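(* Let $\alpha\in\,]0,1[$ and let $\Lambda=z_0+\vec\Lambda$ be a $\mathbb{Z}$-grid in $\mathbb{C}$ (with $\vec\Lambda$ a lattice of covolume $\mathrm{covol}_{\vec\Lambda}$). Let $\phi,\psi:\mathbb{N}\to\,]0,+\infty[$ with $\phi(N)\to+\infty$, $\frac{\phi(N)}{N^{1-\alpha}}\to\lambda\in[0,+\infty]$, and $\psi(N)=\big(\frac{N^{2-\alpha}}{\phi(N)}\big)^2$. For integers $N\geq1$, $N',N''\geq0$ with $N'+N''\geq1$, define $$\mathcal{R}^{\alpha,\Lambda}_{N,N',N''}=\frac{1}{(N'+N'')\psi(N)}\sum_{\substack{m,n\in\Lambda,\ n\neq m\\ 0<|m|,|n|\leq N}}\ \sum_{\substack{r\in\exp^{-1}(m),\ s\in\exp^{-1}(n)\\ |\mathrm{Im}(r)-\mathrm{Im}(s)|<2\pi\\ -2\pi N'\leq \mathrm{Im}(r),\mathrm{Im}(s)<2\pi N''}}\Delta_{\phi(N)(\exp(\alpha s)-\exp(\alpha r))},$$ where $\Delta_w$ is the Dirac mass at $w$ and $\exp^{-1}(m)\subset\mathbb{C}$ is the set of complex logarithms of $m$. Then for every continuous compactly supported $f:\mathbb{C}\to\mathbb{C}$, $\mathcal{R}^{\alpha,\Lambda}_{N,N',N''}(f)\to\int_{\mathbb{C}}f(z)\rho_{\alpha,\vec\Lambda,\lambda}(z)\,dz$ as $\min\{N,N'+N''\}\to\infty$ (i.e. for every $\varepsilon>0$ there is $M$ such that the difference is $<\varepsilon$ whenever $N\geq M$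 and $N'+N''\geq M$).
   Context: The function $\rho_{\alpha,\vec\Lambda,\lambda}:\mathbb{C}\to[0,\infty)$ is defined by: $\rho\equiv0$ if $\lambda=+\infty$; $\rho\equiv\frac{\pi}{\alpha^2(2-\alpha)\mathrm{covol}_{\vec\Lambda}^2}$ if $\lambda=0$; and if $\lambda\in\,]0,+\infty[$, $$\rho_{\alpha,\vec\Lambda,\lambda}(z)=\frac{\alpha^{\frac{2}{1-\alpha}}}{(1-\alpha)\mathrm{covol}_{\vec\Lambda}}\Big(\frac{|z|}{\lambda}\Big)^{-\frac{4-2\alpha}{1-\alpha}}\sum_{\substack{p\in\vec\Lambda\\ |p|\leq\frac{|z|}{\alpha\lambda}}}|p|^{\frac{2}{1-\alpha}}$$ (with value $0$ at $z=0$). $\mathrm{covol}_{\vec\Lambda}$ is the area of a fundamental parallelogram of $\vec\Lambda$. *)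

(* Defs.v *)
From HB Require Import structures.
From mathcomp Require Export all_boot all_order all_algebra.
From mathcomp Require Export complex.
From mathcomp Require Export all_classical all_reals all_analysis.
Export Order.TTheory GRing.Theory Num.Theory.
Export numFieldNormedType.Exports.
Export ComplexField.Normc.

Set Implicit Arguments.
Unset Strict Implicit.
Unset Printing Implicit Defensive.

Local Open Scope classical_set_scope.
Local Open Scope ring_scope.
Local Open Scope complex_scope.

Definition cexp (R : realType) (z : R[i]) : R[i] :=
  (expR (complex.Re z) * cos (complex.Im z)) +i*
  (expR (complex.Re z) * sin (complex.Im z)).

Definition clogs (R : realType) (m : R[i]) : set R[i] := [set r | cexp r = m].

(* A notation, so that the canonical instances of the product measure stay
   visible. *)
Notation lebesgue2 R := (@lebesgue_measure R \x @lebesgue_measure R)%E.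

Definition area (R : realType) (A : set R[i]) : \bar R :=
  (lebesgue2 R) [set p : R * R | A (p.1 +i* p.2)].

(* MathComp-Analysis has no Lebesgue integral of complex-valued functions:
   integrate the real and the imaginary parts against dx dy. *)
Definition cintegral (R : realType) (g : R[i] -> R[i]) : R[i] :=
  (\int[lebesgue2 R]_p complex.Re (g (p.1 +i* p.2))) +i*
  (\int[lebesgue2 R]_p complex.Im (g (p.1 +i* p.2))).

(* L is the lattice Z w1 + Z w2, where (w1, w2) is a basis of C over R. *)
Definition lattice_basis (R : realType) (L : set R[i]) (w1 w2 : R[i]) : Prop :=
  (forall a b : R, a%:C * w1 + b%:C * w2 = 0 -> a = 0 /\ b = 0) /\
  L = [set p | exists a b : int, p = a%:~R * w1 + b%:~R * w2].

Definition fund_parallelogram (R : realType) (w1 w2 : R[i]) : set R[i] :=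
  [set z | exists a b : R,
    [/\ 0 <= a < 1, 0 <= b < 1 & z = a%:C * w1 + b%:C * w2]].

Definition covol (R : realType) (w1 w2 : R[i]) : R :=
  fine (area (fund_parallelogram w1 w2)).

Definition grid (R : realType) (z0 : R[i]) (L : set R[i]) : set R[i] :=
  [set z0 + p | p in L].

(* The case -oo is junk: lambda ranges over [0, +oo]. *)
Definition rho (R : realType) (alpha : R) (L : set R[i]) (cov : R)
    (lambda : \bar R) (z : R[i]) : R :=
  match lambda with
  | EPInf | ENInf => 0
  | EFin l =>
      if l == 0 then pi / (alpha ^+ 2 * (2 - alpha) * cov ^+ 2)
      else if z == 0 then 0
      else alpha `^ (2 / (1 - alpha)) / ((1 - alpha) * cov)
           * (normc z / l) `^ (- ((4 - 2 * alpha) / (1 - alpha)))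
           * \sum_(p \in [set p | L p /\ normc p <= normc z / (alpha * l)])
               normc p `^ (2 / (1 - alpha))
  end.

(* Measures on C are represented by the functionals they induce on
   functions f : C -> C. *)
Definition Dirac (R : realType) (w : R[i]) (f : R[i] -> R[i]) : R[i] := f w.

Definition grid_pairs (R : realType) (La : set R[i]) (N : nat) :
    set (R[i] * R[i]) :=
  [set mn | [/\ La mn.1, La mn.2, mn.2 <> mn.1,
                0 < normc mn.1 <= N%:R & 0 < normc mn.2 <= N%:R]].

Definition log_pairs (R : realType) (m n : R[i]) (N' N'' : nat) :
    set (R[i] * R[i]) :=
  [set rs | [/\ clogs m rs.1, clogs n rs.2,
      `|complex.Im rs.1 - complex.Im rs.2| < 2 * pi,
      - (2 * pi * N'%:R) <= complex.Im rs.1 < 2 * pi * N''%:R &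
      - (2 * pi * N'%:R) <= complex.Im rs.2 < 2 * pi * N''%:R]].

(* Both index sets are finite when La is a grid, so the finitely supported
   sums are plain sums. *)
Definition pair_measure (R : realType) (alpha : R) (La : set R[i])
    (phi psi : nat -> R) (N N' N'' : nat) (f : R[i] -> R[i]) : R[i] :=
  (((N' + N'')%:R * psi N)^-1)%:C *
  \sum_(mn \in grid_pairs La N)
    \sum_(rs \in log_pairs mn.1 mn.2 N' N'')
      Dirac ((phi N)%:C * (cexp (alpha%:C * rs.2) - cexp (alpha%:C * rs.1))) f.

(* C is given the topology of its norm through the regular module R[i]^o. *)
Definition Cc (R : realType) (f : R[i] -> R[i]) : Prop :=
  continuous (f : R[i]^o -> R[i]^o) /\
  compact (closure [set z : R[i]^o | f z <> 0]).

(* Main.v *)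
(* With beta = 1 - alpha, sigma = 2 / beta, lambda_N = phi(N) / N^beta and
   K = N' + N'', one has psi(N) = (N / lambda_N)^2.  A pair (r, s) of logarithms
   of m and n contributes to a compactly supported f only if p = n - m has size
   O(1 / lambda_N); then phi (exp(alpha s) - exp(alpha r)) is close to
   phi alpha p exp(-beta r), and the exceptional m (near the circle |m| = N) and
   branches (at both ends of the window) are negligible.  For a fixed p, the sum
   over m is compared with an integral over the cells of the grid.  The K branches
   of the logarithm unfold the angle into an interval of length 2 pi beta K, so that
   as K grows only circle means survive, and the substitution
   u = phi alpha |p| t^(-beta) gives an integral of f(w) |w|^(-sigma-2) over
   |w| >= alpha lambda_N |p|.  Summing over p produces exactly the integral of f
   against rho for lambda_N.  The conclusion is dominated convergence
   rho_(lambda_N) -> rho_lambda: off finitely many circles if 0 < lambda < oo,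
   by vanishing near 0 if lambda = oo, and by the asymptotics of the sums of |p|^sigma
   over lattice discs if lambda = 0. *)

(* The two limits are independent, and the number of relevant $p$, of order at most $P^2$ with
   $P=4C/(\alpha\lambda_N)$, may grow without bound or drop to zero with $N$. Every error is
   therefore kept proportional to $K(PN)^2$. Since $PN$ is a constant times $N/\lambda_N$, this is a
   constant times the normalization $K\psi(N)$, and the estimates for single $p$ may be added up
   provided that they are uniform in $p$. This uniformity is why $p$ enters only through the
   additive constant $c=\log(\varphi\alpha p)$ of [pt]. It also postpones the three regimes of
   $\lambda$ to the very end, the identity with the density for $\lambda_N$ being exact. The
   divergence of $\varphi$ serves twice: it makes the linearization accurate, and it makes $P$ small
   compared with $N$, so that the boundary annulus is thin. Splitting $f$ into the positive and
   negative parts of its two coordinates makes all integrands nonnegative, so Tonelli and monotone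
   comparison apply before finiteness is known. *)
From HB Require Import structures.
Require Import Defs.
From mathcomp Require Import measurable_realfun.
From mathcomp Require Import ring lra zify.
Set Implicit Arguments.
Unset Strict Implicit.
Unset Printing Implicit Defensive.

Local Open Scope classical_set_scope.
Local Open Scope ring_scope.
Local Open Scope complex_scope.

(* Reifying a large context dominates the cost of [lra] and [lia], hence these
   variants that keep only the order hypotheses of the relevant kind. *)
Ltac clear_bodies := repeat match goal with x := _ |- _ => clearbody x end.

Ltac clra := clear_bodies;
  repeat match goal with H : ?T |- _ =>
    lazymatch type of T with Prop =>
      lazymatch T with
      | is_true (Order.le _ _) => fail
      | is_true (Order.lt _ _) => fail
      | is_true (andb _ _) => fail
      | _ => clear H
      end
    end
  end; lra.

Ltac clia := clear_bodies;
  repeat match goal with H : ?T |- _ =>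
    lazymatch type of T with Prop =>
      lazymatch T with
      | is_true (leq _ _) => fail
      | is_true (negb _) => fail
      | _ => clear H
      end
    end
  end; lia.

(** * Exponential and logarithm on the complex plane *)

Section ComplexExp.
Variable R : realType.
Implicit Types (z w q : R[i]) (x y a : R).

Lemma normcE z : normc z = Num.sqrt (complex.Re z ^+ 2 + complex.Im z ^+ 2).
Proof. by case: z. Qed.

Lemma normc_ge0 z : 0 <= normc z.
Proof. by rewrite normcE sqrtr_ge0. Qed.

Lemma sqr_normcE z : normc z ^+ 2 = complex.Re z ^+ 2 + complex.Im z ^+ 2.
Proof. by rewrite normcE sqr_sqrtr// addr_ge0// sqr_ge0. Qed.

Lemma normc_le z a : 0 <= a ->
  complex.Re z ^+ 2 + complex.Im z ^+ 2 <= a ^+ 2 -> normc z <= a.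
Proof.
move=> a0 h; rewrite -(ler_pXn2r (ltn0Sn 1)) ?nnegrE ?normc_ge0//.
by rewrite sqr_normcE.
Qed.

Lemma Re_le_normc z : `|complex.Re z| <= normc z.
Proof.
rewrite -(ler_pXn2r (ltn0Sn 1)) ?nnegrE ?normc_ge0//.
by rewrite real_normK ?num_real// sqr_normcE lerDl sqr_ge0.
Qed.

Lemma Im_le_normc z : `|complex.Im z| <= normc z.
Proof.
rewrite -(ler_pXn2r (ltn0Sn 1)) ?nnegrE ?normc_ge0//.
by rewrite real_normK ?num_real// sqr_normcE lerDr sqr_ge0.
Qed.

Lemma normc_le_ReIm z : normc z <= `|complex.Re z| + `|complex.Im z|.
Proof.
apply: normc_le; first by rewrite addr_ge0.
rewrite sqrrD !real_normK ?num_real// lerD2r lerDl mulrn_wge0//.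
Qed.

Lemma normcD z w : normc (z + w) <= normc z + normc w.
Proof. exact: le_normcD. Qed.

Lemma normcNE z : normc (- z) = normc z.
Proof. exact: normcN. Qed.

Lemma normcB z w : normc (z - w) <= normc z + normc w.
Proof. by rewrite -(normcNE w) normcD. Qed.

Lemma normcBC z w : normc (z - w) = normc (w - z).
Proof. by rewrite -normcNE opprB. Qed.

Lemma normcB_ge z w : normc z - normc w <= normc (z - w).
Proof. by rewrite lerBlDr (le_trans _ (normcD _ _))// subrK. Qed.

Lemma normcR a : normc a%:C = `|a|.
Proof. by rewrite normcE /= expr0n addr0 sqrtr_sqr. Qed.

Lemma normcZ a z : normc (a%:C * z) = `|a| * normc z.
Proof. by rewrite normcM normcR. Qed.

Lemma normc_gt0 z : (0 < normc z) = (z != 0).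
Proof.
rewrite lt_neqAle normc_ge0 andbT eq_sym; congr (~~ _).
by apply/eqP/eqP => [/eq0_normc//|->]; rewrite normc0.
Qed.

Lemma ReD z w : complex.Re (z + w) = complex.Re z + complex.Re w.
Proof. by case: z; case: w. Qed.
Lemma ImD z w : complex.Im (z + w) = complex.Im z + complex.Im w.
Proof. by case: z; case: w. Qed.
Lemma ReN z : complex.Re (- z) = - complex.Re z. Proof. by case: z. Qed.
Lemma ImN z : complex.Im (- z) = - complex.Im z. Proof. by case: z. Qed.
Lemma ReM z w : complex.Re (z * w) =
  complex.Re z * complex.Re w - complex.Im z * complex.Im w.
Proof. by case: z; case: w. Qed.
Lemma ImM z w : complex.Im (z * w) =
  complex.Re z * complex.Im w + complex.Im z * complex.Re w.
Proof. by case: z; case: w. Qed.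
Lemma ReZ a z : complex.Re (a%:C * z) = a * complex.Re z.
Proof. by rewrite ReM /= mul0r subr0. Qed.
Lemma ImZ a z : complex.Im (a%:C * z) = a * complex.Im z.
Proof. by rewrite ImM /= mul0r addr0. Qed.

Lemma eqC z w : complex.Re z = complex.Re w -> complex.Im z = complex.Im w ->
  z = w.
Proof. by case: z; case: w => ? ? ? ? /= -> ->. Qed.

Lemma cexpD z w : cexp (z + w) = cexp z * cexp w.
Proof.
apply: eqC; rewrite /cexp /= ?ReM ?ImM /= ReD ImD expRD ?cosD ?sinD; ring.
Qed.

Lemma normc_cexp z : normc (cexp z) = expR (complex.Re z).
Proof.
rewrite normcE /cexp /= !exprMn -mulrDr cos2Dsin2 mulr1.
by rewrite sqrtr_sqr ger0_norm// expR_ge0.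
Qed.

Lemma cexp_neq0 z : cexp z != 0.
Proof. by rewrite -normc_gt0 normc_cexp expR_gt0. Qed.

Lemma cexp2pi z : cexp (z + (0 +i* (2 * pi))) = cexp z.
Proof.
rewrite /cexp ReD ImD /= addr0 mulr_natl.
by rewrite cosD2pi sinD2pi.
Qed.

Lemma cexpN2pi z : cexp (z - (0 +i* (2 * pi))) = cexp z.
Proof. by rewrite -[RHS](cexp2pi) -[in RHS](subrK (0 +i* (2 * pi)) z) cexp2pi cexp2pi. Qed.

(** A sum of two nonnegative terms that separates modulus and angle: if the left side is small, both
    the real part and the sine of the half angle are small. *)
Lemma normc_cexpB1 w : normc (cexp w - 1) ^+ 2 =
  (expR (complex.Re w) - 1) ^+ 2
  + 4 * expR (complex.Re w) * sin (complex.Im w / 2) ^+ 2.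
Proof.
rewrite sqr_normcE ReD ImD ReN ImN /= oppr0 addr0.
have e : complex.Im w = (complex.Im w / 2) *+ 2 by rewrite -mulr_natr divfK.
rewrite {1 2}e cos_mulr2n sin_mulr2n.
set X := expR _; set Y := (complex.Im w / 2).
have h : cos Y ^+ 2 = 1 - sin Y ^+ 2 by rewrite -(cos2Dsin2 Y) addrK.
have -> : (X * (cos Y * sin Y *+ 2)) ^+ 2 = 4 * X ^+ 2 * (cos Y ^+ 2) * sin Y ^+ 2.
  by ring.
rewrite h; ring.
Qed.

Lemma sin_le_id x : `|sin x| <= `|x|.
Proof.
wlog x0 : x / 0 <= x => [H|].
  have [/H//|/ltW x0] := leP 0 x.
  by have := H (- x); rewrite oppr_ge0 sinN !normrN; apply.
have [c _] := @MVT_segment _ (@sin R) (@cos R) 0 x x0 (fun y _ => is_derive_sin y)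
  (continuous_subspaceT (@continuous_sin R)).
rewrite sin0 !subr0 => ->; rewrite normrM ler_piMl//.
by rewrite ler_norml cos_geN1 cos_le1.
Qed.

Lemma onemcos_le x : `|cos x - 1| <= x ^+ 2 / 2.
Proof.
have e : x = (x / 2) *+ 2 by rewrite -mulr_natr divfK.
rewrite {1}e cos_mulr2n.
have -> : cos (x / 2) ^+ 2 *+ 2 - 1 - 1 = - (2 * sin (x / 2) ^+ 2).
  have := cos2Dsin2 (x / 2); set c := cos _; set s := sin _ => h.
  have -> : c ^+ 2 = 1 - s ^+ 2 by rewrite -h addrK.
  by ring.
rewrite normrN ger0_norm; last by apply: mulr_ge0 => //; exact: sqr_ge0.
have : sin (x / 2) ^+ 2 <= (x / 2) ^+ 2.
  by have := @lerXn2r _ 2 `|sin (x / 2)| `|x / 2|; rewrite !nnegrE !real_normK ?num_real//;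
    apply => //; exact: sin_le_id.
have -> : x ^+ 2 / 2 = 2 * (x / 2) ^+ 2 by field.
lra.
Qed.

Lemma sinB_le x : `|x| <= 1 -> `|sin x - x| <= x ^+ 2.
Proof.
wlog x0 : x / 0 <= x => [H|].
  have [/H//|/ltW x0] := leP 0 x.
  have := H (- x); rewrite oppr_ge0 sinN !normrN sqrrN -opprD normrN; apply => //.
rewrite ger0_norm// => x1.
have [c] := @MVT_segment _ (fun y => sin y - y) (fun y => cos y - 1) 0 x x0
  (fun y _ => is_deriveB (is_derive_sin y) (is_derive_id y 1))
  (continuous_subspaceT (fun y => @cvgB _ _ _ _ _ _ _ _ _ (@continuous_sin R y) (@cvg_id _ (nbhs y)))).
rewrite in_itv /= => /andP[c0 cx].
rewrite sin0 subrr !subr0 => ->; rewrite normrM (ger0_norm x0).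
apply: (@le_trans _ _ (c ^+ 2 / 2 * x)).
  by rewrite ler_wpM2r// onemcos_le.
nra.
Qed.

(** The tangent inequality at $-x$, multiplied by $e^x$, gives $e^x(1-x)\le1$; with the one at $x$
    this yields all four bounds. *)
Lemma expRB1_bounds x : `|x| <= 2^-1 ->
  [/\ `|expR x - 1| <= 2 * `|x|, `|expR x - 1 - x| <= 2 * x ^+ 2,
      expR x <= 2 & 2^-1 <= expR x].
Proof.
rewrite ler_norml => /andP[xl xu].
have h1 := expR_ge1Dx x.
have h2 := expR_ge1Dx (- x).
have e : expR x * expR (- x) = 1 by rewrite expRN divff// gt_eqF ?expR_gt0.
have h3 : expR x * (1 - x) <= 1 
  by rewrite -[leRHS]e; apply: ler_wpM2l => //; exact: expR_ge0.
have p := expR_gt0 x.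
have h4 : expR x - 1 - x <= 2 * x ^+ 2 by nra.
have h5 : expR x <= 2 by nra.
have h6 : 2^-1 <= expR x by lra.
split => //.
- case: (lerP 0 x) => x0; rewrite ?(ger0_norm x0) ?(ltr0_norm x0) ler_norml; apply/andP; split; nra.
- by rewrite ler_norml; apply/andP; split; nra.
Qed.

Lemma cexp_taylor w : normc w <= 2^-1 ->
  normc (cexp w - 1 - w) <= 8 * normc w ^+ 2.
Proof.
move=> wh.
have hx := le_trans (Re_le_normc w) wh.
have hy := le_trans (Im_le_normc w) wh.
apply: (le_trans (normc_le_ReIm _)); rewrite !ReD !ImD !ReN !ImN /= oppr0 addr0.
have [e1 e2 e3 e4] := expRB1_bounds hx.
have c1 := onemcos_le (complex.Im w).
have s1 := sin_le_id (complex.Im w).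
have s2 := sinB_le (le_trans hy (_ : 2^-1 <= 1)).
rewrite sqr_normcE; set x := complex.Re w in hx e1 e2 e3 e4 *.
set y := complex.Im w in hy c1 s1 s2 *.
have -> : expR x * cos y - 1 - x = (expR x - 1 - x) + expR x * (cos y - 1) by ring.
have -> : expR x * sin y - y = (expR x - 1) * sin y + (sin y - y) by ring.
have t1 : `|expR x * (cos y - 1)| <= 2 * (y ^+ 2 / 2).
  by rewrite normrM ler_pM// ger0_norm// expR_ge0.
have t2 : `|(expR x - 1) * sin y| <= (2 * `|x|) * `|y| by rewrite normrM ler_pM.
have n1 := ler_normD (expR x - 1 - x) (expR x * (cos y - 1)).
have n2 := ler_normD ((expR x - 1) * sin y) (sin y - y).
have xx : `|x| ^+ 2 = x ^+ 2 by rewrite real_normK ?num_real.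
have yy : `|y| ^+ 2 = y ^+ 2 by rewrite real_normK ?num_real.
have := sqr_ge0 (`|x| - `|y|).
have := s2 ltac:(lra) => s2'.
rewrite sqrrB xx yy; nra.
Qed.

(** The radius 1/16 is chosen so that the Taylor remainder $8|w|^2$ is at most $|w|/2$. *)
Lemma cexpB1_bounds w : normc w <= 16^-1 ->
  normc w / 2 <= normc (cexp w - 1) <= 2 * normc w.
Proof.
move=> h; have h' : normc w <= 2^-1 by apply: le_trans h _; lra.
have := cexp_taylor h'; have n0 := normc_ge0 w.
have := normcD (cexp w - 1 - w) w; rewrite subrK.
have := normcB_ge w (- (cexp w - 1 - w)); rewrite opprK normcNE.
rewrite [w + _]addrC subrK => a b c; have : 8 * normc w ^+ 2 <= normc w / 2 by nra.
move=> d; apply/andP; split; lra.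
Qed.

(** On $[0,\pi k]$ the sine increases up to $\pi/2$ and then decreases to $\sin(\pi k)>0$, so it is
    small only near 0. *)
Lemma sin_gt0_small (k e : R) : 0 < k < 1 -> 0 < e -> exists2 d : R, 0 < d &
  forall y, `|y| <= pi * k -> `|sin y| < d -> `|y| < e.
Proof.
move=> /andP[k0 k1] e0.
have pi0 := @pi_gt0 R.
pose e1 := Num.min e (pi / 2).
have e10 : 0 < e1 by rewrite lt_min e0 divr_gt0.
have e1p : e1 <= pi / 2 by rewrite ge_min lexx orbT.
exists (Num.min (sin e1) (sin (pi * k))).
  rewrite lt_min; apply/andP; split; apply: sin_gt0_pi; apply/andP; split; nra.
move=> y; wlog y0 : y / 0 <= y => [H|].
  have [/H//|/ltW y0] := leP 0 y.
  by have := H (- y); rewrite oppr_ge0 sinN !normrN; apply.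
rewrite (ger0_norm y0) => yk.
rewrite ger0_norm; last by apply: sin_ge0_pi; apply/andP; split => //; nra.
rewrite lt_min => /andP[s1 s2].
rewrite ltNge; apply/negP => ey.
have e1y : e1 <= y by rewrite ge_min ey.
have [yp|yp] := leP y (pi / 2).
  move: s1; apply/negP; rewrite -leNgt.
  rewrite leNgt ltr_sin ?in_itv/= -?leNgt//; apply/andP; split; lra.
move: s2; apply/negP; rewrite -leNgt.
rewrite -(cosBpihalf) -(cosBpihalf y).
rewrite leNgt ltr_cos ?in_itv/= -?leNgt; [lra|apply/andP; split; nra|apply/andP; split; nra].
Qed.

(** The factor $k<1$ keeps [w] away from $\pm2\pi i$, the nearest other preimages of 1. It is
    applied with $k=1/2$ to principal logarithms and with $k=\alpha$ to logarithms multiplied by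
    $\alpha$. *)
Lemma cexp_near1 (k e : R) : 0 < k < 1 -> 0 < e -> exists2 d : R, 0 < d &
  forall w, `|complex.Im w| <= 2 * pi * k -> normc (cexp w - 1) < d ->
  normc w < e.
Proof.
move=> k01 e0.
have [d1 d10 H1] := sin_gt0_small k01 (divr_gt0 e0 (ltr0n R 4 : 0 < 4%:R)).
pose d := Num.min (Num.min d1 (e / 8)) (1 / 4).
have d0 : 0 < d by rewrite !lt_min d10 !divr_gt0.
exists d => // w Iw hw.
have [dd1 dd2 dd3] : [/\ d <= d1, d <= e / 8 & d <= 1 / 4].
  by split; rewrite !ge_min lexx ?orbT.
have n0 := normc_ge0 (cexp w - 1).
have s : normc (cexp w - 1) ^+ 2 < d ^+ 2 by nra.
rewrite normc_cexpB1 in s.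
set X := complex.Re w in s *; set Y := complex.Im w in Iw s *.
have X0 := expR_gt0 X.
have sy2 : 0 <= sin (Y / 2) ^+ 2 := sqr_ge0 _.
have s1 : `|expR X - 1| < d.
  rewrite -(ltr_pXn2r (ltn0Sn 1)) ?nnegrE ?(ltW d0)// real_normK ?num_real//.
  apply: le_lt_trans s; rewrite lerDl mulr_ge0// mulr_ge0// ltW//.
have /andP[s1a s1b] : - d < expR X - 1 < d by rewrite -ltr_norml.
have s2 : `|sin (Y / 2)| < d.
  rewrite -(ltr_pXn2r (ltn0Sn 1)) ?nnegrE ?(ltW d0)// real_normK ?num_real//.
  have := sqr_ge0 (expR X - 1); nra.
have hy : `|Y| < e / 2.
  have := H1 (Y / 2); rewrite normrM (@ger0_norm _ 2^-1)//.
  have pi0 := @pi_gt0 R.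
  move=> h; have := h ltac:(lra) (lt_le_trans s2 dd1); lra.
have hx : `|X| < e / 2.
  have h1 := expR_ge1Dx X; have h2 := expR_ge1Dx (- X).
  have ee : expR X * expR (- X) = 1 by rewrite expRN divff// gt_eqF.
  have h3 : expR X * (1 - X) <= 1 
    by rewrite -[leRHS]ee; apply: ler_wpM2l => //; exact: ltW.
  rewrite ltr_norml; apply/andP; split; last by lra.
  rewrite ltNge; apply/negP => Xe; nra.
by apply: le_lt_trans (normc_le_ReIm w) _; rewrite -/X -/Y; lra.
Qed.

(** For $u=z-w$ both terms of [normc_cexpB1] vanish, and the sine of the half angle has no other
    zero in $]-\pi,\pi[$. *)
Lemma cexp_inj z w : `|complex.Im z - complex.Im w| < 2 * pi ->
  cexp z = cexp w -> z = w.
Proof.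
move=> I E; pose u := z - w.
have zE : z = w + u by rewrite /u addrC subrK.
have u1 : cexp u = 1.
  by apply: (mulfI (cexp_neq0 w)); rewrite -cexpD -zE E mulr1.
have : normc (cexp u - 1) = 0 by rewrite u1 subrr normc0.
have := normc_cexpB1 u => /[swap] ->; rewrite expr0n /= => /esym/eqP.
have pi0 := @pi_gt0 R.
have X0 := expR_gt0 (complex.Re u).
rewrite paddr_eq0 ?sqr_ge0//; last by apply: mulr_ge0; [apply: mulr_ge0 => //; exact: ltW|exact: sqr_ge0].
rewrite sqrf_eq0 subr_eq0 -[X in _ == X]expR0 (inj_eq (@expR_inj R)) => /andP[/eqP Re0].
rewrite mulf_eq0 sqrf_eq0 mulf_eq0 pnatr_eq0 /= gt_eqF//= => /eqP s0.
suff : u = 0 by rewrite zE => ->; rewrite addr0.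
apply: eqC => //=.
have hy : `|complex.Im u| < 2 * pi by rewrite ImD ImN.
apply/eqP; rewrite eq_le !leNgt; apply/andP; split; apply/negP => y0.
- have := @sin_gt0_pi R (complex.Im u / 2).
  rewrite s0 ltxx; move: hy; rewrite gtr0_norm// => hy h.
  suff: false by []; apply: h; apply/andP; split; lra.
- have := @sin_gt0_pi R (- (complex.Im u / 2)).
  rewrite sinN s0 oppr0 ltxx; move: hy; rewrite ltr0_norm// => hy h.
  suff: false by []; apply: h; apply/andP; split; lra.
Qed.

(* The argument in [0, 2 pi[, with junk value pi / 2 at the origin. *)
Definition carg z : R :=
  if 0 <= complex.Im z then acos (complex.Re z / normc z)
  else 2 * pi - acos (complex.Re z / normc z).

Definition clog z : R[i] := ln (normc z) +i* carg z.

Lemma Re_clog z : complex.Re (clog z) = ln (normc z).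
Proof. by []. Qed.

Lemma cos_arg_itv z : -1 <= complex.Re z / normc z <= 1.
Proof.
rewrite -ler_norml normrM normfV (ger0_norm (normc_ge0 z)).
have [->|z0] := eqVneq z 0; first by rewrite normr0 mul0r.
by rewrite ler_pdivrMr ?normc_gt0// mul1r Re_le_normc.
Qed.

Lemma clog_spec z : z != 0 -> 0 <= carg z < 2 * pi /\ cexp (clog z) = z.
Proof.
move=> z0; have n0 : 0 < normc z by rewrite normc_gt0.
have pi0 := @pi_gt0 R.
have c1 := cos_arg_itv z; rewrite /clog /carg; set c := complex.Re z / normc z in c1 *.
have cz : complex.Re z = normc z * c by rewrite /c mulrC divfK// gt_eqF.
have s2 : (normc z * Num.sqrt (1 - c ^+ 2)) ^+ 2 = complex.Im z ^+ 2.
  rewrite exprMn sqr_sqrtr; last by rewrite subr_ge0 -real_normK ?num_real// expr_le1// ler_norml.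
  rewrite mulrBr mulr1 -exprMn -cz sqr_normcE; ring.
have s3 : normc z * Num.sqrt (1 - c ^+ 2) = `|complex.Im z|.
  apply: (pexpIrn (ltn0Sn 1)); rewrite ?nnegrE ?mulr_ge0 ?sqrtr_ge0 ?normc_ge0//.
  by rewrite s2 real_normK ?num_real.
have a0 := acos_ge0 c1; have api := acos_lepi c1.
have [y0|y0] := leP 0 (complex.Im z).
  split; first by apply/andP; split; lra.
  apply: eqC; rewrite /cexp /= lnK ?posrE//.
    by rewrite acosK// in_itv.
  by rewrite sin_acos// s3 ger0_norm.
split.
  apply/andP; split; first lra.
  (* The cosine cannot be 1 because the imaginary part is not 0; this keeps the reflected argument
     strictly below $2\pi$. *)
  have : 0 < acos c; last lra.
  rewrite acos_gt0//; move: c1 => /andP[-> c1] /=.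
  rewrite lt_neqAle c1 andbT; apply/eqP => ce.
  by move: s3; rewrite ce expr1n subrr sqrtr0 mulr0 => /esym/eqP; rewrite normr_eq0 lt_eqF.
apply: eqC; rewrite /cexp /= lnK ?posrE// mulr_natl addrC.
  by rewrite cosD2pi cosN acosK// in_itv.
by rewrite sinD2pi sinN sin_acos// mulrN s3 ltr0_norm// opprK.
Qed.

Lemma carg_itv z : z != 0 -> 0 <= carg z < 2 * pi.
Proof. by move=> /clog_spec[]. Qed.

Lemma clogK z : z != 0 -> cexp (clog z) = z.
Proof. by move=> /clog_spec[]. Qed.

Lemma cargE t a : 0 <= a < 2 * pi -> carg (cexp (t +i* a)) = a.
Proof.
move=> aa; have z0 := cexp_neq0 (t +i* a).
have := carg_itv z0; have := clogK z0.
rewrite /clog normc_cexp /= expRK => /cexp_inj /= h cc.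
have : t +i* carg (cexp (t +i* a)) = t +i* a.
  by apply: h; rewrite ltr_norml; apply/andP; split; lra.
by move=> /(congr1 (@complex.Im R)).
Qed.

Lemma cexp_local_log (e : R) : 0 < e -> exists2 d : R, 0 < d &
  forall q, normc q < d -> exists w, [/\ cexp w = 1 + q,
    normc w < e & normc w <= 2 * normc q].
Proof.
move=> e0; have pi0 := @pi_gt0 R.
have [d d0 H] := @cexp_near1 2^-1 (Num.min e 16^-1) ltac:(lra) ltac:(rewrite lt_min e0; lra).
exists (Num.min d 1); first by rewrite lt_min d0 ltr01.
move=> q; rewrite lt_min => /andP[qd q1].
have z0 : 1 + q != 0.
  rewrite -normc_gt0; have := normcB_ge 1 (- q); rewrite normcNE normc1 opprK; lra.
have t1 := carg_itv z0; have te := esym (clogK z0); rewrite /clog in te; set t := carg _ in t1 te.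
(* Arguments from $\pi$ on are lowered by a full turn, so that [w] lies in the strip
   $|\mathrm{Im}|\le\pi$ where [cexp_near1] applies. *)
pose w := (ln (normc (1 + q)) +i* (if t < pi then t else t - 2 * pi)).
have we : cexp w = 1 + q.
  rewrite [RHS]te /w; case: ifP => // _; rewrite -[RHS]cexpN2pi.
  by congr cexp; apply: eqC => /=; rewrite ?subr0.
have hw : normc w < Num.min e 16^-1.
  apply: H; last by rewrite we addrAC subrr add0r.
  by rewrite /w /=; case: ifP => tp; rewrite ler_norml; apply/andP; split; lra.
move: hw; rewrite lt_min => /andP[we1 /ltW/cexpB1_bounds/andP[h _]].
exists w; split => //; move: h; rewrite we addrAC subrr add0r; lra.
Qed.

End ComplexExp.

(** * Integration in the plane *)

Section Restriction.
Context d (T : measurableType d) (R : realType).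
Variables (mu : {measure set T -> \bar R}) (D : set T) (mD : measurable D).
Local Open Scope ereal_scope.

Lemma ge0_integral_mrestr (f : T -> \bar R) : measurable_fun setT f ->
  (forall x, 0 <= f x) -> \int[mrestr mu mD]_x f x = \int[mu]_(x in D) f x.
Proof.
move=> mf f0; rewrite -(setvU D) ge0_integral_setU//; last 3 first.
- exact: measurableC.
- exact: measurable_funTS.
- exact/disj_setPLR.
rewrite (@eq_measure_integral _ _ _ _ mzero); last first.
  move=> A mA AD; rewrite /mrestr /mzero /=.
  have -> : mrestr mu mD A = mu (A `&` D) by [].
  by rewrite (_ : A `&` D = set0) ?measure0// disjoints_subset.
rewrite integral_measure_zero add0e; apply: eq_measure_integral => A mA AD.
by rewrite /mrestr /=; congr (mu _); apply/setIidPl.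
Qed.
End Restriction.

(** * Change of variables on the line *)

Section Substitution.
Variable R : realType.
Notation mu := (@lebesgue_measure R).
Notation mu2 := (lebesgue2 R).
Implicit Types (g w : R -> R) (h : R -> \bar R).
Local Open Scope ereal_scope.

Section density.
Let T1 := measurableTypeR R.
Variables (g w : R -> R).
Hypotheses (mg : measurable_fun setT g) (mw : measurable_fun setT w).
Hypothesis w0 : forall x, (0 <= w x)%R.

(** The region under the graph of [w]. Plane measure restricted to it and projected by
    $g\circ\mathrm{fst}$ is the image under [g] of the measure with density [w], obtained as a
    genuine measure. *)
Let S : set (T1 * T1) := [set p : R * R | (0 <= p.2 < w p.1)%R].

Let mS : measurable S.
Proof.
have -> : S = [set p : R * R | (0 <= p.2)%R] `&` [set p : R * R | (p.2 < w p.1)%R].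
  by apply/seteqP; split => p /=; [move/andP|move=> h; apply/andP].
apply: measurableI.
  rewrite -[X in measurable X]setTI.
  have := @measurable_fun_ler _ _ R setT (cst 0%R) (@snd R R) (measurable_cst _) measurable_snd.
  by move=> /(_ measurableT [set true] ltac:(by [])).
have := @measurable_fun_ltr _ _ R setT (@snd R R) (w \o @fst R R)
   measurable_snd (measurableT_comp mw measurable_fst).
move=> /(_ measurableT [set true] ltac:(by [])).
by rewrite setTI.
Qed.

Let gf : T1 * T1 -> T1 := g \o fst.
Let mgf : measurable_fun setT gf.
Proof. exact: measurableT_comp mg measurable_fst. Qed.
Let gfm := isMeasurableFun.Build _ _ _ _ _ mgf.
Let gfp : {mfun _ >-> _} := HB.pack gf gfm.

Local Notation nu := (pushforward (mrestr mu2 mS) gfp).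

Let nuE h : measurable_fun setT h -> (forall x, 0 <= h x) ->
  \int[nu]_x h x = \int[mu]_x (h (g x) * (w x)%:E).
Proof.
move=> mh h0.
rewrite ge0_integral_pushforward//= ge0_integral_mrestr//; last first.
  exact: measurableT_comp.
rewrite integral_mkcond fubini_tonelli1; last 2 first.
- apply/(measurable_restrictT _ mS); apply: measurable_funTS; exact: measurableT_comp.
- by move=> p; rewrite patchE; case: ifP.
apply: eq_integral => x _; rewrite /fubini_F /=.
transitivity (\int[mu]_(y in `[0%R, w x[) (h (g x))).
  rewrite [RHS]integral_mkcond; apply: eq_integral => y _.
  by rewrite !patchE !mem_setE /S /= in_itv.
rewrite integral_cst//= lebesgue_measure_itv /= lte_fin.
case: ltP => [_|w00]; first by rewrite oppr0 adde0.
by have -> : w x = 0%R by apply/eqP; rewrite eq_le w00 w0.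
Qed.

Hypothesis H : forall a b, (a < b)%R ->
  \int[mu]_x ((\1_(`]a, b]%classic) (g x))%:E * (w x)%:E) = (b - a)%:E.

(** A measure with the right value on all intervals $]a,b]$ is Lebesgue measure, and [H] provides
    exactly these values for [nu]. *)
Lemma substitution_density h : measurable_fun setT h -> (forall x, 0 <= h x) ->
  \int[mu]_x (h (g x) * (w x)%:E) = \int[mu]_x h x.
Proof.
move=> mh h0; rewrite -nuE//; apply: eq_measure_integral => A mA _.
apply/esym; apply: lebesgue_measure_unique => // _ [[a b] _ <-] /=.
have := @nuE (EFin \o \1_(`]a, b]%classic)).
rewrite integral_indic// setIT => ->; last 2 first.
- by apply/measurable_EFinP; exact: measurable_indic.
- by move=> x; rewrite lee_fin.
rewrite lebesgue_measure_itv /= lte_fin; case: ltP => [ab|ab].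
  by rewrite H// EFinB.
rewrite integral0_eq// => x _.
rewrite indicE [x in _ \in x]set_itv_ge ?in_set0 ?mul0e//.
by rewrite bnd_simp -leNgt.
Qed.
End density.

Lemma integral_affine (c e : R) h : (0 < c)%R -> measurable_fun setT h ->
  (forall x, 0 <= h x) -> \int[mu]_x (h (c * x + e)%R * c%:E) = \int[mu]_x h x.
Proof.
move=> c0 mh h0; apply: (@substitution_density (fun x => c * x + e)%R (cst c)) => //.
- by apply: measurable_funD => //; exact: measurable_funM.
- by move=> x; exact: ltW.
move=> a b ab.
transitivity (\int[mu]_x ((\1_(`]((a - e) / c)%R, ((b - e) / c)%R]%classic) x)%:E * c%:E)).
  apply: eq_integral => x _; congr (_%:E * _); rewrite !indicE !mem_setE !in_itv /=.
  by rewrite ltr_pdivrMr// ler_pdivlMr// ltrBlDr lerBrDr mulrC.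
rewrite ge0_integralZr//; last 2 first.
- by apply/measurable_EFinP; exact: measurable_indic.
- by rewrite lee_fin ltW.
rewrite integral_indic//= setIT lebesgue_measure_itv /= lte_fin ltr_pM2r ?invr_gt0// ltrD2r ab.
rewrite -EFinD -EFinM; congr _%:E; field.
by rewrite gt_eqF.
Qed.

Lemma integral_shift (e : R) h : measurable_fun setT h ->
  (forall x, 0 <= h x) -> \int[mu]_x h (x + e)%R = \int[mu]_x h x.
Proof.
move=> mh h0; rewrite -(@integral_affine 1 e h)//.
by apply: eq_integral => x _; rewrite mul1r mule1.
Qed.

Lemma integral_opp h : measurable_fun setT h ->
  (forall x, 0 <= h x) -> \int[mu]_x h (- x)%R = \int[mu]_x h x.
Proof.
move=> mh h0; rewrite -(@substitution_density -%R (cst 1%R) _ _ _ _ h)//.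
- by apply: eq_integral => x _; rewrite mule1.
move=> a b ab.
transitivity (\int[mu]_x ((\1_(`[(- b)%R, (- a)%R[%classic) x)%:E)).
  apply: eq_integral => x _; rewrite mule1; congr (_%:E); rewrite !indicE !mem_setE !in_itv /=.
  by rewrite ltrNr lerNl andbC.
rewrite integral_indic//= setIT lebesgue_measure_itv /= lte_fin ltrN2 ab.
by rewrite opprK addeC.
Qed.

Definition itvD : set R := `](- (pi / 2))%R, (pi / 2)%R[%classic.

(** The Jacobian of the tangent, cut off outside one period so that [atan] is the inverse. *)
Definition tanw (t : R) : R := ((fun t => cos t ^- 2) \_ itvD)%R t.

Lemma cosD_gt0 (t : R) : itvD t -> (0 < cos t)%R.
Proof. by rewrite /itvD /= in_itv /= => ?; exact: cos_gt0_pihalf. Qed.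

Lemma measurable_tanw : measurable_fun setT tanw.
Proof.
apply: (proj1 (measurable_restrictT (fun t : R => (cos t ^- 2)%R) (measurable_itv _))).
apply: open_continuous_measurable_fun; first exact: interval_open.
move=> t /set_mem Dt; apply: cvgV; first by rewrite expf_neq0// gt_eqF// cosD_gt0.
by apply: cvgM; exact: continuous_cos.
Qed.

Lemma tanw_ge0 t : (0 <= tanw t)%R.
Proof. by rewrite /tanw patchE; case: ifP => // _; rewrite invr_ge0 sqr_ge0. Qed.

(** On the preimage of $]a,b]$ this is the fundamental theorem of calculus between [atan a] and
    [atan b]. *)
Lemma integral_tan h : measurable_fun setT h -> (forall x, 0 <= h x) ->
  \int[mu]_t (h (((@tan R) \_ itvD) t) * (tanw t)%:E) = \int[mu]_x h x.
Proof.
apply: substitution_density; [|exact: measurable_tanw|exact: tanw_ge0|].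
  apply: (proj1 (measurable_restrictT (@tan R) (measurable_itv _))).
  apply: open_continuous_measurable_fun; first exact: interval_open.
  by move=> t /set_mem Dt; apply: continuous_tan; rewrite gt_eqF// cosD_gt0.
move=> a b ab.
have aab : (atan a < atan b)%R by exact: lt_atan.
transitivity (\int[mu]_(t in `[(atan a), (atan b)]) ((cos t) ^- 2)%:E).
  rewrite -integral_itv_obnd_cbnd; last first.
    apply/measurable_EFinP; apply: (@measurable_funS _ _ _ _ itvD); first exact: measurable_itv.
      move=> t; rewrite /itvD /= !in_itv /= => /andP[t1 t2].
      by rewrite (lt_trans (atan_gtNpi2 a))// (le_lt_trans t2)// atan_ltpi2.
    exact: (proj2 (measurable_restrictT (fun t : R => (cos t ^- 2)%R) (measurable_itv _)) measurable_tanw).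
  rewrite [RHS]integral_mkcond; apply: eq_integral => t _.
  rewrite /tanw !patchE !indicE !mem_setE.
  case: ifPn => [tD|tD].
    have tab : (t \in `]atan a, atan b]) = (tan t \in `]a, b]).
      have tD' : t \in `](- (pi / 2))%R, (pi / 2)%R[ by [].
      rewrite !in_itv /= -{2}(atanK a) -{2}(atanK b).
      rewrite ltr_tan ?in_itv/= ?atan_gtNpi2 ?atan_ltpi2//.
      by rewrite [in RHS]leNgt ltr_tan ?in_itv/= ?atan_gtNpi2 ?atan_ltpi2// -leNgt.
    by rewrite tab; case: ifP; rewrite ?mul1e ?mul0e.
  (* Outside the period the restricted tangent takes the default value 0, which may lie in $]a,b]$;
     the weight vanishes there. *)
  rewrite mule0; case: ifP => //.
  rewrite in_itv /= => /andP[t1 t2]; move: tD; rewrite in_itv /=.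
  by rewrite (lt_trans (atan_gtNpi2 a))// (le_lt_trans t2)// atan_ltpi2.
have Dab t : t \in `[atan a, atan b] -> itvD t.
  rewrite /itvD /= !in_itv /= => /andP[t1 t2].
  by rewrite (lt_le_trans (atan_gtNpi2 a))// (le_lt_trans t2)// atan_ltpi2.
rewrite (@continuous_FTC2 _ _ (@tan R))//.
- by rewrite !atanK.
- apply: continuous_in_subspaceT => t; rewrite inE => /Dab Dt.
  apply: cvgV; first by rewrite expf_neq0// gt_eqF// cosD_gt0.
  by apply: cvgM; exact: continuous_cos.
- have ct t : t \in `[atan a, atan b] -> {for t, continuous (@tan R)}.
    by move=> /Dab Dt; apply: continuous_tan; rewrite gt_eqF// cosD_gt0.
  split.
  + move=> t tab; apply: derivable_tan; rewrite gt_eqF// cosD_gt0//.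
    by apply: Dab; exact: subset_itv_oo_cc tab.
  + apply: cvg_at_right_filter; apply: ct; rewrite in_itv/= lexx; exact: ltW.
  + apply: cvg_at_left_filter; apply: ct; rewrite in_itv/= lexx andbT; exact: ltW.
- move=> t tab; have Dt : itvD t by apply: Dab; exact: subset_itv_oo_cc tab.
  rewrite derive1E; have := is_derive_tan (lt0r_neq0 (cosD_gt0 Dt)).
  by move=> [_ ->].
Qed.

End Substitution.

(** * Polar coordinates *)

Section Polar.
Variable R : realType.
Notation mu := (@lebesgue_measure R).
Notation mu2 := (lebesgue2 R).
Local Open Scope ereal_scope.

Definition preserving (g : R -> R) := measurable_fun setT g /\
  forall h : R -> \bar R, measurable_fun setT h -> (forall x, 0 <= h x) ->
  \int[mu]_x h (g x) = \int[mu]_x h x.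

Lemma preserving_shift (e : R) : preserving (fun x => x + e)%R.
Proof.
split; first by apply: measurable_funD.
by move=> h mh h0; exact: integral_shift.
Qed.

Lemma preserving_opp : preserving (fun x => - x)%R.
Proof.
split; first exact: measurable_funN.
by move=> h mh h0; exact: integral_opp.
Qed.

Lemma measurable_map2 (g1 g2 : R -> R) :
  measurable_fun setT g1 -> measurable_fun setT g2 ->
  measurable_fun setT (fun p : R * R => (g1 p.1, g2 p.2)).
Proof.
move=> m1 m2; apply: measurable_fun_pair.
- exact: (measurableT_comp m1 measurable_fst).
- exact: (measurableT_comp m2 measurable_snd).
Qed.

Lemma integral2_map (g1 g2 : R -> R) (G : R * R -> \bar R) :
  preserving g1 -> preserving g2 -> measurable_fun setT G ->
  (forall p, 0 <= G p) ->
  \int[mu2]_p G (g1 p.1, g2 p.2) = \int[mu2]_p G p.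
Proof.
move=> [m1 p1] [m2 p2] mG G0.
rewrite fubini_tonelli1//; last first.
  exact: (measurableT_comp mG (measurable_map2 m1 m2)).
rewrite [RHS]fubini_tonelli1// -[RHS]p1; last 2 first.
- exact: measurable_fun_fubini_tonelli_F.
- by move=> x; apply: integral_ge0 => y _.
apply: eq_integral => x _; rewrite /fubini_F /=.
by apply: (p2 (fun y => G (g1 x, y))) => //; exact: measurableT_comp.
Qed.

Lemma integral2_swap (G : R * R -> \bar R) : measurable_fun setT G ->
  (forall p, 0 <= G p) ->
  \int[mu2]_p G (p.2, p.1) = \int[mu2]_p G p.
Proof.
move=> mG G0; rewrite fubini_tonelli2//; last first.
  exact: (measurableT_comp mG (measurable_fun_pair measurable_snd measurable_fst)).
by rewrite [RHS]fubini_tonelli1.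
Qed.

Definition polar (q : R * R) : R * R := (q.1 * cos q.2, q.1 * sin q.2)%R.

Lemma measurable_polar : measurable_fun setT polar.
Proof.
apply: measurable_fun_pair; apply: measurable_funM;
  do ?exact: measurable_fst.
- exact: (measurableT_comp (continuous_measurable_fun (@continuous_cos R)) measurable_snd).
- exact: (measurableT_comp (continuous_measurable_fun (@continuous_sin R)) measurable_snd).
Qed.

Definition posR : set R := `]0%R, +oo[%classic.

Lemma posRE (x : R) : (x \in posR) = (0 < x)%R.
Proof. by rewrite mem_setE in_itv /= andbT. Qed.

Lemma measurable_indic1 (A : set R) : measurable A ->
  measurable_fun setT (fun p : R * R => \1_A p.1 : R).
Proof.
by move=> mA; exact: (measurableT_comp (@measurable_indic _ _ R setT A mA) measurable_fst).
Qed.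

Lemma measurable_indic2 (A : set R) : measurable A ->
  measurable_fun setT (fun p : R * R => \1_A p.2 : R).
Proof.
by move=> mA; exact: (measurableT_comp (@measurable_indic _ _ R setT A mA) measurable_snd).
Qed.

Definition polar_integrand (A : set R) (G : R * R -> R) (q : R * R) : R :=
  (\1_posR q.1 * \1_A q.2 * G (polar q) * q.1)%R.

Lemma measurable_polar_integrand A G : measurable A -> measurable_fun setT G ->
  measurable_fun setT (polar_integrand A G).
Proof.
move=> mA mG; apply: measurable_funM; last exact: measurable_fst.
apply: measurable_funM; last exact: (measurableT_comp mG measurable_polar).
apply: measurable_funM; last exact: measurable_indic2.
by apply: measurable_indic1; exact: measurable_itv.
Qed.

Lemma polar_integrand_ge0 A G q : (forall p, 0 <= G p)%R ->
  (0 <= polar_integrand A G q)%R.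
Proof.
move=> G0; rewrite /polar_integrand indicE posRE.
by case: ltP => q0; rewrite ?mul0r// mul1r mulr_ge0 ?mulr_ge0// ltW.
Qed.

(** Two one-dimensional substitutions replace a planar one: on the right half-plane put $y=x\tan t$
    for fixed $x$, exchange the integrals, then put $x=r\cos t$ for fixed $t$. The Jacobians
    multiply to $r\cos t\cdot\cos^{-2}t\cdot\cos t=r$. *)
Lemma polar_half (G : R * R -> R) : measurable_fun setT G ->
  (forall p, 0 <= G p)%R ->
  \int[mu2]_p (G p * \1_posR p.1)%:E =
  \int[mu2]_q (polar_integrand (@itvD R) G q)%:E.
Proof.
move=> mG G0.
have mpos : measurable posR by exact: measurable_itv.
have mD : measurable (@itvD R) by exact: measurable_itv.
pose tanD := ((@tan R) \_ (@itvD R)).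
have mtanD : measurable_fun setT tanD.
  apply: (proj1 (measurable_restrictT (@tan R) (measurable_itv _))).
  apply: open_continuous_measurable_fun; first exact: interval_open.
  by move=> t /set_mem Dt; apply: continuous_tan; rewrite gt_eqF// cosD_gt0.
pose H (p : R * R) : R := (\1_posR p.1 * G (p.1, p.1 * tanD p.2) * p.1 * tanw p.2)%R.
have mH : measurable_fun setT H.
  apply: measurable_funM; last exact: (measurableT_comp (@measurable_tanw R) measurable_snd).
  apply: measurable_funM; last exact: measurable_fst.
  apply: measurable_funM; first exact: measurable_indic1.
  apply: (measurableT_comp mG); apply: measurable_fun_pair; first exact: measurable_fst.
  apply: measurable_funM; first exact: measurable_fst.
  exact: (measurableT_comp mtanD measurable_snd).
have H0 p : (0 <= H p)%R.
  rewrite /H indicE posRE; case: ltP => q0; rewrite ?mul0r// mul1r.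
  by rewrite !mulr_ge0// ?tanw_ge0// ltW.
transitivity (\int[mu]_x \int[mu]_t (H (x, t))%:E).
  rewrite fubini_tonelli1; last 2 first.
  - by apply/measurable_EFinP; apply: measurable_funM => //; exact: measurable_indic1.
  - by move=> p; rewrite lee_fin mulr_ge0.
  apply: eq_integral => x _; rewrite /fubini_F /=.
  have [x0|x0] := ltP 0%R x; last first.
    have x0' : (\1_posR x : R) = 0%R by rewrite indicE posRE ltNge x0.
    rewrite !integral0_eq// => y _; rewrite /H /= x0' ?mulr0// !mul0r//.
  have x1 : (\1_posR x : R) = 1%R by rewrite indicE posRE x0.
  under eq_integral do rewrite x1 mulr1.
  rewrite -(@integral_affine _ x 0 (fun y => (G (x, y))%:E))//; last 2 first.
  - by apply/measurable_EFinP; exact: measurableT_comp.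
  - by move=> y; rewrite lee_fin.
  rewrite -(@integral_tan _ (fun y => (G (x, (x * y + 0)%R))%:E * x%:E)); last 2 first.
  - apply/measurable_EFinP; apply: measurable_funM => //.
    apply: (measurableT_comp mG); apply: measurable_fun_pair => //.
    by apply: measurable_funD => //; apply: measurable_funM.
  - by move=> y; rewrite -EFinM lee_fin mulr_ge0// ltW.
  by apply: eq_integral => t _; rewrite -!EFinM /H /= x1 mul1r addr0.
transitivity (\int[mu]_t \int[mu]_x (H (x, t))%:E).
  apply: (@fubini_tonelli _ _ _ _ R mu mu (fun p => (H p)%:E)).
  - exact/measurable_EFinP.
  - by move=> p; rewrite lee_fin.
rewrite fubini_tonelli2; last 2 first.
- by apply/measurable_EFinP; exact: measurable_polar_integrand.
- by move=> q; rewrite lee_fin polar_integrand_ge0.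
apply: eq_integral => t _; rewrite /fubini_G /=.
have [Dt|Dt] := boolP (t \in (@itvD R)); last first.
  rewrite !integral0_eq// => x _; rewrite ?/polar_integrand /H /tanw /= ?indicE ?patchE.
    by rewrite (negbTE Dt) mulr0 !mul0r.
  by rewrite (negbTE Dt) mulr0.
have ct : (0 < cos t)%R by apply: cosD_gt0; exact: set_mem.
rewrite -(@integral_affine _ (cos t) 0 (fun x => (H (x, t))%:E))//; last 2 first.
- by apply/measurable_EFinP; exact: measurableT_comp.
- by move=> x; rewrite lee_fin.
apply: eq_integral => x _; rewrite /polar_integrand /H /polar /= -EFinM addr0.
rewrite /tanw /tanD !patchE Dt !indicE Dt !posRE pmulr_rgt0//; congr _%:E.
case: ltP => x0; rewrite ?mul0r// !mul1r.
rewrite mulrC.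
have -> : (cos t * x * tan t = x * sin t)%R.
  by rewrite /tan; field; rewrite gt_eqF.
rewrite (mulrC (cos t) x).
by field; rewrite gt_eqF.
Qed.

(** A quarter turn carries the right half-plane to the upper one; it is a swap of coordinates
    followed by a reflection. *)
Lemma polar_upper (G : R * R -> R) : measurable_fun setT G ->
  (forall p, 0 <= G p)%R ->
  \int[mu2]_p (G p * \1_posR p.2)%:E =
  \int[mu2]_q (polar_integrand `]0%R, pi[%classic G q)%:E.
Proof.
move=> mG G0.
have mpos : measurable posR by exact: measurable_itv.
pose H (p : R * R) : R := G (- p.2, p.1)%R.
have mH : measurable_fun setT H.
  apply: (measurableT_comp mG); apply: measurable_fun_pair; last exact: measurable_fst.
  exact: (measurableT_comp (@measurable_funN _ _ _ _ _ (@measurable_id _ _ setT)) measurable_snd).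
have H0 p : (0 <= H p)%R by exact: G0.
transitivity (\int[mu2]_p (H p * \1_posR p.1)%:E).
  rewrite -(@integral2_swap (fun p => (H p * \1_posR p.1)%:E)); last 2 first.
  - by apply/measurable_EFinP; apply: measurable_funM => //; exact: measurable_indic1.
  - by move=> p; rewrite lee_fin mulr_ge0.
  rewrite -(@integral2_map (fun x => - x)%R id (fun p => (G p * \1_posR p.2)%:E)) //.
  - exact: preserving_opp.
  - by apply/measurable_EFinP; apply: measurable_funM => //; exact: measurable_indic2.
  - by move=> p; rewrite lee_fin mulr_ge0.
rewrite polar_half//.
rewrite -(@integral2_map id (fun x => x + pi / 2)%R (fun q => (polar_integrand `]0%R, pi[%classic G q)%:E)) //.
- apply: eq_integral => q _; rewrite /polar_integrand /H /polar /=.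
  rewrite cosDpihalf sinDpihalf mulrN; congr (_ * _ * _ * _)%:E.
  rewrite !indicE !mem_setE !in_itv /=; congr (_%:R).
  by apply: f_equal; apply/idP/idP => /andP[? ?]; apply/andP; split; lra.
- exact: preserving_shift.
- by apply/measurable_EFinP; apply: measurable_polar_integrand.
- by move=> p; rewrite lee_fin polar_integrand_ge0.
Qed.

Lemma polar_lower (G : R * R -> R) : measurable_fun setT G ->
  (forall p, 0 <= G p)%R ->
  \int[mu2]_p (G p * \1_posR (- p.2)%R)%:E =
  \int[mu2]_q (polar_integrand `]pi, (2 * pi)%R[%classic G q)%:E.
Proof.
move=> mG G0.
have mpos : measurable posR by exact: measurable_itv.
pose H (p : R * R) : R := G (- p.1, - p.2)%R.
have mH : measurable_fun setT H.
  apply: (measurableT_comp mG); apply: measurable_map2; exact: measurable_funN.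
have H0 p : (0 <= H p)%R by exact: G0.
transitivity (\int[mu2]_p (H p * \1_posR p.2)%:E).
  rewrite -(@integral2_map (fun x => - x)%R (fun x => - x)%R (fun p => (H p * \1_posR p.2)%:E)) //.
  - by apply: eq_integral => p _; rewrite /H /= !opprK -surjective_pairing.
  - exact: preserving_opp.
  - exact: preserving_opp.
  - by apply/measurable_EFinP; apply: measurable_funM => //; exact: measurable_indic2.
  - by move=> p; rewrite lee_fin mulr_ge0.
rewrite polar_upper//.
rewrite -(@integral2_map id (fun x => x + pi)%R (fun q => (polar_integrand `]pi, (2 * pi)%R[%classic G q)%:E)) //.
- apply: eq_integral => q _; rewrite /polar_integrand /H /polar /=.
  rewrite cosDpi sinDpi !mulrN; congr (_ * _ * _ * _)%:E.
  rewrite !indicE !mem_setE !in_itv /=; congr (_%:R).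
  by apply: f_equal; apply/idP/idP => /andP[? ?]; apply/andP; split; lra.
- exact: preserving_shift.
- by apply/measurable_EFinP; apply: measurable_polar_integrand.
- by move=> p; rewrite lee_fin polar_integrand_ge0.
Qed.

(** The plane is cut along the real axis rather than the imaginary one, so that the angular ranges
    are $]0,\pi[$ and $]\pi,2\pi[$ and join to $[0,2\pi[$ up to two angles. *)
Lemma integral2_polar (G : R * R -> R) : measurable_fun setT G ->
  (forall p, 0 <= G p)%R ->
  \int[mu2]_p (G p)%:E =
  \int[mu2]_q (polar_integrand `[0%R, (2 * pi)%R[%classic G q)%:E.
Proof.
move=> mG G0.
have pi0 := @pi_gt0 R.
have mpos : measurable posR by exact: measurable_itv.
have mposN : measurable_fun setT (fun p : R * R => \1_posR (- p.2)%R : R).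
  have := (measurableT_comp (@measurable_indic _ _ R setT _ mpos)
    (measurableT_comp (@measurable_funN _ _ _ _ _ (@measurable_id _ _ setT)) measurable_snd)).
  exact.
transitivity (\int[mu2]_p ((G p * \1_posR p.2)%:E + (G p * \1_posR (- p.2)%R)%:E)).
  rewrite !fubini_tonelli1; last 4 first.
  - apply: emeasurable_funD; apply/measurable_EFinP; apply: measurable_funM => //.
    exact: measurable_indic2.
  - by move=> p; rewrite adde_ge0// lee_fin mulr_ge0.
  - exact/measurable_EFinP.
  - by move=> p; rewrite lee_fin.
  apply: eq_integral => x _; rewrite /fubini_F /=.
  rewrite -(setUv [set 0%R]) !ge0_integral_setU//; try exact: measurableC; last 6 first.
  - apply: emeasurable_funD; apply/measurable_EFinP; apply: measurable_funM.
    + exact/measurable_funTS/measurableT_comp.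
    + exact/measurable_funTS/measurable_indic.
    + exact/measurable_funTS/measurableT_comp.
    + apply: measurable_funTS.
      exact: (measurableT_comp (@measurable_indic _ _ R setT _ mpos) (@measurable_funN _ _ _ _ _ (@measurable_id _ _ setT))).
  - by move=> p _; rewrite adde_ge0// lee_fin mulr_ge0.
  - by apply/disj_setPRL.
  - apply/measurable_EFinP; exact/measurable_funTS/measurableT_comp.
  - by move=> p _; rewrite lee_fin.
  - by apply/disj_setPRL.
  rewrite !integral_set1 !add0e; apply: eq_integral => y; rewrite inE /= => /eqP y0.
  rewrite -EFinD -mulrDr !indicE !posRE oppr_gt0.
  by case: ltgtP y0 => // _ _; rewrite ?addr0 ?add0r mulr1.
rewrite ge0_integralD//; last 4 first.
- by move=> p _; rewrite lee_fin mulr_ge0.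
- by apply/measurable_EFinP; apply: measurable_funM => //; exact: measurable_indic2.
- by move=> p _; rewrite lee_fin mulr_ge0.
- by apply/measurable_EFinP; apply: measurable_funM.
rewrite polar_upper// polar_lower//.
rewrite -ge0_integralD//; last 4 first.
- by move=> p _; rewrite lee_fin polar_integrand_ge0.
- by apply/measurable_EFinP; apply: measurable_polar_integrand.
- by move=> p _; rewrite lee_fin polar_integrand_ge0.
- by apply/measurable_EFinP; apply: measurable_polar_integrand.
have mI : measurable_fun setT (fun p : R * R => polar_integrand `]0%R, pi[%classic G p + polar_integrand `]pi, (2 * pi)%R[%classic G p)%R.
  by apply: measurable_funD; apply: measurable_polar_integrand.
rewrite !fubini_tonelli1; last 4 first.
- by apply/measurable_EFinP; apply: measurable_polar_integrand.
- by move=> p; rewrite lee_fin polar_integrand_ge0.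
- exact/measurable_EFinP.
- by move=> p; rewrite adde_ge0// lee_fin polar_integrand_ge0.
apply: eq_integral => x _; rewrite /fubini_F /=.
have ms (A : set R) : measurable A -> measurable_fun setT (fun y => polar_integrand A G (x, y)).
  by move=> mA; apply: measurableT_comp => //; exact: measurable_polar_integrand.
apply: ge0_ae_eq_integral => //.
- by apply/measurable_EFinP; apply: measurable_funD; apply: ms.
- by apply/measurable_EFinP; apply: ms.
- by move=> y; rewrite adde_ge0// lee_fin polar_integrand_ge0.
- by move=> y; rewrite lee_fin polar_integrand_ge0.
exists [set 0%R; pi]; split => //.
- exact: measurableU.
- by apply: countable_lebesgue_measure0; apply: finite_set_countable; exact: finite_set2.
move=> y /= /not_implyP[_]; apply: contra_notP => /not_orP[/eqP y0 /eqP ypi].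
rewrite -EFinD /polar_integrand -!mulrDl -mulrDr; congr (_ * _ * _ * _)%:E.
rewrite !indicE !mem_setE !in_itv /=.
have [y1|y1] := ltP 0%R y; last first.
  have ylt : (y < 0)%R by rewrite lt_neqAle y0.
  have -> : (pi < y)%R = false by apply/negbTE; rewrite -leNgt; lra.
  by rewrite leNgt ylt /= addr0.
rewrite (ltW y1) /=; have [y2|y2] := ltP pi y.
  have -> : (y < pi)%R = false by apply/negbTE; rewrite -leNgt ltW.
  by rewrite add0r.
have -> : (y < pi)%R by rewrite lt_neqAle ypi.
have -> : (y < 2 * pi)%R by lra.
by rewrite addr0.
Qed.

End Polar.

(** * Integrals over the plane, radial functions and discs *)

Section PlaneIntegral.
Variable R : realType.
Notation mu := (@lebesgue_measure R).
Notation mu2 := (lebesgue2 R).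
Implicit Types (F G : R[i] -> R) (z m : R[i]).

Definition ind (b : bool) : R := if b then 1 else 0.

Lemma ind_ge0 b : 0 <= ind b. Proof. by case: b. Qed.
Lemma ind_le1 b : ind b <= 1. Proof. by case: b. Qed.

Definition cmeas G := measurable_fun setT (fun p : R * R => G (p.1 +i* p.2)).

(** Valued in the extended reals, so that identities for nonnegative functions hold without any
    integrability. *)
Definition cint G : \bar R := (\int[mu2]_p (G (p.1 +i* p.2))%:E)%E.

Lemma cmeas_cst (c : R) : cmeas (fun=> c).
Proof. exact: measurable_cst. Qed.

Lemma cmeasD F G : cmeas F -> cmeas G -> cmeas (fun z => F z + G z).
Proof. exact: measurable_funD. Qed.

Lemma cmeasM F G : cmeas F -> cmeas G -> cmeas (fun z => F z * G z).
Proof. exact: measurable_funM. Qed.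

Lemma cmeas_comp (g : R -> R) F : measurable_fun setT g -> cmeas F ->
  cmeas (fun z => g (F z)).
Proof. by move=> mg mF; exact: (measurableT_comp mg mF). Qed.

Lemma cmeas_comp2 F (X Y : R[i] -> R) : cmeas F -> cmeas X -> cmeas Y ->
  cmeas (fun z => F (X z +i* Y z)).
Proof.
move=> mF mX mY; exact: (measurableT_comp mF (measurable_fun_pair mX mY)).
Qed.

Lemma cmeas_if (b : R[i] -> bool) F G :
  measurable_fun setT (fun p : R * R => b (p.1 +i* p.2)) ->
  cmeas F -> cmeas G -> cmeas (fun z => if b z then F z else G z).
Proof. by move=> mb mF mG; exact: measurable_fun_ifT. Qed.

Lemma cmeas_lt F G : cmeas F -> cmeas G ->
  measurable_fun setT (fun p : R * R => F (p.1 +i* p.2) < G (p.1 +i* p.2)).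
Proof. by move=> mF mG; exact: measurable_fun_ltr. Qed.

Lemma cmeas_le F G : cmeas F -> cmeas G ->
  measurable_fun setT (fun p : R * R => F (p.1 +i* p.2) <= G (p.1 +i* p.2)).
Proof. by move=> mF mG; exact: measurable_fun_ler. Qed.

Lemma cmeas_bool (b : R[i] -> bool) :
  measurable_fun setT (fun p : R * R => b (p.1 +i* p.2)) ->
  cmeas (fun z => ind (b z)).
Proof. by move=> mb; apply: cmeas_if => //; exact: cmeas_cst. Qed.

Lemma cmeas_Re : cmeas (@complex.Re R).
Proof. exact: measurable_fst. Qed.

Lemma cmeas_Im : cmeas (@complex.Im R).
Proof. exact: measurable_snd. Qed.

Lemma cmeas_normc : cmeas (@normc R).
Proof.
have -> : @normc R = (fun z => (complex.Re z * complex.Re z + complex.Im z * complex.Im z) `^ 2^-1).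
  by apply/funext => z; rewrite normcE powR12_sqrt// -!expr2 addr_ge0// sqr_ge0.
apply: (cmeas_comp (@measurable_powR R 2^-1)).
by apply: cmeasD; apply: cmeasM; (exact: cmeas_Re || exact: cmeas_Im).
Qed.

Lemma cmeas_sum (I : Type) (s : seq I) (F : I -> R[i] -> R) :
  (forall i, cmeas (F i)) -> cmeas (fun z => \sum_(i <- s) F i z).
Proof. by move=> mF; exact: measurable_sum. Qed.

Lemma cint_ge0 G : (forall z, 0 <= G z) -> (0 <= cint G)%E.
Proof. by move=> G0; apply: integral_ge0 => p _; rewrite lee_fin. Qed.

Lemma cint_le F G : (forall z, 0 <= F z) -> cmeas F -> cmeas G ->
  (forall z, F z <= G z) -> (cint F <= cint G)%E.
Proof.
move=> F0 mF mG FG; apply: ge0_le_integral => //.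
- by move=> p _; rewrite lee_fin.
- exact/measurable_EFinP.
- exact/measurable_EFinP.
- by move=> p _; rewrite lee_fin.
Qed.

Lemma cintD F G : (forall z, 0 <= F z) -> (forall z, 0 <= G z) -> cmeas F ->
  cmeas G -> cint (fun z => F z + G z) = (cint F + cint G)%E.
Proof.
move=> F0 G0 mF mG; rewrite /cint -ge0_integralD//.
- by move=> p _; rewrite lee_fin.
- exact/measurable_EFinP.
- by move=> p _; rewrite lee_fin.
- exact/measurable_EFinP.
Qed.

Lemma cintZ (c : R) F : 0 <= c -> (forall z, 0 <= F z) -> cmeas F ->
  cint (fun z => c * F z) = (c%:E * cint F)%E.
Proof.
move=> c0 F0 mF; rewrite /cint -ge0_integralZl//.
- exact/measurable_EFinP.
- by move=> p _; rewrite lee_fin.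
Qed.

Lemma cint_sum (I : Type) (s : seq I) (F : I -> R[i] -> R) :
  (forall i z, 0 <= F i z) -> (forall i, cmeas (F i)) ->
  cint (fun z => \sum_(i <- s) F i z) = (\sum_(i <- s) cint (F i))%E.
Proof.
move=> F0 mF; rewrite /cint -ge0_integral_sum//.
- by apply: eq_integral => p _; rewrite sumEFin.
- by move=> i; apply/measurable_EFinP; exact: mF.
- by move=> i p _; rewrite lee_fin.
Qed.

Lemma eq_cint F G : (forall z, F z = G z) -> cint F = cint G.
Proof. by move=> /funext ->. Qed.

Lemma cint_translate G m : cmeas G -> (forall z, 0 <= G z) ->
  cint (fun z => G (z - m)) = cint G.
Proof.
move=> mG G0; rewrite /cint.
rewrite -(@integral2_map R (fun x => x - complex.Re m) (fun x => x - complex.Im m)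
  (fun p => (G (p.1 +i* p.2))%:E)).
- by apply: eq_integral => p _; case: m.
- exact: preserving_shift.
- exact: preserving_shift.
- exact/measurable_EFinP.
- by move=> p; rewrite lee_fin.
Qed.

Lemma measurable_circle G (t : R) : cmeas G ->
  measurable_fun setT (fun x : R => G ((t * cos x) +i* (t * sin x))).
Proof.
move=> mG.
have m1 : measurable_fun setT (fun x : R => t * cos x).
  by apply: measurable_funM => //; exact: continuous_measurable_fun (@continuous_cos R).
have m2 : measurable_fun setT (fun x : R => t * sin x).
  by apply: measurable_funM => //; exact: continuous_measurable_fun (@continuous_sin R).
exact: (measurableT_comp mG (measurable_fun_pair m1 m2)).
Qed.

Lemma cint_polar G : cmeas G -> (forall z, 0 <= G z) -> cint G =
  (\int[mu]_(t in `]0%R, +oo[)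
     ((\int[mu]_(x in `[0%R, (2 * pi)%R[) (G ((t * cos x)%R +i* (t * sin x)%R))%:E) * t%:E))%E.
Proof.
move=> mG G0; rewrite /cint (@integral2_polar R (fun p => G (p.1 +i* p.2)))//.
rewrite fubini_tonelli1; last 2 first.
- by apply/measurable_EFinP; apply: measurable_polar_integrand.
- by move=> q; rewrite lee_fin polar_integrand_ge0.
rewrite [RHS]integral_mkcond; apply: eq_integral => t _; rewrite /fubini_F patchE.
rewrite /polar_integrand /= indicE -[`]0, +oo[%classic]/(@posR R) posRE.
case: ltP => t0; last first.
  by rewrite integral0_eq// => x _; rewrite !mul0r.
rewrite -ge0_integralZr//; last 3 first.
- by apply/measurable_funTS/measurable_EFinP; exact: measurable_circle.
- by move=> x _; rewrite lee_fin.
- by rewrite lee_fin ltW.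
rewrite [RHS]integral_mkcond; apply: eq_integral => x _; rewrite /polar /= patchE indicE mul1r.
by case: ifP; rewrite ?mul1r ?mul0r ?mul0e.
Qed.

Lemma cint_radial (g : R -> R) : measurable_fun setT g -> (forall t, 0 <= g t) ->
  cint (fun z => g (normc z)) =
  ((2 * pi)%:E * \int[mu]_(t in `]0%R, +oo[) (g t * t)%:E)%E.
Proof.
move=> mg g0; have pi0 := @pi_gt0 R.
rewrite cint_polar//; last exact: (cmeas_comp mg cmeas_normc).
rewrite -ge0_integralZl//; last 3 first.
- apply/measurable_funTS/measurable_EFinP; apply: measurable_funM => //.
- by move=> t; rewrite /= in_itv /= andbT => t0; rewrite lee_fin mulr_ge0// ltW.
- by rewrite lee_fin; lra.
apply: eq_integral => t; rewrite inE /= in_itv /= andbT => t0.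
have nE x : Num.sqrt ((t * cos x) ^+ 2 + (t * sin x) ^+ 2) = t.
  rewrite !exprMn -mulrDr cos2Dsin2 mulr1 sqrtr_sqr ger0_norm//; exact: ltW.
under eq_integral do rewrite nE.
rewrite integral_cst//= lebesgue_measure_itv /= lte_fin.
have -> : (0 < 2 * pi :> R) by lra.
by rewrite oppr0 adde0 -!EFinM; congr _%:E; ring.
Qed.

Lemma integral_powR (e X : R) : 0 <= e -> 0 <= X ->
  (\int[mu]_(t in `]0%R, +oo[) (ind (t <= X)%R * t `^ e)%:E =
   (X `^ (e + 1) / (e + 1))%:E)%E.
Proof.
move=> e0; rewrite le_eqVlt => /orP[/eqP <-|X0].
  rewrite powR0; last by rewrite gt_eqF//; lra.
  rewrite mul0r integral0_eq// => t; rewrite /= in_itv /= andbT => t0.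
  by rewrite leNgt t0 /ind /= mul0r.
transitivity (\int[mu]_(t in `[0%R, X]) (t `^ e)%:E)%E.
  rewrite -integral_itv_obnd_cbnd; last first.
    by apply/measurable_funTS/measurable_EFinP; exact: measurable_powR.
  rewrite integral_mkcond [RHS]integral_mkcond; apply: eq_integral => t _.
  rewrite !patchE !mem_setE !in_itv /= andbT; case: ltP => //= t0.
  by rewrite /ind; case: leP; rewrite ?mul1r ?mul0r.
have e1 : e + 1 != 0 by rewrite gt_eqF//; lra.
pose F (t : R) := t `^ (e + 1) / (e + 1).
have cF (t : R) : 0 < t -> is_derive t 1 F (t `^ e).
  move=> t0.
  have dt : derivable (@powR R ^~ (e + 1)) t 1 by apply: derivable_powR; rewrite in_itv /= t0.
  have : is_derive t 1 (@powR R ^~ (e + 1)) ((e + 1) * t `^ e).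
    apply: DeriveDef => //; rewrite -derive1E powR_derive1 ?in_itv/= ?t0//.
    by rewrite addrK.
  move=> dp; rewrite (_ : F = (e + 1)^-1 *: (@powR R ^~ (e + 1))); last first.
    by apply/funext => u; rewrite /F mulrC.
  apply: is_derive_eq; rewrite [_ *: _]mulrA mulVf// mul1r//.
have c0 (a : R) : 0 < a -> ((fun t => t `^ a) x @[x --> (0 : R)^'+] --> (0 `^ a : R)).
  by move=> a0; rewrite powR0 ?gt_eqF//; exact: powR_cvg0.
have cc (t : R) (a : R) : 0 < t -> {for t, continuous (fun t => t `^ a)}.
  by move=> t0; apply/differentiable_continuous/derivable1_diffP; apply: derivable_powR; rewrite in_itv /= t0.
rewrite (@continuous_FTC2 _ _ F)//.
- by rewrite /F powR0// mul0r sube0.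
(* For exponent 0 the integrand is the constant 1, also at 0, whereas the limit at 0 in [c0] needs a
   positive exponent. *)
- have [->|ne] := eqVneq e 0.
    by under [X in continuous X]eq_fun do rewrite powRr0; apply: continuous_subspaceT => t; exact: cvg_cst.
  have e00 : 0 < e by rewrite lt_neqAle eq_sym ne.
  apply/continuous_within_itvP => //; split.
  + by move=> t; rewrite in_itv /= => /andP[t0 _]; exact: cc.
  + exact: c0.
  + by apply: cvg_at_left_filter; exact: cc.
- split.
  + by move=> t; rewrite in_itv /= => /andP[t0 _]; have [] := cF t t0.
  + apply: cvgMl; apply: c0; lra.
  + by apply: cvg_at_left_filter; apply: cvgMl; exact: cc.
- move=> t; rewrite in_itv /= => /andP[t0 _]; rewrite derive1E.
  by have [_ ->] := cF t t0.
Qed.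

Lemma cint_disc (T : R) : 0 <= T ->
  cint (fun z => ind (normc z <= T)) = (pi * T ^+ 2)%:E.
Proof.
move=> T0.
rewrite (@cint_radial (fun t => ind (t <= T))); last 2 first.
- by apply: measurable_fun_ifT => //; exact: measurable_fun_ler.
- by move=> t; exact: ind_ge0.
have := @integral_powR 1 T ler01 T0.
have -> : (\int[mu]_(t in `]0%R, +oo[) (ind (t <= T)%R * t `^ 1)%:E =
  \int[mu]_(t in `]0%R, +oo[) (ind (t <= T)%R * t)%:E)%E.
  apply: eq_integral => t; rewrite inE /= in_itv /= andbT => t0.
  by rewrite powRr1// ltW.
move=> ->; rewrite -EFinM; congr _%:E.
by rewrite (_ : 1 + 1 = 2%:R)// powR_mulrn//; field.
Qed.

Lemma cint_disc_fin (B T : R) F : 0 <= T -> 0 <= B -> cmeas F -> (forall z, 0 <= F z) ->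
  (forall z, F z <= B * ind (normc z <= T)) -> (cint F <= (B * (pi * T ^+ 2))%:E)%E.
Proof.
move=> T0 B0 mF F0 FB; rewrite EFinM -cint_disc// -cintZ//.
- apply: cint_le => //; apply: cmeasM; first exact: cmeas_cst.
  by apply: cmeas_bool; apply: cmeas_le; [exact: cmeas_normc|exact: cmeas_cst].
- by move=> z; exact: ind_ge0.
- by apply: cmeas_bool; apply: cmeas_le; [exact: cmeas_normc|exact: cmeas_cst].
Qed.

End PlaneIntegral.

(** * Lattice sums and integrals *)

Section FiniteSums.
Variable R : realType.

Lemma ler_fsum (T : choiceType) (S : set T) (F G : T -> R) : finite_set S ->
  (forall i, S i -> F i <= G i) -> \sum_(i \in S) F i <= \sum_(i \in S) G i.
Proof.
move=> fS FG; rewrite !fsbig_finite//= big_seq [leRHS]big_seq.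
by apply: ler_sum => i; rewrite in_fset_set// inE => /FG.
Qed.

Lemma ler_fsum_subset (T : choiceType) (S S' : set T) (F : T -> R) :
  finite_set S' -> S `<=` S' -> (forall i, S' i -> 0 <= F i) ->
  \sum_(i \in S) F i <= \sum_(i \in S') F i.
Proof.
move=> fS' SS' F0; rewrite fsbig_mkcond [leRHS]fsbig_mkcond.
have fS := sub_finite_set SS' fS'.
rewrite -(@fsbig_widen _ _ _ _ S' setT); last 2 first.
- by [].
- by move=> i [_ ni] /=; rewrite patchE memNset// => /SS'.
rewrite -[leRHS](@fsbig_widen _ _ _ _ S' setT); last 2 first.
- by [].
- by move=> i [_ ni] /=; rewrite patchE memNset.
apply: ler_fsum => // i Si; rewrite !patchE (mem_set Si).
by case: ifP => // _; exact: F0.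
Qed.

Lemma ler_norm_fsum (T : choiceType) (S : set T) (F : T -> R) : finite_set S ->
  `|\sum_(i \in S) F i| <= \sum_(i \in S) `|F i|.
Proof. by move=> fS; rewrite !fsbig_finite//=; exact: ler_norm_sum. Qed.

Lemma fsumrB (T : choiceType) (S : set T) (F G : T -> R) : finite_set S ->
  \sum_(i \in S) (F i - G i) = \sum_(i \in S) F i - \sum_(i \in S) G i.
Proof. by move=> fS; rewrite !fsbig_finite//= sumrB. Qed.

End FiniteSums.

(** * Sums over a grid as integrals over its cells *)

Section Lattice.
Variable R : realType.
Notation mu2 := (lebesgue2 R).
Variables (w1 w2 z0 : R[i]) (L : set R[i]).
Hypothesis L_lattice : lattice_basis L w1 w2.
Implicit Types (z m : R[i]) (F G E : R[i] -> R).

Let det : R := complex.Re w1 * complex.Im w2 - complex.Im w1 * complex.Re w2.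

(** If it vanished, the real combinations of [w1], [w2] with coefficients
    $(\mathrm{Im}\,w_2,-\mathrm{Im}\,w_1)$ and $(\mathrm{Re}\,w_2,-\mathrm{Re}\,w_1)$ would be 0;
    independence then kills [w1], which contradicts independence. *)
Lemma det_neq0 : det != 0.
Proof.
have [H _] := L_lattice.
apply/eqP => d0.
have [i2 i1] : complex.Im w2 = 0 /\ - complex.Im w1 = 0.
  apply: H; apply: eqC; rewrite ?ReD ?ImD ?ReZ ?ImZ /=; last by ring.
  by rewrite -[RHS]d0 /det; ring.
have [r2 r1] : complex.Re w2 = 0 /\ - complex.Re w1 = 0.
  apply: H; apply: eqC; rewrite ?ReD ?ImD ?ReZ ?ImZ /=; first by ring.
  by rewrite -[RHS]oppr0 -[in RHS]d0 /det; ring.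
have [] : (1 : R) = 0 /\ (0 : R) = 0.
  apply: H; apply: eqC; rewrite ?ReD ?ImD ?ReZ ?ImZ /= mul1r mul0r addr0.
  - by apply/eqP; rewrite -oppr_eq0 r1.
  - by apply/eqP; rewrite -oppr_eq0 i1.
by move/eqP; rewrite oner_eq0.
Qed.

(** Cramer's rule: [cu] and [cv] are the real coordinates in the basis [w1], [w2]. *)
Definition cu z : R := (complex.Re z * complex.Im w2 - complex.Im z * complex.Re w2) / det.
Definition cv z : R := (complex.Re w1 * complex.Im z - complex.Im w1 * complex.Re z) / det.

Lemma cuvK z : z = (cu z)%:C * w1 + (cv z)%:C * w2.
Proof.
have d0 := det_neq0.
apply: eqC; rewrite ?ReD ?ImD ?ReZ ?ImZ /cu /cv /det; field; exact: d0.
Qed.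

Lemma cuE (a b : R) : cu (a%:C * w1 + b%:C * w2) = a.
Proof.
by have d0 := det_neq0; rewrite /cu ReD ImD !ReZ !ImZ /det; field; exact: d0.
Qed.

Lemma cvE (a b : R) : cv (a%:C * w1 + b%:C * w2) = b.
Proof.
by have d0 := det_neq0; rewrite /cv ReD ImD !ReZ !ImZ /det; field; exact: d0.
Qed.

Lemma cuB z m : cu (z - m) = cu z - cu m.
Proof. by rewrite /cu ReD ImD ReN ImN -mulrBl; congr (_ / _); ring. Qed.

Lemma cvB z m : cv (z - m) = cv z - cv m.
Proof. by rewrite /cv ReD ImD ReN ImN -mulrBl; congr (_ / _); ring. Qed.

Definition Acst : R := 2 * (normc w1 + normc w2) / `|det|.

Lemma Acst_gt0 : 0 < Acst.
Proof.
have d0 := det_neq0.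
rewrite /Acst divr_gt0 ?normr_gt0//.
rewrite mulr_gt0// ltr_pwDl ?normc_ge0// normc_gt0; apply: contraNneq d0 => w0.
by rewrite /det w0 /= !mul0r subrr.
Qed.

Lemma cuv_le z : `|cu z| <= Acst * normc z /\ `|cv z| <= Acst * normc z.
Proof.
have d0 : 0 < `|det| by rewrite normr_gt0 det_neq0.
have h (a b c d n1 n2 : R) : `|a| <= n1 -> `|b| <= n1 -> `|c| <= n2 -> `|d| <= n2 ->
    `|a * c - b * d| <= 2 * (n1 * n2).
  move=> h1 h2 h3 h4; apply: (le_trans (ler_normB _ _)); rewrite !normrM.
  by have := ler_pM (normr_ge0 _) (normr_ge0 _) h1 h3;
     have := ler_pM (normr_ge0 _) (normr_ge0 _) h2 h4; lra.
have n1 := normc_ge0 w1; have n2 := normc_ge0 w2; have n := normc_ge0 z.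
split.
- rewrite /cu /Acst normrM normfV mulrAC ler_pdivrMr// divfK ?gt_eqF//.
  apply: (le_trans (h _ _ _ _ _ _ (Re_le_normc z) (Im_le_normc z) (Im_le_normc w2) (Re_le_normc w2))).
  by nra.
- rewrite /cv /Acst normrM normfV mulrAC ler_pdivrMr// divfK ?gt_eqF//.
  apply: (le_trans (h _ _ _ _ _ _ (Re_le_normc w1) (Im_le_normc w1) (Im_le_normc z) (Re_le_normc z))).
  by nra.
Qed.

Definition par z := (0 <= cu z < 1) && (0 <= cv z < 1).

Lemma parP z : fund_parallelogram w1 w2 z <-> par z.
Proof.
split=> [[a [b [ha hb ->]]]|/andP[hu hv]].
  by rewrite /par cuE cvE ha hb.
by exists (cu z), (cv z); split => //; exact: cuvK.
Qed.

Definition diam : R := normc w1 + normc w2.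

Lemma diam_ge0 : 0 <= diam.
Proof. by rewrite addr_ge0 ?normc_ge0. Qed.

Lemma par_diam z : par z -> normc z <= diam.
Proof.
move=> /andP[/andP[u0 u1] /andP[v0 v1]]; rewrite {1}(cuvK z).
apply: (le_trans (normcD _ _)); rewrite !normcZ !ger0_norm// lerD// ler_piMl ?normc_ge0 ?ltW//.
Qed.

Lemma cmeas_par m : cmeas (fun z => ind R (par (z - m))).
Proof.
have mu_ : cmeas (fun z => cu (z - m)).
  have -> : (fun z => cu (z - m)) = (fun z => cu z - cu m) by apply/funext => z; rewrite cuB.
  rewrite /cmeas /cu /=; apply: measurable_funB => //; apply: measurable_funM => //.
  by apply: measurable_funB; apply: measurable_funM => //;
     (exact: measurable_fst || exact: measurable_snd).
have mv_ : cmeas (fun z => cv (z - m)).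
  have -> : (fun z => cv (z - m)) = (fun z => cv z - cv m) by apply/funext => z; rewrite cvB.
  rewrite /cmeas /cv /=; apply: measurable_funB => //; apply: measurable_funM => //.
  by apply: measurable_funB; apply: measurable_funM => //;
     (exact: measurable_fst || exact: measurable_snd).
have h (b c : R[i] -> bool) : cmeas (fun z => ind R (b z)) -> cmeas (fun z => ind R (c z)) ->
   cmeas (fun z => ind R (b z && c z)).
  move=> mb mc; have -> : (fun z => ind R (b z && c z)) = (fun z => ind R (b z) * ind R (c z)).
    by apply/funext => z; rewrite /ind; case: (b z); case: (c z); rewrite ?mulr1 ?mulr0.
  exact: cmeasM.
have hI (X : R[i] -> R) : cmeas X -> cmeas (fun z => ind R (0 <= X z < 1)).
  move=> mX; apply: (h (fun z => 0 <= X z) (fun z => X z < 1)); apply: cmeas_bool.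
    exact: (cmeas_le (@cmeas_cst R 0) mX).
  exact: (cmeas_lt mX (@cmeas_cst R 1)).
by apply: h; exact: hI.
Qed.

Let cov := covol w1 w2.

(** A cell lies in a disc, hence has finite area and the [fine] in [covol] loses nothing;
    translation invariance handles all cells at once. *)
Lemma cint_par m : cint (fun z => ind R (par (z - m))) = cov%:E.
Proof.
rewrite (@cint_translate R (fun z => ind R (par z))); last 2 first.
- by have := @cmeas_par 0; congr cmeas; apply/funext => z; rewrite subr0.
- by move=> z; exact: ind_ge0.
have m0 : cmeas (fun z => ind R (par z)).
  by have := @cmeas_par 0; congr cmeas; apply/funext => z; rewrite subr0.
have e : cint (fun z => ind R (par z)) = area (fund_parallelogram w1 w2).
  rewrite /area -[X in _ = _ X]setIT -integral_indic//; last first.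
    have := m0 measurableT [set 1%R] (measurable_set1 _); rewrite setTI.
    congr measurable; apply/seteqP; split => p /=.
      by rewrite /ind => h; apply/parP; move: h; case: ifP => // _ /esym/eqP; rewrite oner_eq0.
    by move/parP; rewrite /ind => ->.
  apply: eq_integral => p _; rewrite indicE /ind; congr _%:E.
  case: ifP => h; last by rewrite memNset//= => /parP; rewrite h.
  by rewrite mem_set//=; exact/parP.
rewrite e /cov /covol fineK// -e ge0_fin_numE; last by apply: cint_ge0 => z; exact: ind_ge0.
have := @cint_disc_fin R 1 diam (fun z => ind R (par z)) diam_ge0 ler01 m0.
move=> h; apply: (le_lt_trans (h _ _)) (ltry _).
  by move=> z; exact: ind_ge0.
move=> z; rewrite mul1r /ind; case: ifP => [/par_diam ->//|_]; by case: ifP.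
Qed.

Notation La := (grid z0 L).

Lemma intC (a : int) : (a%:~R : R[i]) = (a%:~R : R)%:C.
Proof. by rewrite rmorph_int. Qed.

Lemma gridP m : La m <-> exists a b : int, cu (m - z0) = a%:~R /\ cv (m - z0) = b%:~R.
Proof.
have [_ LE] := L_lattice.
split=> [[p]|[a [b [ha hb]]]].
  rewrite LE => -[a [b ->]] <-; exists a, b.
  by rewrite addrAC subrr add0r !intC cuE cvE.
exists (m - z0); last by rewrite addrC subrK.
by rewrite LE; exists a, b; rewrite {1}(cuvK (m - z0)) ha hb !intC.
Qed.

Lemma grid_cell z : exists m, La m /\ par (z - m).
Proof.
pose a := Num.floor (cu (z - z0)); pose b := Num.floor (cv (z - z0)).
exists (z0 + ((a%:~R : R)%:C * w1 + (b%:~R : R)%:C * w2)); split.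
  by apply/gridP; exists a, b; rewrite addrAC subrr add0r cuE cvE.
rewrite /par opprD addrA cuB cvB cuE cvE.
have h (x : R) : 0 <= x - (Num.floor x)%:~R < 1.
  by rewrite subr_ge0 ltrBlDl floor_le_tmp /=; have := floorD1_gt x; rewrite intrD.
by rewrite !h.
Qed.

(** The coordinates of $z-m$ and $z-m'$ lie in $[0,1[$ and differ by integers. *)
Lemma grid_cell_uniq z m m' : La m -> La m' -> par (z - m) -> par (z - m') -> m = m'.
Proof.
have key (a b : int) (x y : R) : x - y = a%:~R - b%:~R -> 0 <= x < 1 -> 0 <= y < 1 -> x = y.
  move=> e hx hy; have : (`|(a - b)%:~R| < (1 : R)).
    by rewrite intrB -e ltr_norml; apply/andP; split; lra.
  rewrite -intr_norm ltrz1 => h.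
  have ab : a - b = 0 by lia.
  by move: e; rewrite -intrB ab => /eqP; rewrite subr_eq0 => /eqP.
move=> /gridP[a [b [ha hb]]] /gridP[a' [b' [ha' hb']]] /andP[hu hv] /andP[hu' hv'].
have eu : cu (z - m) = cu (z - m').
  apply: (key a' a) => //; rewrite -ha -ha' !cuB; ring.
have ev : cv (z - m) = cv (z - m').
  apply: (key b' b) => //; rewrite -hb -hb' !cvB; ring.
have : z - m = z - m' by rewrite (cuvK (z - m)) eu ev -cuvK.
by move=> /addrI/oppr_inj.
Qed.

Lemma grid_finite T : finite_set [set m | La m /\ normc m <= T].
Proof.
(* The integer coordinates of $m-z_0$ are at most [Acst] times its norm, so both lie in $[-M,M]$,
   which [I] enumerates. *)
pose M := Num.bound (Acst * (T + normc z0)).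
pose I : set int := [set (n%:Z - M%:Z) | n in `I_(M + M).+1].
have fI : finite_set I by apply: finite_image; exact: finite_II.
apply: (@sub_finite_set _ _ ((fun q : int * int =>
   z0 + ((q.1%:~R : R)%:C * w1 + (q.2%:~R : R)%:C * w2)) @` (I `*` I))); last first.
  by apply: finite_image; exact: finite_setX.
move=> m /= [Lm mT].
have n1 : normc (m - z0) <= T + normc z0 by apply: (le_trans (normcB _ _)); rewrite lerD2r.
have [a [b [ha hb]]] := (gridP m).1 Lm.
have [h1 h2] := cuv_le (m - z0).
have A0 := Acst_gt0.
have n2 : Acst * normc (m - z0) < M%:R.
  have : 0 <= Acst * (T + normc z0).
    by rewrite mulr_ge0 ?(ltW A0)//; apply: le_trans n1; exact: normc_ge0.
  by move/archi_boundP; apply: le_lt_trans; rewrite ler_pM2l.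
have hM (c : int) : `|c%:~R| <= Acst * normc (m - z0) -> I c.
  move=> hc; have : `|c%:~R| < (M%:Z%:~R : R) by apply: le_lt_trans n2.
  rewrite -intr_norm ltr_int => cM.
  by exists `|(c + M%:Z)%R|%N => /=; lia.
exists (a, b) => /=; last first.
  by rewrite -ha -hb -cuvK addrC subrK.
by split; apply: hM; rewrite -?ha -?hb.
Qed.

Lemma big_cell (s : seq R[i]) G z m : uniq s -> {in s, forall m, La m} ->
  La m -> par (z - m) ->
  \sum_(m' <- s) G m' * ind R (par (z - m')) = if m \in s then G m else 0.
Proof.
move=> us sL Lm pm.
have other m' : m' \in s -> m' != m -> G m' * ind R (par (z - m')) = 0.
  move=> ms; apply: contraNeq; rewrite /ind; case: ifP => [pm' _|]; last by rewrite mulr0 eqxx.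
  by apply/eqP; exact: (grid_cell_uniq (sL _ ms) Lm pm' pm).
case: ifPn => ms.
  rewrite (bigD1_seq m)//= big_seq_cond big1 ?addr0 /ind ?pm ?mulr1//.
  by move=> m' /andP[? ?]; exact: other.
rewrite big_seq big1// => m' m's; apply: other => //.
by apply: contraNneq ms => <-.
Qed.

Section compare.
Variables (S : set R[i]) (G : R[i] -> R).
Hypotheses (fS : finite_set S) (SL : S `<=` La) (G0 : forall m, 0 <= G m).

Let H z := \sum_(m <- finmap.enum_fset (fset_set S)) G m * ind R (par (z - m)).

Let mH : cmeas H.
Proof.
by apply: cmeas_sum => m; apply: cmeasM; [exact: cmeas_cst|exact: cmeas_par].
Qed.

Let H0 z : 0 <= H z.
Proof. by apply: sumr_ge0 => m _; rewrite mulr_ge0// ind_ge0. Qed.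

Let HE : cint H = (cov * \sum_(m \in S) G m)%:E.
Proof.
rewrite /H cint_sum; last 2 first.
- by move=> m z; rewrite mulr_ge0// ind_ge0.
- by move=> m; apply: cmeasM; [exact: cmeas_cst|exact: cmeas_par].
rewrite fsbig_finite//= mulr_sumr -sumEFin; apply: eq_bigr => m _.
rewrite cintZ//; first by rewrite cint_par -EFinM mulrC.
- by move=> z; exact: ind_ge0.
- exact: cmeas_par.
Qed.

Lemma HcellE z m : La m -> par (z - m) -> H z = if m \in S then G m else 0.
Proof.
move=> Lm pm; rewrite /H (@big_cell _ G z m)//.
- by rewrite in_fset_set.
- exact: finmap.fset_uniq.
- by move=> m'; rewrite in_fset_set// inE => /SL.
Qed.

(* Each side of the comparison is spread over the cells [m + P]: no geometry
   of the summation domain is needed, only the pointwise defect [E]. *)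
Lemma grid_compare F E : cmeas F -> cmeas E -> (forall z, 0 <= F z) ->
  (cint F < +oo)%E -> (cint E < +oo)%E ->
  (forall m z, La m -> par (z - m) ->
     `|(if m \in S then G m else 0) - F z| <= E z) ->
  `|cov * \sum_(m \in S) G m - fine (cint F)| <= fine (cint E).
Proof.
move=> mF mE F0 Ffin Efin HFE.
have FE z : `|H z - F z| <= E z.
  by have [m [Lm pm]] := grid_cell z; rewrite (HcellE Lm pm); exact: HFE.
have E0 z : 0 <= E z by apply: le_trans (FE z).
have le1 : (cint H <= cint F + cint E)%E.
  rewrite -cintD//; apply: cint_le => //; first exact: cmeasD.
  by move=> z; have := FE z; rewrite ler_norml => /andP[]; lra.
have le2 : (cint F <= cint H + cint E)%E.
  rewrite -cintD//; apply: cint_le => //; first exact: cmeasD.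
  by move=> z; have := FE z; rewrite ler_norml => /andP[]; lra.
have fF : cint F \is a fin_num by rewrite ge0_fin_numE// cint_ge0.
have fE : cint E \is a fin_num by rewrite ge0_fin_numE// cint_ge0.
move: le1 le2; rewrite HE -(fineK fF) -(fineK fE) -!EFinD !lee_fin /= => le1 le2.
by rewrite ler_norml; apply/andP; split; lra.
Qed.

Lemma grid_sum_le E (a : R) : cmeas E -> (cint E <= a%:E)%E -> (forall z, 0 <= E z) ->
  (forall m z, S m -> par (z - m) -> G m <= E z) ->
  cov * \sum_(m \in S) G m <= a.
Proof.
move=> mE Ea E0 SE; rewrite -lee_fin -HE; apply: le_trans Ea; apply: cint_le => // z.
have [m [Lm pm]] := grid_cell z; rewrite (HcellE Lm pm); case: ifPn => // mS.
by apply: SE => //; exact: set_mem.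
Qed.

Lemma grid_sum_ge E (a : R) : cmeas E -> (a%:E <= cint E)%E -> (forall z, 0 <= E z) ->
  (forall m z, La m -> par (z - m) -> E z <= if m \in S then G m else 0) ->
  a <= cov * \sum_(m \in S) G m.
Proof.
move=> mE Ea E0 SE; rewrite -lee_fin -HE; apply: (le_trans Ea); apply: cint_le => // z.
by have [m [Lm pm]] := grid_cell z; rewrite (HcellE Lm pm); exact: SE.
Qed.

End compare.

Definition ncard (S : set R[i]) : R := \sum_(m \in S) (1 : R).

Lemma cmeas_ind_le (T : R) : cmeas (fun z => ind R (normc z <= T)).
Proof.
by apply: cmeas_bool; apply: cmeas_le; [exact: cmeas_normc|exact: cmeas_cst].
Qed.

Lemma cov_ge0 : 0 <= cov.
Proof.
by rewrite -lee_fin -(cint_par 0); apply: cint_ge0 => z; exact: ind_ge0.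
Qed.

Definition gridball (T : R) := [set m | La m /\ normc m <= T].

(** The unit disc is covered by the finitely many cells that meet it; with cells of area 0 its area
    $\pi$ would be 0. *)
Lemma cov_gt0 : 0 < cov.
Proof.
rewrite lt_neqAle cov_ge0 andbT eq_sym; apply/eqP => c0.
have d0 := diam_ge0.
have := @grid_sum_ge (gridball (1 + diam)) (fun=> 1) (grid_finite _) (fun m => @proj1 _ _)
  (fun=> ler01) (fun z => ind R (normc z <= 1)) (pi * 1 ^+ 2) (cmeas_ind_le 1).
rewrite cint_disc// c0 mul0r expr1n mulr1.
move=> /(_ (lexx _) (fun=> ind_ge0 _ _)) h.
suff : (pi : R) <= 0 by rewrite leNgt pi_gt0.
apply: h => m z Lm pm; case: ifPn => [_|mS]; first exact: ind_le1.
rewrite /ind; case: ifP => // z1; exfalso; move/negP: mS; apply; apply: mem_set.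
split => //; have := par_diam pm; have := normcB z (z - m).
by rewrite opprB addrC subrK; lra.
Qed.

(** The cells of the points counted are disjoint and lie in the disc enlarged by [diam]. *)
Lemma card_gridball_le T : 0 <= T -> ncard (gridball T) <= pi * (T + diam) ^+ 2 / cov.
Proof.
move=> T0; have d0 := diam_ge0.
rewrite ler_pdivlMr ?cov_gt0// mulrC.
apply: (@grid_sum_le (gridball T) (fun=> 1) (grid_finite _) (fun m => @proj1 _ _)
  (fun=> ler01) (fun z => ind R (normc z <= T + diam))).
- exact: cmeas_ind_le.
- by rewrite cint_disc// addr_ge0.
- by move=> z; exact: ind_ge0.
- move=> m z [Lm mT] /par_diam pm; rewrite /ind.
  have := normcD m (z - m); rewrite addrC subrK => h.
  by case: ifPn => //; rewrite -ltNge; lra.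
Qed.

Definition gridannulus (a b : R) := [set m | La m /\ a < normc m <= b].

Lemma cmeas_ind_annulus (a b : R) : cmeas (fun z => ind R (a < normc z <= b)).
Proof.
have -> : (fun z : R[i] => ind R (a < normc z <= b)) =
  (fun z => ind R (a < normc z) * ind R (normc z <= b)).
  by apply/funext => z; rewrite /ind; case: (_ < _); case: (_ <= _); rewrite ?mulr1 ?mulr0.
apply: cmeasM; last exact: cmeas_ind_le.
by apply: cmeas_bool; exact: (cmeas_lt (@cmeas_cst R a) (@cmeas_normc R)).
Qed.

Lemma cint_annulus (a b : R) : 0 <= a <= b ->
  cint (fun z : R[i] => ind R (a < normc z <= b)) = (pi * (b ^+ 2 - a ^+ 2))%:E.
Proof.
move=> /andP[a0 ab].
have := @cintD R (fun z => ind R (normc z <= a)) (fun z => ind R (a < normc z <= b))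
  (fun=> ind_ge0 _ _) (fun=> ind_ge0 _ _) (cmeas_ind_le a).
have -> : (fun z : R[i] => ind R (normc z <= a) + ind R (a < normc z <= b)) =
    (fun z => ind R (normc z <= b)).
  apply/funext => z; rewrite /ind; case: (leP (normc z) a) => /= h.
    by rewrite (le_trans h ab) addr0.
  by rewrite add0r.
rewrite !cint_disc//; last exact: le_trans ab.
move=> h; have {h} := h _.
rewrite mulrBr EFinB => ->; first by rewrite addeAC subee// add0e.
exact: cmeas_ind_annulus.
Qed.

(** Disjoint cells again, now in the annulus thickened by [diam] on both sides. For a thin annulus
    the bound is a small fraction of the disc, which is how the points near the circle $|m|=N$
    become negligible. *)
Lemma card_gridannulus_le a b : diam <= a <= b ->
  ncard (gridannulus a b) <= pi * ((b + diam) ^+ 2 - (a - diam) ^+ 2) / cov.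
Proof.
move=> /andP[da ab]; have d0 := diam_ge0.
rewrite ler_pdivlMr ?cov_gt0// mulrC.
have := @cint_annulus (a - diam) (b + diam); rewrite subr_ge0 da /= => h.
apply: (@grid_sum_le (gridannulus a b) (fun=> 1) _ _
  (fun=> ler01) (fun z => ind R (a - diam < normc z <= b + diam))).
- apply: (@sub_finite_set _ _ (gridball b)); last exact: grid_finite.
  by move=> m [Lm /andP[]].
- by move=> m [].
- exact: cmeas_ind_annulus.
- by rewrite h//; lra.
- by move=> z; exact: ind_ge0.
- move=> m z [Lm /andP[ma mb]] /par_diam pm; rewrite /ind.
  have h1 := normcD m (z - m); rewrite addrC subrK in h1.
  have h2 := normcB_ge m (- (z - m)); rewrite normcNE opprK [m + _]addrC subrK in h2.
  by case: ifPn => //; rewrite negb_and -!ltNge -leNgt => /orP[]; lra.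
Qed.

End Lattice.

(** * Averages over the branches of the logarithm *)

Section Measurability.
Variable R : realType.
Implicit Types (z w : R[i]).

(** The arccosine is used as a continuous function on the open interval only; the quotients $\pm1$
    are split off and receive their constant values. *)
Lemma cmeas_carg : cmeas (@carg R).
Proof.
have mc : cmeas (fun z => complex.Re z / normc z).
  have -> : (fun z => complex.Re z / normc z) = (fun z : R[i] => complex.Re z * (normc z) `^ (-1)).
    by apply/funext => z; rewrite powR_inv1// normc_ge0.
  apply: cmeasM; first exact: cmeas_Re.
  exact: (cmeas_comp (@measurable_powR R (-1)) (@cmeas_normc R)).
pose g := ((@acos R) \_ `](-1)%R, 1%R[).
have mg : measurable_fun setT g.
  apply: (proj1 (measurable_restrictT (@acos R) (measurable_itv _))).
  apply: open_continuous_measurable_fun; first exact: interval_open.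
  by move=> t; rewrite inE /= in_itv /= => ht; exact: continuous_acos.
have ma : cmeas (fun z => acos (complex.Re z / normc z)).
  have -> : (fun z : R[i] => acos (complex.Re z / normc z)) =
    (fun z => if -1 < complex.Re z / normc z then
       (if complex.Re z / normc z < 1 then g (complex.Re z / normc z) else 0) else pi).
    apply/funext => z; have /andP[h1 h2] := cos_arg_itv z.
    case: ltP => h3; last first.
      by rewrite (_ : _ / _ = -1) ?acosN1//; apply/eqP; rewrite eq_le h3 h1.
    case: ltP => h4; last first.
      by rewrite (_ : _ / _ = 1) ?acos1//; apply/eqP; rewrite eq_le h4 h2.
    by rewrite /g patchE mem_setE in_itv /= h3 h4.
  apply: cmeas_if; first exact: (cmeas_lt (@cmeas_cst R _) mc).
    apply: cmeas_if; first exact: (cmeas_lt mc (@cmeas_cst R _)).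
      exact: cmeas_comp mg mc.
    exact: cmeas_cst.
  exact: cmeas_cst.
apply: cmeas_if => //; first exact: (cmeas_le (@cmeas_cst R _) (@cmeas_Im R)).
rewrite /cmeas; apply: measurable_funB => //.
Qed.

Lemma normc_pair (x y x' y' : R) : normc ((x +i* y) - (x' +i* y')) <= `|x - x'| + `|y - y'|.
Proof. exact: (normc_le_ReIm ((x +i* y) - (x' +i* y'))). Qed.

(** The function is the pointwise limit of functions that are constant in the real part on thin
    strips. Each of these is a finite sum of products of functions of one coordinate, hence
    measurable for the product structure. *)
Lemma cmeas_unif (f : R[i] -> R) :
  (forall e, 0 < e -> exists2 d, 0 < d &
     forall z w, normc (z - w) < d -> `|f z - f w| < e) -> cmeas f.
Proof.
move=> uf.
pose st (n : nat) (j : int) : R := j%:~R / n.+1%:R.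
pose I (n : nat) (j : int) : set R := `[st n j, st n (j + 1)[%classic.
(* There are $2(n+1)^2$ strips of width $1/(n+1)$; they cover the real parts in $[-(n+1),n+1[$. *)
pose h (n : nat) (p : R * R) : R :=
  \sum_(i < (n.+1 * n.+1).*2) \1_(I n (i%:Z - (n.+1 * n.+1)%:Z)) p.1 *
     f (st n (i%:Z - (n.+1 * n.+1)%:Z) +i* p.2).
apply: (@measurable_fun_cvg _ _ _ _ h).
  move=> n; apply: measurable_sum => i; apply: measurable_funM.
    by apply: measurable_indic1; exact: measurable_itv.
  apply: (measurableT_comp (f := fun y => f (st n (i%:Z - (n.+1 * n.+1)%:Z) +i* y))); last exact: measurable_snd.
  apply: continuous_measurable_fun => y; apply/cvgrPdist_lt => e e0.
  have [d d0 H] := uf e e0; near=> y'; apply: H.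
  apply: (le_lt_trans (normc_pair _ _ _ _)); rewrite subrr normr0 add0r.
  by near: y'; exact: cvgr_dist_lt.
move=> [x y] _; apply/cvgrPdist_lt => e e0; have [d d0 H] := uf e e0.
near=> n.
have n0 : (0 : R) < n.+1%:R by [].
have xn : `|x| < n.+1%:R.
  apply: (@lt_trans _ _ n%:R); last by rewrite ltr_nat.
  by near: n; exact: nbhs_infty_gtr.
have nd : n.+1%:R^-1 < d.
  by near: n; exact: near_infty_natSinv_lt (PosNum d0).
pose j := Num.floor (x * n.+1%:R).
have /andP[j1 j2] : (j%:~R <= x * n.+1%:R < j%:~R + 1).
  by rewrite floor_le_tmp /=; have := floorD1_gt (x * n.+1%:R); rewrite intrD.
have jx : I n j x.
  by rewrite /I /= in_itv /= /st ler_pdivrMr// ltr_pdivlMr// j1 intrD.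
have [jl ju] : - (n.+1 * n.+1)%:Z <= j /\ j < (n.+1 * n.+1)%:Z.
  have /andP[xl xu] : - n.+1%:R < x < n.+1%:R by rewrite -ltr_norml.
  split.
    rewrite -ltzD1 -(ltr_int R) intrD; apply: le_lt_trans j2.
    by rewrite mulrNz -pmulrn natrM -mulNr ler_pM2r// ltW.
  by rewrite -(ltr_int R); apply: (le_lt_trans j1); rewrite -pmulrn natrM ltr_pM2r.
have jlt : (`|(j + (n.+1 * n.+1)%:Z)%R| < (n.+1 * n.+1).*2)%N by lia.
have jE : j = `|(j + (n.+1 * n.+1)%:Z)%R|%:Z - (n.+1 * n.+1)%:Z by lia.
have -> : h n (x, y) = f (st n j +i* y).
  rewrite /h (bigD1 (Ordinal jlt))//= -jE indicE mem_set// mul1r big1 ?addr0// => i ni.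
  rewrite indicE memNset ?mul0r// /I /= in_itv /= /st ler_pdivrMr// ltr_pdivlMr// => /andP[i1 i2].
  move/negP: ni; apply; apply/eqP/val_inj => /=.
  have a1 : i%:Z - (n.+1 * n.+1)%:Z < j + 1 
    by rewrite -(ltr_int R) [X in _ < X]intrD; exact: le_lt_trans i1 j2.
  have a2 : j < i%:Z - (n.+1 * n.+1)%:Z + 1 by rewrite -(ltr_int R); exact: le_lt_trans j1 i2.
  by lia.
apply: H; apply: (le_lt_trans (normc_pair _ _ _ _)); rewrite subrr normr0 addr0.
apply: le_lt_trans nd; rewrite ger0_norm.
  by rewrite lerBlDl /st -[X in _ + X]mul1r -mulrDl ler_pdivlMr// ltW.
by rewrite subr_ge0 /st ler_pdivrMr.
Unshelve. all: by end_near. Qed.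

End Measurability.

(** * Periodic functions integrated over long intervals *)

Section Periodic.
Variable R : realType.
Notation mu := (@lebesgue_measure R).
Local Open Scope ereal_scope.
Implicit Types (h : R -> R) (a b c T : R).

Definition itg h a b : \bar R := \int[mu]_(x in `[a, b[) (h x)%:E.

Lemma itg_ge0 h a b : (forall x, (0 <= h x)%R) -> 0 <= itg h a b.
Proof. by move=> h0; apply: integral_ge0 => x _; rewrite lee_fin. Qed.

Lemma itg_split h a b c : measurable_fun setT h -> (forall x, (0 <= h x)%R) ->
  (a <= b)%R -> (b <= c)%R -> itg h a c = itg h a b + itg h b c.
Proof.
move=> mh h0 ab bc; rewrite /itg -ge0_integral_setU//.
- congr (integral _ _ _); apply/seteqP; split => x /=; rewrite !in_itv /=.
    move=> /andP[ax xc]; have [xb|bx] := ltP x b; [left|right]; apply/andP; split => //.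
  move=> [/andP[ax xb]|/andP[bx xc]]; apply/andP; split => //.
    exact: lt_le_trans bc.
  exact: le_trans bx.
- by apply/measurable_funTS/measurable_EFinP.
- by move=> x _; rewrite lee_fin.
- apply/disj_setPS => x /=; rewrite !in_itv /= => -[/andP[_ xb] /andP[bx _]].
  by move: xb; rewrite ltNge bx.
Qed.

Lemma itg_shift h a b e : measurable_fun setT h -> (forall x, (0 <= h x)%R) ->
  itg (fun x => h (x + e)%R) a b = itg h (a + e) (b + e).
Proof.
move=> mh h0; rewrite /itg integral_mkcond [RHS]integral_mkcond.
rewrite -[RHS](@integral_shift R e); last 2 first.
- apply: (proj1 (measurable_restrictT _ (measurable_itv _))).
  by apply/measurable_funTS/measurable_EFinP.
- by move=> x; rewrite patchE; case: ifP => // _; rewrite lee_fin.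
apply: eq_integral => x _; rewrite !patchE !mem_setE !in_itv /=.
by rewrite lerD2r ltrD2r.
Qed.

Lemma itg_scale h (c T : R) : (0 < c)%R -> measurable_fun setT h -> (forall x, (0 <= h x)%R) ->
  itg (fun x => h (c * x)%R) 0 T = (c^-1)%:E * itg h 0 (c * T).
Proof.
move=> c0 mh h0; rewrite /itg integral_mkcond [in RHS]integral_mkcond.
rewrite -[in RHS](@integral_affine R c 0); last 3 first.
- by [].
- apply: (proj1 (measurable_restrictT _ (measurable_itv _))).
  by apply/measurable_funTS/measurable_EFinP.
- by move=> x; rewrite patchE; case: ifP => // _; rewrite lee_fin.
rewrite -ge0_integralZl//; last 3 first.
- apply: emeasurable_funM => //.
  apply: (measurableT_comp (f := (fun x : R => (h x)%:E) \_ `[0%R, (c * T)%R[)).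
    apply: (proj1 (measurable_restrictT _ (measurable_itv _))).
    by apply/measurable_funTS/measurable_EFinP.
  by apply: measurable_funD => //; apply: measurable_funM.
- move=> x _; apply: mule_ge0; last by rewrite lee_fin ltW.
  by rewrite patchE; case: ifP => // _; rewrite lee_fin.
- by rewrite lee_fin invr_ge0 ltW.
apply: eq_integral => x _; rewrite !patchE !mem_setE !in_itv /= addr0.
rewrite pmulr_rge0// ltr_pM2l//; case: ifP => _; last by rewrite mul0e mule0.
by rewrite -!EFinM; congr _%:E; field; rewrite gt_eqF.
Qed.

Section per.
Variables (h : R -> R) (T : R).
Hypotheses (T0 : (0 < T)%R) (mh : measurable_fun setT h) (h0 : forall x, (0 <= h x)%R).
Hypothesis hT : forall x, h (x + T)%R = h x.

Lemma per_nat n x : h (x + T * n%:R)%R = h x.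
Proof.
elim: n x => [|n IH] x; first by rewrite mulr0 addr0.
by rewrite -natr1 mulrDr mulr1 addrA hT.
Qed.

Lemma per_int (n : int) x : h (x + T * n%:~R)%R = h x.
Proof.
case: n => n; first exact: per_nat.
by rewrite NegzE mulrNz mulrN -pmulrn -(per_nat n.+1 (x - _)%R) subrK.
Qed.

(** Whole periods bring [a] into $[0,T]$; the piece beyond $T$ then moves back by one period onto
    the missing initial piece. *)
Lemma itg_period a : itg h a (a + T) = itg h 0 T.
Proof.
pose q := Num.floor (a / T); pose r := (a - T * q%:~R)%R.
have /andP[q1 q2] : (q%:~R <= a / T < q%:~R + 1)%R.
  by rewrite floor_le_tmp /=; have := floorD1_gt (a / T); rewrite intrD.
rewrite ler_pdivlMr// in q1; rewrite ltr_pdivrMr// in q2.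
have r0 : (0 <= r)%R by rewrite /r; lra.
have rT : (r <= T)%R by rewrite /r; lra.
have -> : itg h a (a + T) = itg h r (r + T).
  have -> : a = (r + T * q%:~R)%R by rewrite /r subrK.
  rewrite [(_ + T)%R]addrAC -itg_shift//; congr integral.
  by apply/funext => x; rewrite per_int.
rewrite (@itg_split h r T (r + T))//; last by rewrite lerDr.
have -> : itg h T (r + T) = itg h 0 r.
  by rewrite -{1}(add0r T) -itg_shift//; congr integral; apply/funext => x; rewrite hT.
by rewrite addeC -itg_split.
Qed.

Lemma itg_periods a n : itg h a (a + T * n%:R) = n%:R%:E * itg h 0 T.
Proof.
elim: n => [|n IH].
  by rewrite mulr0 addr0 mul0e /itg set_itv_ge ?integral_set0// bnd_simp ltxx.
rewrite (@itg_split h a (a + T * n%:R))//; last 2 first.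
- by rewrite lerDl mulr_ge0// ltW.
- by rewrite lerD2l ler_pM2l// ler_nat.
have -> : (a + T * n.+1%:R = (a + T * n%:R) + T)%R by rewrite -natr1; ring.
by rewrite IH itg_period -natr1 EFinD ge0_muleDl ?lee_fin// mul1e.
Qed.

Lemma itg_le a b c : (b <= c)%R -> itg h a b <= itg h a c.
Proof.
move=> bc; apply: ge0_subset_integral => //.
- by apply/measurable_funTS/measurable_EFinP.
- by move=> x _; rewrite lee_fin.
- by move=> x /=; rewrite !in_itv /= => /andP[-> xb]; exact: lt_le_trans bc.
Qed.

(** The interval contains $\lfloor l/T\rfloor$ consecutive periods and is contained in one more, so
    the error is at most one period whatever the position of [a]. *)
Lemma itg_average a l (I : R) : (0 <= l)%R -> itg h 0 T = I%:E ->
  exists2 J : R, itg h a (a + l) = J%:E & (`|J - l / T * I| <= I)%R.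
Proof.
move=> l0 IE; pose n := Num.truncn (l / T).
have lT0 : (0 <= l / T)%R by rewrite divr_ge0// ltW.
have /andP[n1 n2] : (n%:R <= l / T < n.+1%:R)%R by exact: truncn_itv.
have I0 : (0 <= I)%R by rewrite -lee_fin -IE itg_ge0.
have lo : itg h a (a + T * n%:R) <= itg h a (a + l).
  by apply: itg_le; rewrite lerD2l mulrC -ler_pdivlMr.
have hi : itg h a (a + l) <= itg h a (a + T * n.+1%:R).
  by apply: itg_le; rewrite lerD2l mulrC -ler_pdivrMr// ltW.
rewrite itg_periods IE -EFinM in lo; rewrite itg_periods IE -EFinM in hi.
have fi : itg h a (a + l) \is a fin_num.
  by rewrite ge0_fin_numE ?itg_ge0// (le_lt_trans hi)// ltry.
exists (fine (itg h a (a + l))); first by rewrite fineK.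
move: lo hi; rewrite -(fineK fi) !lee_fin /= => lo hi.
rewrite -natr1 in hi n2.
by rewrite ler_norml; apply/andP; split; nra.
Qed.

(** A reflection moves the closed end of the interval to the other side; passing to open intervals
    removes the difference. *)
Lemma itg_reflect c : itg (fun x => h (c - x)%R) 0 T = itg h 0 T.
Proof.
have mr : measurable_fun setT (fun x : R => h (- x)%R).
  by apply: (measurableT_comp mh); exact: measurable_funN.
transitivity (itg (fun x : R => h (- x)%R) (- c) (T - c)).
  rewrite -{1}(add0r (- c)%R) -itg_shift//; congr integral.
  by apply/funext => x; rewrite opprD opprK addrC.
rewrite -(itg_period (c - T)) subrK /itg.
transitivity (\int[mu]_(x in `](- c)%R, (T - c)%R[) (h (- x)%R)%:E).
  by apply: integral_itv_bndoo; apply/measurable_funTS/measurable_EFinP.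
rewrite [RHS]integral_itv_bndoo; last by apply/measurable_funTS/measurable_EFinP.
rewrite integral_mkcond [RHS]integral_mkcond.
rewrite -[RHS]integral_opp; last 2 first.
- apply: (proj1 (measurable_restrictT _ (measurable_itv _))).
  by apply/measurable_funTS/measurable_EFinP.
- by move=> x; rewrite patchE; case: ifP => // _; rewrite lee_fin.
apply: eq_integral => x _; rewrite !patchE !mem_setE !in_itv /=.
by rewrite andbC; congr (if _ then _ else _); congr (_ && _); apply/idP/idP; lra.
Qed.

End per.

Lemma sum_itg_shift h (a T : R) K : (0 <= T)%R -> measurable_fun setT h ->
  (forall x, (0 <= h x)%R) ->
  \sum_(j < K) itg (fun x => h (x + (a + T * j%:R))%R) 0 T = itg h a (a + T * K%:R).
Proof.
move=> T0 mh h0; elim: K => [|K IH].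
  by rewrite big_ord0 mulr0 addr0 /itg set_itv_ge ?integral_set0// bnd_simp ltxx.
rewrite big_ord_recr /= IH itg_shift// add0r -natr1 mulrDr mulr1.
rewrite [RHS](@itg_split h a (a + T * K%:R))//; last 2 first.
- by rewrite lerDl mulr_ge0.
- by rewrite lerD2l lerDl.
by congr (_ + itg _ _ _); ring.
Qed.

End Periodic.

(** Quantitative form of a nonnegative continuous function with compact support. [B] and [C] are
    parameters because one pair serves the positive and negative parts of both coordinates of a
    function. *)
Record test_function (R : realType) (f : R[i] -> R) (B C : R) : Prop := TestFunction {
  test_ge0 : forall z, 0 <= f z;
  test_le : forall z, f z <= B;
  test_pos : 0 < C;
  test_supp : forall z, C < normc z -> f z = 0;
  test_unif : forall e : R, 0 < e -> exists2 d : R, 0 < d &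
     forall z w, normc (z - w) < d -> `|f z - f w| < e }.

(** * Circle means and the unfolded angle *)

Section Angular.
Variables (R : realType) (f : R[i] -> R) (B C : R).
Hypothesis tf : test_function f B C.
Notation mu := (@lebesgue_measure R).
Implicit Types (z w c : R[i]) (u t : R).

Let f0 := test_ge0 tf.
Let fB := test_le tf.
Let C0 := test_pos tf.
Let fC := test_supp tf.
Let uf := test_unif tf.
Let mf : cmeas f := cmeas_unif uf.

Lemma test_bound_ge0 : 0 <= B.
Proof. exact: le_trans (f0 0) (fB 0). Qed.

Definition arc u (x : R) : R[i] := (u * cos x) +i* (u * sin x).

Lemma normc_arc u x : normc (arc u x) = `|u|.
Proof.
by rewrite normcE /arc /= !exprMn -mulrDr cos2Dsin2 mulr1 sqrtr_sqr.
Qed.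

Lemma arcE t x : 0 < t -> arc t x = cexp (ln t +i* x).
Proof. by move=> t0; rewrite /cexp /= lnK. Qed.

Lemma measurable_arc u : measurable_fun setT (fun x => f (arc u x)).
Proof. exact: measurable_circle. Qed.

(** $2\pi$ times the mean over the circle of radius [u], without the factor [u] of arc length. *)
Definition circ u : R := fine (itg (fun x => f (arc u x)) 0 (2 * pi)).

Lemma itg_bound (h : R -> R) (a b M : R) : measurable_fun setT h -> (forall x, 0 <= h x) ->
  (forall x, h x <= M) -> a <= b -> (itg h a b <= (M * (b - a))%:E)%E.
Proof.
move=> mh h0 hM ab; have -> : (M * (b - a))%:E = (\int[mu]_(x in `[a, b[) M%:E)%E.
  rewrite integral_cst//= lebesgue_measure_itv /= lte_fin; case: ltP => ba.
    by rewrite -EFinB -EFinM.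
  by rewrite (_ : b - a = 0) ?mulr0 ?mule0//; apply/eqP; rewrite subr_eq0 eq_le ba ab.
apply: ge0_le_integral => //.
- by move=> x _; rewrite lee_fin.
- by apply/measurable_funTS/measurable_EFinP.
- by move=> x _; rewrite lee_fin.
Qed.

Lemma circE u : itg (fun x => f (arc u x)) 0 (2 * pi) = (circ u)%:E.
Proof.
rewrite /circ fineK// ge0_fin_numE; last by apply: itg_ge0.
have := @itg_bound (fun x => f (arc u x)) 0 (2 * pi) B (measurable_arc u)
  (fun x => f0 _) (fun x => fB _).
have pi0 := @pi_gt0 R.
by move=> /(_ ltac:(lra)) h; apply: (le_lt_trans h); rewrite ltry.
Qed.

Lemma circ_ge0 u : 0 <= circ u.
Proof. by rewrite -lee_fin -circE; apply: itg_ge0. Qed.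

Lemma circ_le u : circ u <= 2 * pi * B.
Proof.
have pi0 := @pi_gt0 R.
rewrite -lee_fin -circE.
have := @itg_bound (fun x => f (arc u x)) 0 (2 * pi) B (measurable_arc u)
  (fun x => f0 _) (fun x => fB _).
by move=> /(_ ltac:(lra)); rewrite subr0 (mulrC B).
Qed.

Lemma circ_supp u : C < u -> circ u = 0.
Proof.
move=> Cu; apply/eqP; rewrite -eqe -circE /itg integral0_eq// => x _.
by rewrite fC// normc_arc ger0_norm// ltW// (lt_trans C0).
Qed.

(** Points of equal angle on the circles of radii $u$ and $v$ are at distance $|u-v|$, so the
    uniform modulus of [f] passes to the means. *)
Lemma circ_continuous : continuous circ.
Proof.
have pi0 := @pi_gt0 R.
have key e : 0 < e -> exists2 d, 0 < d & forall u v, `|u - v| < d -> circ u <= circ v + 2 * pi * e.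
  move=> e0; have [d d0 H] := uf e0; exists d => // u v uv.
  rewrite -lee_fin EFinD -!circE.
  have me : measurable_fun setT (fun x : R => f (arc v x) + e).
    by apply: measurable_funD => //; exact: measurable_arc.
  have -> : (itg (fun x => f (arc v x)) 0 (2 * pi) + (2 * pi * e)%:E)%E =
      itg (fun x => f (arc v x) + e) 0 (2 * pi).
    have -> : (2 * pi * e)%:E = (\int[mu]_(x in `[0%R, (2 * pi)%R[) e%:E)%E.
      rewrite integral_cst//= lebesgue_measure_itv /= lte_fin.
      have -> : (0 < 2 * pi :> R) by lra.
      by rewrite oppr0 adde0 -EFinM mulrC.
    rewrite /itg -ge0_integralD//.
    - by move=> x _; rewrite lee_fin.
    - by apply/measurable_funTS/measurable_EFinP; exact: measurable_arc.
    - by move=> x _; rewrite lee_fin ltW.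
  apply: ge0_le_integral => //.
  - by move=> x _; rewrite lee_fin.
  - by apply/measurable_funTS/measurable_EFinP; exact: measurable_arc.
  - by apply/measurable_funTS/measurable_EFinP.
  - move=> x _; rewrite lee_fin.
    have : normc (arc u x - arc v x) < d.
      have -> : arc u x - arc v x = arc (u - v) x.
        by apply: eqC; rewrite ?ReD ?ImD ?ReN ?ImN /= mulrBl.
      by rewrite normc_arc.
    by move/H; rewrite ltr_norml => /andP[]; lra.
move=> u; apply/cvgrPdist_lt => e e0.
have [d d0 H] := key (e / (4 * pi)) ltac:(by rewrite divr_gt0//; lra).
have ee (P : R) : P != 0 -> 2 * P * (e / (4 * P)) = e / 2 by move=> ?; field.
rewrite ee ?gt_eqF// in H.
near=> v.
have uv : `|u - v| < d by near: v; exact: cvgr_dist_lt.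
have h1 := H u v uv; rewrite distrC in uv; have h2 := H v u uv.
by rewrite ltr_norml; apply/andP; split; lra.
Unshelve. all: by end_near. Qed.

Variable beta : R.
Hypothesis beta_gt0 : 0 < beta.

(** The number $e^c z^{-\beta}$ for the argument in $[0,2\pi[$. With $c$ a logarithm of
    $\varphi\alpha p$ this is a linearized difference, and lowering $c$ by $2\pi i\beta j$ passes to
    the $j$-th next branch of the logarithm of [z]. *)
Definition pt c z : R[i] := cexp (c - beta%:C * clog z).

Definition rad c t : R := expR (complex.Re c - beta * ln t).

Lemma pt_arc c t x : 0 < t -> 0 <= x < 2 * pi ->
  pt c (arc t x) = arc (rad c t) (complex.Im c - beta * x).
Proof.
move=> t0 xx; rewrite /pt arcE// /clog normc_cexp /= expRK cargE//.
by rewrite arcE ?expR_gt0// /rad expRK; congr cexp; apply: eqC;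
  rewrite ?ReD ?ImD ?ReN ?ImN ?ReZ ?ImZ.
Qed.

Lemma cmeas_pt c : cmeas (fun z => f (pt c z)).
Proof.
have mr : cmeas (fun z => rad c (normc z)).
  apply: (@cmeas_comp R (rad c)); last exact: cmeas_normc.
  apply: (measurableT_comp (@measurable_expR R)); apply: measurable_funB => //.
  by apply: measurable_funM => //; exact: measurable_ln.
have ma : cmeas (fun z => complex.Im c - beta * carg z).
  apply: (@cmeas_comp R (fun x => complex.Im c - beta * x)); last exact: cmeas_carg.
  by apply: measurable_funB => //; exact: measurable_funM.
have -> : (fun z => f (pt c z)) = (fun z => f (
   (rad c (normc z) * cos (complex.Im c - beta * carg z)) +i*
   (rad c (normc z) * sin (complex.Im c - beta * carg z)))).
  by apply/funext => z; rewrite /pt /cexp /clog /rad !ReD !ImD !ReN !ImN !ReZ !ImZ.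
apply: cmeas_comp2 => //; apply: cmeasM => //.
- exact: (cmeas_comp (continuous_measurable_fun (@continuous_cos R)) ma).
- exact: (cmeas_comp (continuous_measurable_fun (@continuous_sin R)) ma).
Qed.

Definition Fpt c (N : R) z : R := f (pt c z) * ind R (0 < normc z <= N).

Lemma Fpt_ge0 c N z : 0 <= Fpt c N z.
Proof. by rewrite mulr_ge0// ind_ge0. Qed.

Lemma cmeas_Fpt c N : cmeas (Fpt c N).
Proof. by apply: cmeasM; [exact: cmeas_pt|exact: cmeas_ind_annulus]. Qed.

(** The formula of [pt_arc] without the restriction $0\le x<2\pi$: on the whole line the windows of
    successive branches can be joined. *)
Let hang c t (x : R) : R := f (arc (rad c t) (complex.Im c - beta * x)).

Lemma measurable_rad c : measurable_fun setT (rad c).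
Proof.
apply: (measurableT_comp (@measurable_expR R)); apply: measurable_funB => //.
by apply: measurable_funM => //; exact: measurable_ln.
Qed.

Let measurable_hang2 c : measurable_fun setT (fun q : R * R => hang c q.1 q.2).
Proof.
have ma : measurable_fun setT (fun q : R * R => complex.Im c - beta * q.2).
  by apply: measurable_funB => //; apply: measurable_funM => //; exact: measurable_snd.
have mr : measurable_fun setT (fun q : R * R => rad c q.1).
  exact: (measurableT_comp (measurable_rad c) measurable_fst).
have m1 : measurable_fun setT (fun q : R * R => rad c q.1 * cos (complex.Im c - beta * q.2)).
  apply: measurable_funM => //.
  exact: (measurableT_comp (continuous_measurable_fun (@continuous_cos R)) ma).
have m2 : measurable_fun setT (fun q : R * R => rad c q.1 * sin (complex.Im c - beta * q.2)).
  apply: measurable_funM => //.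
  exact: (measurableT_comp (continuous_measurable_fun (@continuous_sin R)) ma).
exact: (measurableT_comp mf (measurable_fun_pair m1 m2)).
Qed.

Let measurable_hang c t : measurable_fun setT (hang c t).
Proof. by have := measurable_fun_pair2 t (measurable_hang2 c). Qed.

Let hang_ge0 c t x : 0 <= hang c t x. Proof. exact: f0. Qed.

Let measurable_itg_hang c a b : measurable_fun setT (fun t => itg (hang c t) a b).
Proof.
have e : (fun t => itg (hang c t) a b) = fubini_F mu (fun q : R * R => (hang c q.1 q.2 * \1_(`[a, b[%classic) q.2)%:E).
  apply/funext => t; rewrite /itg /fubini_F [LHS]integral_mkcond; apply: eq_integral => x _.
  by rewrite patchE indicE; case: ifP; rewrite ?mulr1 ?mulr0.
rewrite e; apply: measurable_fun_fubini_tonelli_F.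
- apply/measurable_EFinP; apply: measurable_funM; first exact: measurable_hang2.
  exact: (measurable_indic2 (measurable_itv _)).
- by move=> q; rewrite lee_fin mulr_ge0.
Qed.

Lemma cint_Fpt c N : cint (Fpt c N) =
  (\int[mu]_(t in `]0%R, +oo[) (itg (hang c t) 0 (2 * pi) * (ind R (t <= N)%R * t)%:E))%E.
Proof.
rewrite cint_polar; [|exact: cmeas_Fpt|exact: Fpt_ge0].
apply: eq_integral => t; rewrite inE /= in_itv /= andbT => t0.
rewrite EFinM muleA; congr (_ * _)%E.
rewrite /itg -ge0_integralZr//; last 3 first.
- by apply/measurable_funTS/measurable_EFinP; exact: measurable_hang.
- by move=> x _; rewrite lee_fin.
- by rewrite lee_fin ind_ge0.
apply: eq_integral => x; rewrite inE /= in_itv /= => xx.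
by rewrite -EFinM /Fpt -[_ +i* _]/(arc t x) pt_arc// normc_arc ger0_norm ?t0// ltW.
Qed.

(** The expected contribution of a single branch: at each radius the angular integral over a length
    $2\pi$ is replaced by [circ]. *)
Definition Jint c (N : R) : \bar R :=
  (\int[mu]_(t in `]0%R, +oo[) ((circ (rad c t)) * (ind R (t <= N)%R * t))%:E)%E.

Lemma measurable_circ_rad c : measurable_fun setT (fun t => circ (rad c t)).
Proof. exact: (measurableT_comp (continuous_measurable_fun circ_continuous) (measurable_rad c)). Qed.

Lemma measurable_indt (N : R) : measurable_fun setT (fun t : R => ind R (t <= N) * t).
Proof.
apply: measurable_funM => //.
by apply: measurable_fun_ifT => //; exact: measurable_fun_ler.
Qed.

Lemma Jint_bound c N : 0 <= N -> (0 <= Jint c N <= (pi * B * N ^+ 2)%:E)%E.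
Proof.
move=> N0; have pi0 := @pi_gt0 R; have B0 := test_bound_ge0; apply/andP; split.
  apply: integral_ge0 => t; rewrite /= in_itv /= andbT => t0.
  by rewrite lee_fin !mulr_ge0 ?circ_ge0 ?ind_ge0// ltW.
have -> : (pi * B * N ^+ 2)%:E = ((2 * pi * B)%:E * (N `^ (1 + 1) / (1 + 1))%:E)%E.
  by rewrite (_ : 1 + 1 = 2%:R)// powR_mulrn// -EFinM; congr _%:E; field.
rewrite -integral_powR// -ge0_integralZl//; last 3 first.
- apply/measurable_funTS/measurable_EFinP; apply: measurable_funM; last exact: measurable_powR.
  by apply: measurable_fun_ifT => //; exact: measurable_fun_ler.
- by move=> t _; rewrite lee_fin mulr_ge0 ?ind_ge0// powR_ge0.
- by rewrite lee_fin !mulr_ge0// ltW.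
apply: ge0_le_integral => //.
- move=> t; rewrite /= in_itv /= andbT => t0.
  by rewrite lee_fin !mulr_ge0 ?circ_ge0 ?ind_ge0// ltW.
- apply/measurable_funTS/measurable_EFinP; apply: measurable_funM.
    exact: measurable_circ_rad.
  exact: measurable_indt.
- apply/measurable_funTS; apply: emeasurable_funM => //; apply/measurable_EFinP; apply: measurable_funM; last exact: measurable_powR.
  by apply: measurable_fun_ifT => //; exact: measurable_fun_ler.
- move=> t; rewrite /= in_itv /= andbT => t0.
  rewrite -EFinM lee_fin powRr1; last exact: ltW.
  rewrite ler_wpM2r//.
    by rewrite mulr_ge0 ?ind_ge0// ltW.
  exact: circ_le.
Qed.

(** In the variable [x] the period is $2\pi/\beta$ and one period contributes [circ] divided by
    $\beta$. A window of length $2\pi K$ holds $\beta K$ periods, in general not an integer, and the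
    incomplete one is the error. *)
Let hang_average c t (a : R) K : exists2 J : R,
  itg (hang c t) a (a + 2 * pi * K%:R) = J%:E &
  `|J - K%:R * circ (rad c t)| <= circ (rad c t) / beta.
Proof.
have pi0 := @pi_gt0 R.
pose T := 2 * pi / beta.
have T0 : 0 < T by rewrite divr_gt0//; lra.
pose g (x : R) := f (arc (rad c t) (complex.Im c - x)).
have mg : measurable_fun setT g.
  apply: (measurableT_comp (measurable_arc (rad c t))).
  exact: measurable_funB.
have arcP u x : arc u (x + 2 * pi) = arc u x.
  by rewrite /arc mulr_natl cosD2pi sinD2pi.
have gT : itg (hang c t) 0 T = (circ (rad c t) / beta)%:E.
  transitivity (itg (fun x => g (beta * x)) 0 T); first by [].
  rewrite itg_scale//; last by move=> x; exact: f0.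
  rewrite (_ : beta * T = 2 * pi); last by rewrite /T mulrC divfK// gt_eqF.
  rewrite (@itg_reflect _ (fun x => f (arc (rad c t) x)) (2 * pi)).
  - by rewrite circE -EFinM mulrC.
  - by lra.
  - exact: measurable_arc.
  - by move=> x; exact: f0.
  - by move=> x; rewrite arcP.
have hT x : hang c t (x + T) = hang c t x.
  rewrite /hang mulrDr (_ : beta * T = 2 * pi); last by rewrite /T mulrC divfK// gt_eqF.
  by rewrite -[in LHS]arcP opprD addrA subrK.
have [J JE hJ] := @itg_average _ (hang c t) T T0 (measurable_hang c t) (hang_ge0 c t) hT
  a (2 * pi * K%:R) _ ltac:(by rewrite !mulr_ge0//; lra) gT.
exists J => //; move: hJ; congr (`|_ - _| <= _); rewrite /T.
have calc (P X : R) : P != 0 -> 2 * P * K%:R / (2 * P / beta) * (X / beta) = K%:R * X.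
  by move=> P0; field; rewrite P0 gt_eqF.
by rewrite calc// gt_eqF.
Qed.

(* Consecutive branches of the logarithm unfold into one interval of length
   [2 pi K], on which the circle mean is the only surviving average. *)
Lemma sum_cint_Fpt c N (A : R) K : 0 <= N ->
  exists J S : R, [/\ Jint c N = J%:E,
    (\sum_(j < K) cint (Fpt (c - (0 +i* (beta * (A + 2 * pi * j%:R))))%R N) = S%:E)%E
    & `|S - K%:R * J| <= J / beta].
Proof.
move=> N0; have /andP[J0 JB] := Jint_bound c N0.
have pi0 := @pi_gt0 R.
have jf : Jint c N \is a fin_num by rewrite ge0_fin_numE// (le_lt_trans JB)// ltry.
pose W t := (itg (hang c t) A (A + 2 * pi * K%:R) * (ind R (t <= N)%R * t)%:E)%E.
have mW : measurable_fun setT W.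
  apply: emeasurable_funM; first exact: measurable_itg_hang.
  by apply/measurable_EFinP; exact: measurable_indt.
have wt t : 0 < t -> 0 <= ind R (t <= N)%R * t by move=> t0; rewrite mulr_ge0 ?ind_ge0// ltW.
have SE : (\sum_(j < K) cint (Fpt (c - (0 +i* (beta * (A + 2 * pi * j%:R))))%R N) =
   \int[mu]_(t in `]0%R, +oo[) W t)%E.
  under eq_bigr do rewrite cint_Fpt.
  rewrite -(@ge0_integral_sum _ _ _ mu _ _ _ (fun (j : 'I_K) t => (itg (hang (c - (0 +i* (beta * (A + 2 * pi * (j : nat)%:R))))%R t) 0 (2 * pi) * (ind R (t <= N)%R * t)%:E)%E)); last 3 first.
  - exact: measurable_itv.
  - move=> j; apply: measurable_funTS; apply: emeasurable_funM; first exact: measurable_itg_hang.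
    by apply/measurable_EFinP; exact: measurable_indt.
  - move=> j t; rewrite /= in_itv /= andbT => t0; apply: mule_ge0; first exact: itg_ge0.
    by rewrite lee_fin wt.
  apply: eq_integral => t; rewrite inE /= in_itv /= andbT => t0.
  rewrite -ge0_sume_distrl; last by move=> j _; exact: itg_ge0.
  rewrite /W -(@sum_itg_shift _ (hang c t))//; last by lra.
  congr (_ * _)%E; apply: eq_bigr => j _; congr itg; apply/funext => x.
  rewrite /hang /rad ReD ReN ImD ImN /= subr0; congr (f (arc _ _)); ring.
have JE : Jint c N = (\int[mu]_(t in `]0%R, +oo[) ((circ (rad c t)) * (ind R (t <= N)%R * t))%:E)%E by [].
have W0 t : `]0%R, +oo[%classic t -> (0 <= W t)%E.
  rewrite /= in_itv /= andbT => t0; apply: mule_ge0; first exact: itg_ge0.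
  by rewrite lee_fin wt.
have mcirc : measurable_fun setT (fun t => circ (rad c t) * (ind R (t <= N) * t)).
  by apply: measurable_funM; [exact: measurable_circ_rad|exact: measurable_indt].
have circ0 t : `]0%R, +oo[%classic t -> (0 <= (circ (rad c t) * (ind R (t <= N) * t))%:E)%E.
  by rewrite /= in_itv /= andbT => t0; rewrite lee_fin mulr_ge0 ?circ_ge0// wt.
have K0 : 0 <= K%:R :> R by [].
have b0 : 0 <= beta^-1 by rewrite invr_ge0 ltW.
have le1 : (\int[mu]_(t in `]0%R, +oo[) W t <= (K%:R + beta^-1)%:E * Jint c N)%E.
  rewrite JE -ge0_integralZl//; last 2 first.
  - by apply/measurable_funTS/measurable_EFinP.
  - by rewrite lee_fin addr_ge0.
  apply: ge0_le_integral => //.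
  - exact: measurable_funTS.
  - by apply/measurable_funTS; apply: emeasurable_funM => //; apply/measurable_EFinP.
  move=> t; rewrite /= in_itv /= andbT => t0.
  have [J1 J1E hJ1] := hang_average c t A K.
  rewrite /W J1E -!EFinM lee_fin [leRHS]mulrA ler_wpM2r ?wt//.
  by move: hJ1; rewrite ler_norml mulrDl => /andP[_]; rewrite [_^-1 * _]mulrC; lra.
have le2 : (K%:R%:E * Jint c N <= \int[mu]_(t in `]0%R, +oo[) W t + (beta^-1)%:E * Jint c N)%E.
  have Zl (k : R) : 0 <= k -> (k%:E * Jint c N =
      \int[mu]_(t in `]0%R, +oo[) (k%:E * (circ (rad c t) * (ind R (t <= N)%R * t))%:E))%E.
    by move=> k0; rewrite JE ge0_integralZl//; apply/measurable_funTS/measurable_EFinP.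
  rewrite !Zl//.
  rewrite -ge0_integralD//; last 3 first.
  - exact: measurable_funTS.
  - by move=> t ht; apply: mule_ge0; [rewrite lee_fin|exact: circ0].
  - by apply/measurable_funTS; apply: emeasurable_funM => //; apply/measurable_EFinP.
  apply: ge0_le_integral => //.
  - by move=> t ht; apply: mule_ge0; [rewrite lee_fin|exact: circ0].
  - by apply/measurable_funTS; apply: emeasurable_funM => //; apply/measurable_EFinP.
  - apply/measurable_funTS; apply: emeasurable_funD => //.
    by apply: emeasurable_funM => //; apply/measurable_EFinP.
  move=> t; rewrite /= in_itv /= andbT => t0.
  have [J1 J1E hJ1] := hang_average c t A K.
  rewrite /W J1E -!EFinM -EFinD lee_fin.
  have h : K%:R * circ (rad c t) <= J1 + beta^-1 * circ (rad c t).
    by move: hJ1; rewrite ler_norml => /andP[+ _]; rewrite [beta^-1 * _]mulrC; lra.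
  have := ler_wpM2r (wt t t0) h; rewrite mulrDl !mulrA; exact.
have wfin : (\int[mu]_(t in `]0%R, +oo[) W t)%E \is a fin_num.
  rewrite ge0_fin_numE; last exact: integral_ge0.
  by apply: (le_lt_trans le1); rewrite -(fineK jf) -EFinM ltry.
exists (fine (Jint c N)), (fine (\int[mu]_(t in `]0%R, +oo[) W t)%E); split.
- by rewrite fineK.
- by rewrite SE fineK.
move: le1 le2; rewrite -(fineK jf) -(fineK wfin) -!EFinM -EFinD !lee_fin /= => le1 le2.
by rewrite ler_norml; apply/andP; split; lra.
Qed.

Lemma rad_lt c t u : 0 < t -> t < u -> rad c u < rad c t.
Proof.
move=> t0 tu; rewrite /rad ltr_expR ltrD2l ltrN2 ltr_pM2l// ltr_ln// posrE.
exact: lt_trans tu.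
Qed.

Lemma rad_derive c t : 0 < t -> is_derive t 1 (rad c) (- (beta * rad c t / t)).
Proof.
move=> t0; have dl := is_derive1_ln t0.
have d1 : is_derive t 1 (fun t => complex.Re c - beta * ln t) (- (beta * t^-1)).
  rewrite (_ : (fun t => _) = (cst (complex.Re c) - beta *: (@ln R))); last by apply/funext.
  by apply: is_derive_eq; rewrite sub0r.
have := @is_derive1_comp R (@expR R) (fun t => complex.Re c - beta * ln t) t _ _
  (is_derive_expR _) d1.
by move=> h; apply: (is_derive_eq h); rewrite /rad; ring.
Qed.

Lemma rad_continuous c t : 0 < t -> {for t, continuous (rad c)}.
Proof.
move=> t0; apply: differentiable_continuous; apply/derivable1_diffP.
by have [] := rad_derive c t0.
Qed.

Let near_pos (t : R) : 0 < t -> \forall v \near t, 0 < v.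
Proof.
by move=> t0; exact: (@cvgr_gt _ _ (nbhs t) _ id t cvg_id).
Qed.

Let rad' c t := - (beta * rad c t / t).

Let rad_derive1 c t : 0 < t -> derive1 (rad c) t = rad' c t.
Proof. by move=> t0; rewrite derive1E; have [_ ->] := rad_derive c t0. Qed.

Let rad'_continuous c t : 0 < t -> {for t, continuous (derive1 (rad c))}.
Proof.
move=> t0; rewrite /prop_for /continuous_at rad_derive1//.
apply: cvg_trans (_ : rad' c v @[v --> t] --> rad' c t).
  by apply: near_eq_cvg; apply: filterS (near_pos t0) => v v0; rewrite rad_derive1.
apply: cvgN; apply: cvgM.
  by apply: cvgM; [exact: cvg_cst|exact: rad_continuous].
by apply: cvgV; [rewrite gt_eqF|exact: cvg_id].
Qed.

Let s := 2 / beta.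

(** With $u=e^{\mathrm{Re}\,c}t^{-\beta}$ one has $t^2=e^{s\,\mathrm{Re}\,c}u^{-s}$, hence
    $t\,dt=-\beta^{-1}e^{s\,\mathrm{Re}\,c}u^{-s-1}du$. Returning from polar coordinates costs a
    further factor $u^{-1}$. *)
Lemma Jint_subst c N : 0 < N -> Jint c N =
  ((beta^-1 * expR (s * complex.Re c))%:E *
   cint (fun w => f w * (normc w) `^ (- (s + 2)) * ind R (rad c N <= normc w))%R)%E.
Proof.
move=> N0.
have s0 : 0 < s by rewrite divr_gt0.
(* This radius exceeds both the support and [rad c N]. Hence $t_0<N$ and the integrand vanishes for
   $t<t_0$, so the substitution takes place on a compact interval away from 0. *)
pose C' := C + rad c N + 1.
have r0 t : 0 < rad c t by exact: expR_gt0.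
have Cpos := C0.
have rN := r0 N.
have C'0 : 0 < C' by rewrite /C'; lra.
pose t0 := expR ((complex.Re c - ln C') / beta).
have t00 : 0 < t0 by exact: expR_gt0.
have rt0 : rad c t0 = C'.
  by rewrite /rad /t0 expRK mulrC divfK ?gt_eqF// subKr lnK.
have t0N : t0 < N.
  rewrite ltNge; apply/negP; rewrite le_eqVlt => /orP[/eqP E|].
    by have := rt0; rewrite -E /C'; lra.
  by move/(rad_lt c N0); rewrite rt0 /C'; lra.
(* The power $u^{-(s+1)}$, written through the logarithm so that its continuity is that of a
   composition. *)
pose G u := circ u * expR (- (s + 1) * ln u).
have -> : cint (fun w => f w * (normc w) `^ (- (s + 2)) * ind R (rad c N <= normc w)) =
   (\int[mu]_(u in `[rad c N, rad c t0]) (G u)%:E)%E.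
  rewrite cint_polar; last 2 first.
  - apply: cmeasM; last first.
      by apply: cmeas_bool; exact: (cmeas_le (@cmeas_cst R _) (@cmeas_normc R)).
    apply: cmeasM => //; exact: (cmeas_comp (@measurable_powR R _) (@cmeas_normc R)).
  - by move=> z; rewrite !mulr_ge0// ?powR_ge0// ind_ge0.
  rewrite integral_mkcond [RHS]integral_mkcond; apply: eq_integral => u _.
  rewrite !patchE !mem_setE !in_itv /= andbT; case: ltP => u0; last first.
    by rewrite leNgt (le_lt_trans u0 (r0 N)).
  have nE x : normc (u * cos x +i* (u * sin x)) = u.
    by have := normc_arc u x; rewrite /arc ger0_norm// ltW.
  have -> : (\int[mu]_(x in `[0%R, (2 * pi)%R[) (f (u * cos x +i* (u * sin x))
      * normc (u * cos x +i* (u * sin x)) `^ (- (s + 2))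
      * ind R (rad c N <= normc (u * cos x +i* (u * sin x))))%:E)%E =
      ((circ u)%:E * (u `^ (- (s + 2)) * ind R (rad c N <= u))%:E)%E.
    rewrite -circE /itg -ge0_integralZr//; last 3 first.
    - by apply/measurable_funTS/measurable_EFinP; exact: measurable_arc.
    - by move=> x _; rewrite lee_fin.
    - by rewrite lee_fin mulr_ge0 ?powR_ge0 ?ind_ge0.
    by apply: eq_integral => x _; rewrite nE -EFinM /arc mulrA.
  rewrite -!EFinM; case: leP => h1 /=; last by rewrite !mulr0 mul0r.
  rewrite mulr1 rt0; case: leP => h2; last first.
    by rewrite circ_supp ?mul0r//; apply: lt_trans h2; rewrite /C'; have := r0 N; lra.
  congr _%:E; rewrite /G -mulrA; congr (_ * _).
  rewrite /powR gt_eqF// -{2}(lnK (_ : u \is Num.pos)) ?posrE// -expRD; congr expR; ring.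
have -> : Jint c N = (\int[mu]_(t in `[t0, N]) (circ (rad c t) * t)%:E)%E.
  rewrite /Jint integral_mkcond [RHS]integral_mkcond; apply: eq_integral => t _.
  rewrite !patchE !mem_setE !in_itv /= andbT; case: ltP => tt; last first.
    by rewrite leNgt (le_lt_trans tt t00).
  rewrite /ind; case: (leP t N) => tN; rewrite ?andbF ?mul0r ?mulr0// andbT mul1r.
  case: leP => // tt0; rewrite circ_supp ?mul0r//.
  by have := rad_lt c tt tt0; rewrite rt0 /C'; have := r0 N; lra.
rewrite (@integration_by_substitution_decreasing _ (rad c) G t0 N); last 7 first.
- exact: ltW.
- move=> x y; rewrite !in_itv /= => /andP[x0 _] /andP[y0 _] xy.
  by apply: rad_lt => //; apply: lt_le_trans y0.
- move=> t; rewrite in_itv /= => /andP[tt _]; apply: rad'_continuous; exact: lt_trans tt.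
- apply/cvg_ex; exists (derive1 (rad c) t0); apply: cvg_at_right_filter; exact: rad'_continuous.
- apply/cvg_ex; exists (derive1 (rad c) N); apply: cvg_at_left_filter; exact: rad'_continuous.
- split.
  + move=> t; rewrite in_itv /= => /andP[tt _].
    by have [] := rad_derive c (lt_trans t00 tt).
  + apply: cvg_at_right_filter; exact: rad_continuous.
  + apply: cvg_at_left_filter; exact: rad_continuous.
- apply: continuous_in_subspaceT => u; rewrite inE /= in_itv /= => /andP[u1 _].
  have u0 : 0 < u by apply: lt_le_trans u1.
  apply: cvgM; first exact: circ_continuous.
  apply: (@cvg_comp _ _ _ (fun u => - (s + 1) * ln u) expR _ (nbhs (- (s + 1) * ln u))); last exact: continuous_expR.
  by apply: cvgM; [exact: cvg_cst|exact: continuous_ln].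
have hpos t : t \in `[t0, N]%classic -> 0 < t.
  by rewrite inE /= in_itv /= => /andP[tt _]; exact: lt_le_trans tt.
have vE t : 0 < t -> ((G \o rad c) * - derive1 (rad c)) t = G (rad c t) * (beta * rad c t / t).
  by move=> tp; rewrite -[LHS]/(G (rad c t) * - derive1 (rad c) t) rad_derive1// opprK.
rewrite -ge0_integralZl//; last 3 first.
- apply/measurable_EFinP.
  apply: (@subspace_continuous_measurable_fun).
  + exact: measurable_itv.
  + apply: continuous_in_subspaceT => t /hpos tp.
    apply: cvgM; last by apply: cvgN; exact: rad'_continuous.
    apply: cvgM; first by apply: cvg_comp; [exact: rad_continuous|exact: circ_continuous].
    apply: (@cvg_comp _ _ _ (fun t => - (s + 1) * ln (rad c t)) expR _ (nbhs (- (s + 1) * ln (rad c t)))); last exact: continuous_expR.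
    apply: cvgM; first exact: cvg_cst.
    by apply: cvg_comp; [exact: rad_continuous|exact: continuous_ln].
- move=> t ht; have tp : 0 < t by apply: hpos; rewrite inE.
  rewrite lee_fin vE// !mulr_ge0 ?circ_ge0 ?expR_ge0 ?invr_ge0 ?ltW//.
- by rewrite lee_fin mulr_ge0 ?expR_ge0// invr_ge0 ltW.
apply: eq_integral => t /hpos tp; rewrite -EFinM; congr _%:E.
rewrite vE// /G.
have -> : ln (rad c t) = complex.Re c - beta * ln t by rewrite /rad expRK.
have -> : expR (- (s + 1) * (complex.Re c - beta * ln t)) =
   expR (- (s * complex.Re c)) * (rad c t)^-1 * t ^+ 2.
  have te : t ^+ 2 = expR (2 * ln t) by rewrite expRM_natl lnK.
  rewrite te /rad -expRN -!expRD; congr expR; rewrite /s; field.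
  by rewrite gt_eqF.
rewrite expRN; set E := expR (s * _); set Q := rad c t; set X := circ Q.
field.
by rewrite !gt_eqF// /E /Q expR_gt0.
Qed.

End Angular.

Section Strip.
Variable R : realType.
Notation mu := (@lebesgue_measure R).

Lemma integral_ind_norm (X : R) : 0 <= X ->
  (\int[mu]_x (ind R (`|x| <= X)%R)%:E = (2 * X)%:E)%E.
Proof.
move=> X0; transitivity (\int[mu]_x (\1_(`[(- X)%R, X]%classic) x)%:E)%E.
  apply: eq_integral => x _; rewrite indicE mem_setE in_itv /= ler_norml /ind.
  by case: ifP.
rewrite integral_indic//= setIT lebesgue_measure_itv /= lte_fin.
case: ltP => h; first by rewrite -EFinD; congr _%:E; ring.
by congr _%:E; clra.
Qed.

Lemma cmeas_ind_norm (F : R[i] -> R) (X : R) : cmeas F -> cmeas (fun z => ind R (`|F z| <= X)).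
Proof.
move=> mF; apply: cmeas_bool; apply: (cmeas_le (_ : cmeas (fun z => `|F z|)) (@cmeas_cst R X)).
exact: (cmeas_comp (continuous_measurable_fun (@norm_continuous R R)) mF).
Qed.

Lemma cint_strip (X Y : R) : 0 <= X -> 0 <= Y ->
  cint (fun z : R[i] => ind R (`|complex.Re z| <= X) * ind R (`|complex.Im z| <= Y)) =
  (4 * X * Y)%:E.
Proof.
move=> X0 Y0.
have mI (Z : R) : measurable_fun setT (fun x : R => ind R (`|x| <= Z)).
  apply: measurable_fun_ifT => //.
  by apply: measurable_fun_ler => //; exact: (continuous_measurable_fun (@norm_continuous R R)).
rewrite /cint fubini_tonelli1; last 2 first.
- apply/measurable_EFinP.
  exact: (cmeasM (cmeas_ind_norm X (@cmeas_Re R)) (cmeas_ind_norm Y (@cmeas_Im R))).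
- by move=> p; rewrite lee_fin mulr_ge0// ind_ge0.
transitivity (\int[mu]_x ((2 * Y)%:E * (ind R (`|x| <= X)%R)%:E))%E.
  apply: eq_integral => x _; rewrite /fubini_F /=.
  under eq_integral do rewrite EFinM.
  rewrite ge0_integralZl//.
  - by rewrite integral_ind_norm// muleC.
  - by apply/measurable_EFinP; exact: mI.
  - by move=> y _; rewrite lee_fin ind_ge0.
  - by rewrite lee_fin ind_ge0.
rewrite ge0_integralZl//.
- by rewrite integral_ind_norm// -EFinM; congr _%:E; ring.
- by apply/measurable_EFinP; exact: mI.
- by move=> y _; rewrite lee_fin ind_ge0.
- by rewrite lee_fin mulr_ge0.
Qed.

(** Consequently the arguments of two points on the same side of the real axis differ by at most
    $\pi$; only crossing the positive axis produces the jump. *)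
Lemma carg_half (z : R[i]) : if 0 <= complex.Im z then 0 <= carg z <= pi else pi <= carg z <= 2 * pi.
Proof.
have c := cos_arg_itv z; have a0 := acos_ge0 c; have a1 := acos_lepi c.
rewrite /carg; set a := acos _ in a0 a1 *.
by case: (0 <= complex.Im z); apply/andP; split; clra.
Qed.

End Strip.

(** * Grid sums of [pt] compared with plane integrals *)

Section GridPoints.
Variables (R : realType) (f : R[i] -> R) (B C beta : R).
Hypothesis tf : test_function f B C.
Hypothesis beta_gt0 : 0 < beta.
Hypothesis beta_le1 : beta <= 1.
Variables (w1 w2 z0 : R[i]) (L : set R[i]).
Hypothesis L_lattice : lattice_basis L w1 w2.
Notation mu := (@lebesgue_measure R).
Notation cov := (covol w1 w2).
Notation pt := (pt beta).
Notation Fpt := (Fpt f beta).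
Implicit Types (z m c : R[i]).

Lemma pt_ratio c z m w : z != 0 -> m != 0 -> w = clog z - clog m ->
  pt c z = pt c m * cexp (- (beta%:C * w)).
Proof.
move=> zn mn ->; rewrite /pt -cexpD; congr cexp.
by rewrite mulrBr; ring.
Qed.

(* The bound is uniform in [c]: on the support of [f] the point [pt c m] stays
   in a fixed disc, and a cell displacement multiplies it by a factor
   close to 1 depending only on [normc m]. *)
Lemma pt_osc (e D : R) : 0 < e -> 0 <= D -> exists2 T : R, D < T &
  forall c m z, T < normc z -> normc (z - m) <= D -> D < `|complex.Im z| ->
  `|f (pt c m) - f (pt c z)| <= e.
Proof.
move=> e0 D0; have C0 := test_pos tf; have pi0 := @pi_gt0 R.
have [d d0 fd] := test_unif tf e0.
(* A factor within $2e_1$ of 1 displaces a point of the disc of radius $2C$ by at most $4Ce_1\le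
   d/2$. *)
pose e1 : R := Num.min 16^-1 (d / (8 * C)).
have e10 : 0 < e1 by rewrite lt_min; apply/andP; split => //; rewrite divr_gt0//; clra.
have [d1 d10 near1] := @cexp_near1 R 2^-1 e1 ltac:(clra) e10.
exists (D + D / d1 + 1).
  by have : 0 <= D / d1 by [rewrite divr_ge0// ltW]; clra.
move=> c m z zT zm Dz.
have Dd : 0 <= D / d1 by rewrite divr_ge0// ltW.
have mT : D / d1 + 1 < normc m.
  by have := normcD m (z - m); rewrite addrC subrK; clra.
have m0 : m != 0 by rewrite -normc_gt0; clra.
have zn0 : z != 0 by rewrite -normc_gt0; clra.
pose w := clog z - clog m.
have ew : cexp w = z / m.
  apply: (mulIf m0); rewrite divfK// -{1}(clogK m0) -cexpD /w addrC addrCA subrr addr0.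
  by rewrite clogK.
have wI : `|complex.Im w| <= 2 * pi * 2^-1.
  rewrite /w ImD ImN /=.
  have := carg_half z; have := carg_half m.
  have Imzm : `|complex.Im z - complex.Im m| <= D.
    by apply: le_trans zm; rewrite -ImN -ImD; exact: Im_le_normc.
  (* As $|\mathrm{Im}\,z|>D\ge|\mathrm{Im}\,z-\mathrm{Im}\,m|$, both points are on the same side of
     the real axis, and the cut of the argument does not separate them. *)
  move: Imzm Dz; rewrite ler_norml ltr_normr => /andP[i1 i2] /orP[iz|iz].
    have -> : 0 <= complex.Im z by clra.
    have -> : 0 <= complex.Im m by clra.
    by move=> /andP[? ?] /andP[? ?]; rewrite ler_norml; apply/andP; split; clra.
  have -> : (0 <= complex.Im z) = false by apply/negbTE; rewrite -ltNge; clra.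
  have -> : (0 <= complex.Im m) = false by apply/negbTE; rewrite -ltNge; clra.
  by move=> /andP[? ?] /andP[? ?]; rewrite ler_norml; apply/andP; split; clra.
have we : normc w < e1.
  apply: near1 => //; rewrite ew.
  have -> : z / m - 1 = (z - m) / m by rewrite mulrBl divff.
  rewrite normcM normcV ltr_pdivrMr; last by clra.
  apply: (le_lt_trans zm).
  have : D / d1 * d1 < normc m * d1 by rewrite ltr_pM2r//; clra.
  by rewrite divfK ?gt_eqF// mulrC.
have ptE := pt_ratio c zn0 m0 (erefl w).
have bw : normc (- (beta%:C * w)) <= normc w.
  by rewrite normcNE normcZ ger0_norm ?(ltW beta_gt0)// ler_piMl// normc_ge0.
have [e1a e1b] : e1 <= 16^-1 /\ e1 <= d / (8 * C) by split; rewrite ge_min lexx ?orbT.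
have h16 : normc (- (beta%:C * w)) <= 16^-1 by apply: le_trans bw _; clra.
have /andP[_ h2'] := cexpB1_bounds h16.
have h2 : normc (cexp (- (beta%:C * w)) - 1) <= 2 * e1.
  by apply: (le_trans h2'); clra.
have dist : normc (pt c m - pt c z) <= normc (pt c m) * (2 * e1).
  rewrite ptE -{1}(mulr1 (pt c m)) -mulrBr normcM normcBC.
  by apply: ler_wpM2l => //; exact: normc_ge0.
have [hm|hm] := leP (normc (pt c m)) (2 * C).
  apply: ltW; apply: fd; apply: (le_lt_trans dist).
  apply: (@le_lt_trans _ _ (2 * C * (2 * (d / (8 * C))))).
    by apply: ler_pM => //; [exact: normc_ge0|clra|clra].
  have -> : 2 * C * (2 * (d / (8 * C))) = d / 2 by field; rewrite gt_eqF.
  by clra.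
(* Now $|{\tt pt}\ c\ m|>2C$, and the displacement is at most an eighth of this modulus: both points
   lie outside the support. *)
have n0 := normc_ge0 (pt c m).
rewrite (test_supp tf (z := pt c m)); last by clra.
rewrite (test_supp tf (z := pt c z)) ?subrr ?normr0 ?(ltW e0)//.
have := normcB_ge (pt c m) (pt c m - pt c z); rewrite subKr.
have : normc (pt c m) * (2 * e1) <= normc (pt c m) / 8.
  by apply: ler_wpM2l => //; clra.
by clra.
Qed.

Let D := diam w1 w2.

(** The pointwise defect on a cell is the small oscillation of [pt_osc], except on a fixed disc, an
    annulus around $|z|=N$ and a strip along the real axis, where the trivial bound $B$ is used. *)
Lemma grid_pt_compare (eps : R) : 0 < eps -> exists2 M : R, 1 <= M &
  forall (N : R) c, M <= N ->
  `|cov * \sum_(m \in gridannulus z0 L 0 N) f (pt c m) - fine (cint (Fpt c N))|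
  <= eps * N ^+ 2.
Proof.
move=> eps0; have B0 := test_bound_ge0 tf; have pi0 := @pi_gt0 R.
have D0 : 0 <= D := diam_ge0 w1 w2.
(* The disc of radius $N+D\le2N$ has area at most $4\pi N^2$, so the oscillation costs half of
   $\varepsilon N^2$. The exceptional regions have total area linear in $N$, estimated through
   [Q]. *)
pose e := eps / (8 * pi).
have e0 : 0 < e by rewrite divr_gt0//; clra.
have [T DT osc] := @pt_osc e D e0 D0.
pose Q := B * (pi * T ^+ 2 + 4 * pi * D + 8 * D).
have T0 : 0 < T by clra.
have Q0 : 0 <= Q.
  rewrite mulr_ge0//; have : 0 <= pi * T ^+ 2 by [rewrite mulr_ge0 ?sqr_ge0// ltW].
  by have : 0 <= 4 * pi * D by [rewrite !mulr_ge0// ltW]; clra.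
have Qe : 0 <= 2 * Q / eps by apply: divr_ge0; [exact: mulr_ge0|exact: ltW].
exists (1 + D + 2 * Q / eps); first clra.
move=> N c NM.
have N1 : 1 <= N by clra.
have ND : D <= N by clra.
have NQ : 2 * Q / eps <= N by clra.
have ND0 : 0 <= N + D by clra.
pose E z := e * ind R (normc z <= N + D) + B * (ind R (normc z <= T)
  + (ind R (N - D < normc z <= N + D)
     + ind R (`|complex.Re z| <= N + D) * ind R (`|complex.Im z| <= D))).
have i0 b : 0 <= ind R b by exact: ind_ge0.
have mstrip : cmeas (fun z : R[i] => ind R (`|complex.Re z| <= N + D) * ind R (`|complex.Im z| <= D)).
  by apply: cmeasM; apply: cmeas_ind_norm; [exact: cmeas_Re|exact: cmeas_Im].
have m3 := cmeasD (@cmeas_ind_annulus R (N - D) (N + D)) mstrip.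
have m2 := cmeasD (@cmeas_ind_le R T) m3.
have mE : cmeas E.
  apply: cmeasD; first by apply: cmeasM; [exact: cmeas_cst|exact: cmeas_ind_le].
  by apply: cmeasM; [exact: cmeas_cst|].
have EE : cint E = (e * (pi * (N + D) ^+ 2) + B * (pi * T ^+ 2 +
   (pi * ((N + D) ^+ 2 - (N - D) ^+ 2) + 4 * (N + D) * D)))%:E.
  rewrite cintD; last 4 first.
  - by move=> z; rewrite mulr_ge0// ltW.
  - by move=> z; rewrite mulr_ge0// !addr_ge0// mulr_ge0.
  - by apply: cmeasM; [exact: cmeas_cst|exact: cmeas_ind_le].
  - by apply: cmeasM; [exact: cmeas_cst|].
  rewrite cintZ ?(ltW e0)//; last exact: cmeas_ind_le.
  rewrite cintZ//; last by move=> z; rewrite !addr_ge0// mulr_ge0.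
  rewrite cintD//; last 2 first.
  - by move=> z; rewrite !addr_ge0// mulr_ge0.
  - exact: cmeas_ind_le.
  rewrite cintD//; last 2 first.
  - by move=> z; rewrite mulr_ge0.
  - exact: cmeas_ind_annulus.
  rewrite cint_disc// cint_disc ?(ltW T0)// cint_annulus; last by apply/andP; split; clra.
  by rewrite cint_strip// -!EFinD -!EFinM -EFinD.
have Ffin : (cint (Fpt c N) < +oo)%E.
  apply: le_lt_trans (_ : (_ <= (B * (pi * N ^+ 2))%:E)%E) (ltry _).
  apply: cint_disc_fin => //; first by clra.
  - exact: (cmeas_Fpt tf).
  - exact: (Fpt_ge0 tf).
  - move=> z; rewrite /Fpt; apply: ler_pM => //; first exact: (test_ge0 tf).
      exact: (test_le tf).
    by rewrite /ind; case: ifP => [/andP[_ ->]//|_]; case: ifP.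
have fin : finite_set (gridannulus z0 L 0 N).
  apply: (@sub_finite_set _ _ (gridball z0 L N)); last exact: (grid_finite z0 L_lattice).
  by move=> m [Lm /andP[]].
have := @grid_compare R w1 w2 z0 L L_lattice (gridannulus z0 L 0 N) (fun m => f (pt c m))
  fin (fun m => @proj1 _ _) (fun m => test_ge0 tf (pt c m)) (Fpt c N) E
  (cmeas_Fpt tf beta c N) mE (Fpt_ge0 tf beta c N) Ffin.
rewrite EE /= => /(_ (ltry _)) cmp.
apply: (le_trans (cmp _)); last first.
  have eE : e * (pi * (N + D) ^+ 2) <= eps / 2 * N ^+ 2.
    have -> : e * (pi * (N + D) ^+ 2) = eps / 8 * (N + D) ^+ 2.
      by rewrite /e; have : pi != 0 :> R by [rewrite gt_eqF]; generalize (pi : R) => P P0; field.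
    have : (N + D) ^+ 2 <= 4 * N ^+ 2 by nra.
    by nra.
  have QE : B * (pi * T ^+ 2 + (pi * ((N + D) ^+ 2 - (N - D) ^+ 2) + 4 * (N + D) * D)) <= Q * N.
    rewrite /Q -[leRHS]mulrA; apply: ler_wpM2l => //.
    have -> : pi * ((N + D) ^+ 2 - (N - D) ^+ 2) = 4 * pi * D * N by ring.
    have : pi * T ^+ 2 <= pi * T ^+ 2 * N by rewrite ler_peMr// mulr_ge0 ?sqr_ge0// ltW.
    have : (N + D) * D <= 2 * D * N by nra.
    generalize (pi * T ^+ 2) (4 * pi * D) => P P' h1 h2.
    have -> : (P + P' + 8 * D) * N = P * N + P' * N + 8 * D * N by ring.
    by clra.
  have : Q * N <= eps / 2 * N ^+ 2.
    rewrite expr2 mulrA ler_wpM2r//; first by clra.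
    by move: NQ; rewrite ler_pdivrMr//; clra.
  by clra.
move=> m z Lm pm; have zm := par_diam L_lattice pm; rewrite -/D in zm.
have nm : normc m <= normc z + D.
  by have := normcB z (z - m); rewrite subKr; clra.
have nz : normc z <= normc m + D.
  by have := normcD m (z - m); rewrite addrC subrK; clra.
pose Gm := if m \in gridannulus z0 L 0 N then f (pt c m) else 0.
rewrite -/Gm.
have Gm0 : 0 <= Gm <= B.
  by rewrite /Gm; case: ifP => _; rewrite ?lexx// (test_ge0 tf) (test_le tf).
have F0 : 0 <= Fpt c N z <= B.
  rewrite /Fpt /ind; case: ifP => _; rewrite ?mulr1 ?mulr0 ?lexx//.
  by rewrite (test_ge0 tf) (test_le tf).
have dB : `|Gm - Fpt c N z| <= B by rewrite ler_norml; apply/andP; split; clra.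
have e0' := ltW e0.
have Bi b : 0 <= B * ind R b by rewrite mulr_ge0.
have ei b : 0 <= e * ind R b by rewrite mulr_ge0.
have B2 b b' : 0 <= B * (ind R b * ind R b') by rewrite mulr_ge0// mulr_ge0.
rewrite /E !mulrDr.
have [zT|zT] := leP (normc z) T.
  have -> : ind R true = 1 by [].
  by have := Bi (N - D < normc z <= N + D); have := ei (normc z <= N + D);
     have := B2 (`|complex.Re z| <= N + D) (`|complex.Im z| <= D); clra.
have [zN|zN] := ltP (N - D) (normc z) => /=.
  have [zN'|zN'] := leP (normc z) (N + D) => /=.
    by have := B2 (`|complex.Re z| <= N + D) (`|complex.Im z| <= D); have := Bi false; clra.
  have -> : Gm = 0.
    rewrite /Gm; case: ifPn => // /set_mem[_ /andP[_ h]]; clra.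
  have -> : Fpt c N z = 0.
    by rewrite /Fpt (_ : _ <= N = false) ?andbF ?mulr0//; apply/negbTE; rewrite -ltNge; clra.
  rewrite subrr normr0.
  by have := B2 (`|complex.Re z| <= N + D) (`|complex.Im z| <= D); have := Bi false; have := ei false; clra.
have -> : Gm = f (pt c m).
  by rewrite /Gm mem_set//; split => //; apply/andP; split; clra.
have -> : Fpt c N z = f (pt c z).
  have h1 : 0 < normc z by clra.
  have h2 : normc z <= N by clra.
  by rewrite /Fpt h1 h2 /= mulr1.
have -> : normc z <= N + D by clra.
have [iz|iz] := leP `|complex.Im z| D.
  have -> : `|complex.Re z| <= N + D by apply: (le_trans (Re_le_normc z)); clra.
  have -> : ind R true = 1 by [].
  have : `|f (pt c m) - f (pt c z)| <= B.
    have := test_ge0 tf (pt c m); have := test_le tf (pt c m).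
    have := test_ge0 tf (pt c z); have := test_le tf (pt c z).
    by rewrite ler_norml => ? ? ? ?; apply/andP; split; clra.
  by have := Bi false; clra.
have := osc c m z zT zm iz.
have -> : ind R true = 1 by [].
by have := Bi false; have := B2 (`|complex.Re z| <= N + D) false; clra.
Qed.

(* Only the number [K] of branches matters, not the position [A] of the
   window. *)
Lemma branch_average (eps : R) : 0 < eps -> exists2 M : R, 1 <= M &
  forall (N : R) (K : nat) (A : R) c, M <= N -> M <= K%:R ->
  exists2 J : R, Jint f beta c N = J%:E &
  `|\sum_(j < K) \sum_(m \in gridannulus z0 L 0 N)
      f (pt (c - (0 +i* (beta * (A + 2 * pi * j%:R)))) m) - K%:R / cov * J|
  <= eps * N ^+ 2 * K%:R.
Proof.
move=> eps0; have B0 := test_bound_ge0 tf; have pi0 := @pi_gt0 R.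
have cov0 := cov_gt0 z0 L_lattice.
pose e2 := eps * cov / 2.
have e20 : 0 < e2 by rewrite divr_gt0// mulr_gt0.
have [M M1 HM] := grid_pt_compare e20.
have q0 : 0 <= pi * B / beta / e2.
  exact: (divr_ge0 (divr_ge0 (mulr_ge0 (ltW pi0) B0) (ltW beta_gt0)) (ltW e20)).
(* The second summand bounds $K$ from below, so that the incomplete period, at most $\pi
   BN^2/\beta$, is below $Ke_2N^2$. *)
exists (M + pi * B / beta / e2); first clra.
move=> N K A c NM KM.
have N0 : 0 <= N by clra.
have [J [S [JE SE JS]]] := sum_cint_Fpt tf beta_gt0 c A K N0.
exists J => //.
have := Jint_bound tf beta c N0; rewrite JE !lee_fin => /andP[J0 JB].
pose cj (j : 'I_K) := c - (0 +i* (beta * (A + 2 * pi * j%:R))).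
have fin j : cint (Fpt (cj j) N) \is a fin_num.
  rewrite ge0_fin_numE; last by apply: cint_ge0; exact: (Fpt_ge0 tf).
  rewrite ltey; apply/eqP => inf; have : (+oo <= S%:E)%E; last by rewrite leye_eq.
  rewrite -SE -inf (bigD1 j)//= leeDl// sume_ge0// => i _.
  by apply: cint_ge0; exact: (Fpt_ge0 tf).
have SE' : S = \sum_(j < K) fine (cint (Fpt (cj j) N)).
  apply/eqP; rewrite -eqe -SE -sumEFin; apply/eqP; apply: eq_bigr => j _.
  by rewrite fineK// fin.
set X := \sum_(j < K) _.
have h1 : `|cov * X - S| <= K%:R * (e2 * N ^+ 2).
  rewrite SE' /X mulr_sumr -sumrB; apply: (le_trans (ler_norm_sum _ _ _)).
  apply: (@le_trans _ _ (\sum_(j < K) (e2 * N ^+ 2))).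
    by apply: ler_sum => j _; apply: HM; clra.
  by rewrite sumr_const card_ord mulr_natl.
have h2 : J / beta <= K%:R * (e2 * N ^+ 2).
  apply: (@le_trans _ _ (pi * B / beta * N ^+ 2)).
    by rewrite [leRHS]mulrAC ler_wpM2r// invr_ge0 ltW.
  rewrite mulrA ler_wpM2r ?sqr_ge0//.
  by rewrite -ler_pdivrMr//; clra.
have -> : X - K%:R / cov * J = (cov * X - K%:R * J) / cov by field; rewrite gt_eqF.
rewrite normrM normfV (gtr0_norm cov0) ler_pdivrMr//.
have -> : eps * N ^+ 2 * K%:R * cov = K%:R * (e2 * N ^+ 2) + K%:R * (e2 * N ^+ 2).
  by rewrite /e2; field.
have -> : cov * X - K%:R * J = (cov * X - S) + (S - K%:R * J) by ring.
by apply: (le_trans (ler_normD _ _)); apply: lerD => //; exact: le_trans JS h2.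
Qed.

End GridPoints.

(** * Linearization of the differences *)

Section Fibers.
Variables (R : nmodType) (I J : choiceType).

Lemma fsum_fibers (A : set I) (W : set J) (h : J -> I) (g : J -> R) :
  finite_set A -> finite_set W -> (forall j, W j -> A (h j)) ->
  \sum_(i \in A) \sum_(j \in W `&` [set j | h j = i]) g j = \sum_(j \in W) g j.
Proof.
move=> fA fW hWA.
transitivity (\sum_(i \in A) \sum_(j \in W) (if h j == i then g j else 0)).
  apply: eq_fsbigr => i _; rewrite fsbig_mkcondr; apply: eq_fsbigr => j _.
  case: eqP => hj; first by rewrite mem_set.
  by rewrite memNset.
rewrite exchange_fsbig//; apply: eq_fsbigr => j /set_mem Wj.
rewrite fsbig_finite//= (bigD1_seq (h j))//=; last first.
  by rewrite in_fset_set// mem_set//; exact: hWA.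
by rewrite eqxx big1 ?addr0// => i; rewrite eq_sym => /negbTE ->.
Qed.

(** Meant for a parametrization [s] that covers the support of [g] in [T] but may leave [T]: the
    terms outside are set to 0 and can be estimated afterwards. *)
Lemma fsum_image_support (T : set J) (P : set I) (s : I -> J) (g : J -> R) :
  finite_set P -> finite_set T -> {in P &, injective s} ->
  (forall j, T j -> g j <> 0 -> exists2 i, P i & s i = j) ->
  \sum_(j \in T) g j = \sum_(i \in P) (if s i \in T then g (s i) else 0).
Proof.
move=> fP fT sinj supp.
transitivity (\sum_(j \in T `&` (s @` P)) g j).
  apply/esym; apply: fsbig_widen; first by move=> j [].
  move=> j /= [Tj nj]; apply: contrapT => gj; apply: nj; split => //.
  by have [i Pi <-] := supp j Tj gj; exists i.
have -> : T `&` (s @` P) = s @` (P `&` [set i | T (s i)]).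
  apply/seteqP; split => j /=.
    by move=> [Tj [i Pi e]]; exists i => //; split => //; rewrite e.
  by move=> [i [Pi Ti] <-]; split => //; exists i.
rewrite fsbig_image; last first.
  by move=> x y /set_mem[Px _] /set_mem[Py _]; apply: sinj; exact: mem_set.
rewrite fsbig_mkcondr; apply: eq_fsbigr => i _.
have [Ti|Ti] := pselect (T (s i)); first by rewrite !mem_set.
by rewrite !memNset.
Qed.

End Fibers.

Section Linearization.
Variables (R : realType) (alpha : R).
Hypotheses (alpha_gt0 : 0 < alpha) (alpha_lt1 : alpha < 1).
Implicit Types (r s p w : R[i]).

Lemma expR_scale_ge (c0 rho : R) : 0 < c0 -> c0 <= expR rho ->
  expR (alpha * ln c0) <= expR (alpha * rho).
Proof.
move=> c00 h; rewrite ler_expR ler_pM2l//.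
by rewrite -ler_expR lnK.
Qed.

Lemma cexp_scaleB r w : cexp (alpha%:C * (r + w)) - cexp (alpha%:C * r) =
  cexp (alpha%:C * r) * (cexp (alpha%:C * w) - 1).
Proof. by rewrite mulrDr cexpD mulrBr mulr1. Qed.

Lemma normc_cexp_scale r : normc (cexp (alpha%:C * r)) = expR (alpha * complex.Re r).
Proof. by rewrite normc_cexp ReZ. Qed.

(** With $w=s-r$ the hypothesis bounds $|e^{\alpha w}-1|$ by $C/(\varphi e^{\alpha\mathrm{Re}\,r})$,
    which is small because $|e^r|\ge c_0$. Then $w$ is small, and $|e^w-1|$ is comparable with
    $|w|$. *)
Lemma close_logs (C c0 e1 : R) : 0 < C -> 0 < c0 -> 0 < e1 -> exists2 F : R, 0 < F &
  forall (phi : R) r s, F <= phi -> c0 <= normc (cexp r) ->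
  `|complex.Im r - complex.Im s| < 2 * pi ->
  normc (phi%:C * (cexp (alpha%:C * s) - cexp (alpha%:C * r))) <= C ->
  normc (s - r) < e1 /\
  normc (cexp s - cexp r) <= 4 * C / alpha * expR ((1 - alpha) * complex.Re r) / phi.
Proof.
move=> C0 c00 e10; have pi0 := @pi_gt0 R.
pose e2 := Num.min e1 16^-1.
have e20 : 0 < e2 by rewrite lt_min e10; clra.
have [e2a e2b] : e2 <= e1 /\ e2 <= 16^-1 by split; rewrite ge_min lexx ?orbT.
(* Here $\alpha<1$ matters: $|\mathrm{Im}\,\alpha w|\le2\pi\alpha$ stays away from $2\pi$, so
   $e^{\alpha w}$ near 1 forces $w$ near 0. *)
have [d d0 near1] := @cexp_near1 R alpha (alpha * e2) ltac:(by rewrite alpha_gt0) ltac:(by rewrite mulr_gt0).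
pose X0 := expR (alpha * ln c0).
have X00 : 0 < X0 by exact: expR_gt0.
have C2 : 0 < C / (d * X0) by rewrite divr_gt0// mulr_gt0.
exists (C / (d * X0) + 1); first by clra.
move=> phi r s Fphi cr Im_rs hC.
have phi0 : 0 < phi by clra.
pose w := s - r; have sE : s = r + w by rewrite /w addrC subrK.
have XX0 : X0 <= expR (alpha * complex.Re r).
  by apply: expR_scale_ge => //; rewrite -normc_cexp.
set X := expR (alpha * complex.Re r) in XX0.
have Xpos : 0 < X by exact: expR_gt0.
rewrite sE cexp_scaleB normcZ (gtr0_norm phi0) normcM normc_cexp_scale -/X in hC.
have h1 : normc (cexp (alpha%:C * w) - 1) <= C / (phi * X).
  by rewrite ler_pdivlMr ?mulr_gt0// mulrC -mulrA.
have h2 : C / (phi * X) < d.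
  rewrite ltr_pdivrMr ?mulr_gt0//.
  have : C < d * (phi * X0).
    have : C / (d * X0) < phi by clra.
    by rewrite ltr_pdivrMr ?mulr_gt0//; clra.
  move=> h; apply: (lt_le_trans h); rewrite ler_pM2l// ler_pM2l//.
have wI : `|complex.Im (alpha%:C * w)| <= 2 * pi * alpha.
  rewrite ImZ normrM (gtr0_norm alpha_gt0) mulrC ler_pM2r//.
  by rewrite /w ImD ImN distrC ltW.
have h3 := near1 _ wI (le_lt_trans h1 h2).
rewrite normcZ (gtr0_norm alpha_gt0) ltr_pM2l// in h3.
split; first by rewrite -/w; clra.
have n0 := normc_ge0 w.
have aw16 : normc (alpha%:C * w) <= 16^-1.
  rewrite normcZ (gtr0_norm alpha_gt0).
  have : alpha * normc w <= normc w by rewrite ler_piMl// ltW.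
  by clra.
have /andP[h4 _] := cexpB1_bounds aw16.
rewrite normcZ (gtr0_norm alpha_gt0) in h4.
have w16 : normc w <= 16^-1 by clra.
have /andP[_ h5] := cexpB1_bounds w16.
have -> : cexp s - cexp r = cexp r * (cexp w - 1) by rewrite sE cexpD mulrBr mulr1.
rewrite normcM normc_cexp.
have eX : expR (complex.Re r) = X * expR ((1 - alpha) * complex.Re r).
  by rewrite /X -expRD; congr expR; ring.
rewrite eX; set Y := expR ((1 - alpha) * complex.Re r).
have Y0 : 0 < Y by exact: expR_gt0.
have h6 : normc w <= 2 * C / (alpha * (phi * X)).
  rewrite ler_pdivlMr ?mulr_gt0//.
  have := le_trans h4 h1; rewrite ler_pdivlMr ?mulr_gt0//; clra.
apply: (@le_trans _ _ (X * Y * (2 * (2 * C / (alpha * (phi * X)))))).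
  apply: ler_wpM2l; first by rewrite mulr_ge0// ltW.
  by apply: (le_trans h5); clra.
rewrite le_eqVlt; apply/orP; left; apply/eqP; field.
by rewrite !gt_eqF.
Qed.

(** The converse of [close_logs]: such a [p] is small compared with $e^r$, since $|p/e^r|\le
    C_1/(\varphi e^{\alpha\mathrm{Re}\,r})$. Hence $e^r+p$ has a logarithm near [r], and the
    linearization error is quadratic in this quotient. *)
Lemma log_of_shift (C1 c0 e1 eps : R) : 0 < C1 -> 0 < c0 -> 0 < e1 -> 0 < eps ->
  exists2 F : R, 0 < F &
  forall (phi : R) r p, F <= phi -> c0 <= normc (cexp r) ->
  normc p <= C1 * expR ((1 - alpha) * complex.Re r) / phi ->
  exists w, [/\ cexp (r + w) = cexp r + p, normc w < e1 &
    normc (phi%:C * (cexp (alpha%:C * (r + w)) - cexp (alpha%:C * r))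
           - (phi * alpha)%:C * p * cexp ((alpha - 1)%:C * r)) <= eps].
Proof.
move=> C10 c00 e10 eps0.
pose e2 := Num.min e1 16^-1.
have e20 : 0 < e2 by rewrite lt_min e10; clra.
have [e2a e2b] : e2 <= e1 /\ e2 <= 16^-1 by split; rewrite ge_min lexx ?orbT.
have [d d0 locl] := cexp_local_log e20.
pose X0 := expR (alpha * ln c0).
have X00 : 0 < X0 by exact: expR_gt0.
have p1 : 0 < C1 / (d * X0) by rewrite divr_gt0// mulr_gt0.
(* The factor 64 is $16\cdot4$: two Taylor remainders give $16|w|^2$, and $|w|\le2|q|$. *)
have p2 : 0 < 64 * C1 ^+ 2 / (eps * X0) by rewrite divr_gt0// ?mulr_gt0// exprn_gt0.
exists (C1 / (d * X0) + 64 * C1 ^+ 2 / (eps * X0) + 1); first by clra.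
move=> phi r p Fphi cr hp.
have phi0 : 0 < phi by clra.
have XX0 : X0 <= expR (alpha * complex.Re r).
  by apply: expR_scale_ge => //; rewrite -normc_cexp.
set X := expR (alpha * complex.Re r) in XX0.
have Xpos : 0 < X by exact: expR_gt0.
have m0 := cexp_neq0 r.
pose q := p / cexp r.
have eX : expR (complex.Re r) = X * expR ((1 - alpha) * complex.Re r).
  by rewrite /X -expRD; congr expR; ring.
have Y0 : 0 < expR ((1 - alpha) * complex.Re r) by exact: expR_gt0.
have nq : normc q <= C1 / (phi * X).
  rewrite normcM normcV normc_cexp eX ler_pdivrMr ?mulr_gt0//.
  apply: (le_trans hp); rewrite le_eqVlt; apply/orP; left; apply/eqP; field.
  by rewrite !gt_eqF.
have qd : C1 / (phi * X) < d.
  rewrite ltr_pdivrMr ?mulr_gt0//.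
  have h : C1 < d * (phi * X0).
    have : C1 / (d * X0) < phi by clra.
    by rewrite ltr_pdivrMr ?mulr_gt0//; clra.
  by apply: (lt_le_trans h); rewrite ler_pM2l// ler_pM2l.
have [w [we w1 w2]] := locl q (le_lt_trans nq qd).
exists w; split.
- by rewrite cexpD we mulrDr mulr1 /q mulrC divfK// .
- by clra.
have n0 := normc_ge0 w; have nq0 := normc_ge0 q.
have pE : p = q * cexp r by rewrite /q divfK.
have ra : cexp r * cexp ((alpha - 1)%:C * r) = cexp (alpha%:C * r).
  rewrite -cexpD; congr cexp; apply: eqC; rewrite ?ReD ?ImD ?ReZ ?ImZ; ring.
(* Since $p=e^r(e^w-1)$, both expressions are multiples of $e^{\alpha r}$ with the same first-order
   term $\alpha w$; only the two remainders survive. *)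
have -> : phi%:C * (cexp (alpha%:C * (r + w)) - cexp (alpha%:C * r))
    - (phi * alpha)%:C * p * cexp ((alpha - 1)%:C * r) =
  phi%:C * (cexp (alpha%:C * r) * ((cexp (alpha%:C * w) - 1 - alpha%:C * w)
     - alpha%:C * (cexp w - 1 - w))).
  rewrite cexp_scaleB pE we -ra rmorphM /=; ring.
rewrite normcZ (gtr0_norm phi0) normcM normc_cexp_scale -/X.
have aw : normc (alpha%:C * w) <= normc w.
  by rewrite normcZ (gtr0_norm alpha_gt0) ler_piMl// ltW.
have t1 := cexp_taylor (_ : normc (alpha%:C * w) <= 2^-1).
have t2 := cexp_taylor (_ : normc w <= 2^-1).
have t3 : normc ((cexp (alpha%:C * w) - 1 - alpha%:C * w) - alpha%:C * (cexp w - 1 - w)) <= 16 * normc w ^+ 2.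
  apply: (le_trans (normcB _ _)); rewrite normcZ (gtr0_norm alpha_gt0).
  have h1 : normc (cexp (alpha%:C * w) - 1 - alpha%:C * w) <= 8 * normc w ^+ 2.
    apply: (le_trans (t1 _)); first by clra.
    rewrite ler_pM2l//; apply: lerXn2r => //; rewrite nnegrE; exact: normc_ge0.
  have h2 : normc (cexp w - 1 - w) <= 8 * normc w ^+ 2 by apply: t2; clra.
  have : alpha * normc (cexp w - 1 - w) <= normc (cexp w - 1 - w).
    by rewrite ler_piMl ?normc_ge0// ltW.
  by clra.
have t4 : normc w ^+ 2 <= 4 * (C1 / (phi * X)) ^+ 2.
  have : normc w <= 2 * (C1 / (phi * X)) by clra.
  have : 0 <= C1 / (phi * X) by rewrite divr_ge0// ?mulr_ge0// ltW.
  by move=> ? ?; nra.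
apply: (@le_trans _ _ (phi * (X * (16 * (4 * (C1 / (phi * X)) ^+ 2))))).
  rewrite ler_pM2l// ler_pM2l//; clra.
have -> : phi * (X * (16 * (4 * (C1 / (phi * X)) ^+ 2))) = 64 * C1 ^+ 2 / (phi * X).
  by field; rewrite !gt_eqF.
rewrite ler_pdivrMr ?mulr_gt0//.
have h : 64 * C1 ^+ 2 < eps * (phi * X0).
  have : 64 * C1 ^+ 2 / (eps * X0) < phi by clra.
  by rewrite ltr_pdivrMr ?mulr_gt0//; clra.
apply: ltW; apply: (lt_le_trans h); rewrite ler_pM2l// ler_pM2l//.
Qed.

End Linearization.

(** * Discreteness and quadratic growth of the grid *)

Section GridDiscrete.
Variables (R : realType) (w1 w2 : R[i]) (L : set R[i]).
Hypothesis L_lattice : lattice_basis L w1 w2.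
Notation cov := (covol w1 w2).

Lemma latticeD p q : L p -> L q -> L (p + q).
Proof.
rewrite (proj2 L_lattice) => -[a [b ->]] [c [d ->]]; exists (a + c), (b + d).
by rewrite !intrD; ring.
Qed.

Lemma latticeN p : L p -> L (- p).
Proof.
rewrite (proj2 L_lattice) => -[a [b ->]]; exists (- a), (- b).
by rewrite !intrN; ring.
Qed.

Lemma grid0E : grid 0 L = L.
Proof.
by apply/seteqP; split => [p [q Lq <-]|p Lp]; [rewrite add0r|exists p; rewrite ?add0r].
Qed.

Lemma gridD z0 m p : grid z0 L m -> L p -> grid z0 L (m + p).
Proof. by move=> [q Lq <-] Lp; exists (q + p); [exact: latticeD|rewrite addrA]. Qed.

Lemma gridB z0 m n : grid z0 L m -> grid z0 L n -> L (n - m).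
Proof.
move=> [p Lp <-] [q Lq <-]; rewrite (_ : _ - _ = q + - p); last by ring.
by apply: latticeD => //; exact: latticeN.
Qed.

Lemma seq_pos_min (T : eqType) (F : T -> R) (s : seq T) :
  {in s, forall x, 0 < F x} -> exists2 c, 0 < c & {in s, forall x, c <= F x}.
Proof.
elim: s => [|x s IH] h; first by exists 1.
have [|c c0 H] := IH; first by move=> y ys; apply: h; rewrite inE ys orbT.
have Fx : 0 < F x by apply: h; rewrite inE eqxx.
exists (Num.min c (F x)); first by rewrite lt_min c0.
move=> y; rewrite inE => /orP[/eqP->|/H cy]; rewrite ge_min ?lexx ?orbT//.
by rewrite cy.
Qed.

Lemma gridannulus_finite z0 (a b : R) : finite_set (gridannulus z0 L a b).
Proof.
apply: (@sub_finite_set _ _ (gridball z0 L b)); last exact: (grid_finite z0 L_lattice).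
by move=> m [? /andP[_ ?]].
Qed.

(** The unit disc contains finitely many grid points. This bound is the $c_0$ that makes the
    thresholds for $\varphi$ in the linearization independent of $m$. *)
Lemma grid_min_norm z0 : exists2 c : R, 0 < c &
  forall m, grid z0 L m -> m != 0 -> c <= normc m.
Proof.
have fS := gridannulus_finite z0 0 1.
have [|c c0 H] := @seq_pos_min _ (@normc R) (finmap.enum_fset (fset_set (gridannulus z0 L 0 1))).
  by move=> m; rewrite in_fset_set// => /set_mem[_ /andP[]].
exists (Num.min c 1); first by rewrite lt_min c0 ltr01.
move=> m Lm m0; rewrite ge_min; have [m1|m1] := leP (normc m) 1; last by rewrite (ltW m1) orbT.
apply/orP; left; apply: H; rewrite in_fset_set// mem_set//.
by split => //; rewrite normc_gt0 m0.
Qed.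

Lemma ncard_ge0 (S : set R[i]) : 0 <= ncard S.
Proof. exact: fsumr_ge0. Qed.

(** Removing the origin makes the count 0 for small radii, so the quadratic bound holds for every
    radius. This is essential because the reach tends to 0 when $\lambda=+\infty$. *)
Lemma card_gridannulus0_le z0 : exists2 c : R, 0 < c &
  forall P : R, ncard (gridannulus z0 L 0 P) <= c * P ^+ 2.
Proof.
have [c c0 H] := grid_min_norm z0; have cov0 := cov_gt0 z0 L_lattice.
have pi0 := @pi_gt0 R; have D0 := @diam_ge0 R w1 w2; set D := diam w1 w2 in D0.
exists (pi * (1 + D / c) ^+ 2 / cov).
  rewrite divr_gt0// mulr_gt0// exprn_gt0//.
  have : 0 <= D / c by rewrite divr_ge0// ltW.
  by lra.
move=> P; have [Pc|cP] := ltP P c.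
  rewrite /ncard (_ : gridannulus z0 L 0 P = set0) ?fsbig_set0.
    by rewrite mulr_ge0 ?sqr_ge0// mulr_ge0 ?invr_ge0 ?(ltW cov0)// mulr_ge0 ?sqr_ge0// (ltW pi0).
  apply/seteqP; split => // m [Lm /andP[m0 mP]]; rewrite normc_gt0 in m0.
  by have := H m Lm m0; lra.
have P0 : 0 <= P by lra.
apply: (@le_trans _ _ (ncard (gridball z0 L P))).
  apply: ler_fsum_subset => //; first exact: (grid_finite z0 L_lattice).
  by move=> m [? /andP[_ ?]].
apply: (le_trans (card_gridball_le z0 L_lattice P0)).
rewrite [leRHS]mulrAC ler_wpM2r ?invr_ge0 ?(ltW cov0)// -mulrA ler_pM2l// -exprMn.
apply: lerXn2r; rewrite ?nnegrE.
- by rewrite addr_ge0.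
- by rewrite mulr_ge0// addr_ge0// divr_ge0// ltW.
rewrite mulrDl mul1r lerD2l -mulrA ler_peMr// mulrC ler_pdivlMr// mul1r.
by [].
Qed.

End GridDiscrete.

(** * Numbering of the logarithms in a window *)

Section Branches.
Variable R : realType.
Implicit Types (S : set R[i]) (m r : R[i]).

(** Branches are numbered from the bottom of the window: the indices below $N'+N''$ give exactly the
    logarithms inside it. *)
Definition branch (N' : nat) (q : R[i] * nat) : R[i] :=
  clog q.1 + (0 +i* (- (2 * pi * N'%:R) + 2 * pi * q.2%:R)).

Lemma cexp_periodD z k : cexp (z + (0 +i* (2 * pi * k%:R))) = cexp z :> R[i].
Proof.
elim: k z => [|k IH] z; first by rewrite mulr0 addr0.
rewrite -[RHS]IH -[RHS]cexp2pi -addrA; congr (cexp (z + _)).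
by apply: eqC; rewrite ?ReD ?ImD /= -?natr1; ring.
Qed.

Lemma cexp_periodB z k : cexp (z - (0 +i* (2 * pi * k%:R))) = cexp z :> R[i].
Proof. by rewrite -[LHS](cexp_periodD _ k) subrK. Qed.

Lemma Im_branch N' m j :
  complex.Im (branch N' (m, j)) = carg m - 2 * pi * N'%:R + 2 * pi * j%:R.
Proof. by rewrite /branch ImD /= addrA. Qed.

Lemma cexp_branch N' m j : m != 0 -> cexp (branch N' (m, j)) = m.
Proof.
move=> m0; rewrite -[RHS](clogK m0) -[RHS](cexp_periodB _ N') -[RHS](cexp_periodD _ j).
by congr cexp; apply: eqC; rewrite /branch ?ReD ?ImD ?ReN ?ImN /=; ring.
Qed.

Definition strip_logs S (N' N'' : nat) : set R[i] :=
  [set r | S (cexp r) /\ - (2 * pi * N'%:R) <= complex.Im r < 2 * pi * N''%:R].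

Lemma branch_bij S N' N'' : ~ S 0 ->
  set_bij (S `*` `I_(N' + N'')) (strip_logs S N' N'') (branch N').
Proof.
move=> S0; have pi0 := @pi_gt0 R.
have nz m : S m -> m != 0 by move=> Sm; apply/eqP => e; apply: S0; rewrite -e.
split.
- move=> [m j] [/= Sm jK]; split; first by rewrite cexp_branch// nz.
  rewrite Im_branch; have /andP[c0 c1] := carg_itv (nz _ Sm).
  have : (2 * pi : R) * j.+1%:R <= 2 * pi * (N' + N'')%:R by rewrite ler_pM2l ?mulr_gt0// ler_nat.
  have : 0 <= (2 * pi : R) * j%:R by rewrite mulr_ge0 ?ler0n// mulr_ge0// ltW.
  rewrite -natr1 natrD => h1 h2; apply/andP; split; lra.
- move=> [m j] [n k] /set_mem[/= Sm _] /set_mem[/= Sn _] e.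
  have emn : m = n by rewrite -(cexp_branch N' j (nz _ Sm)) e cexp_branch// nz.
  rewrite emn in e *; congr (_, _).
  have : 2 * pi * (j%:R : R) = 2 * pi * k%:R.
    by have := congr1 (@complex.Im R) e; rewrite !Im_branch; lra.
  have p2 : (2 * pi : R) != 0 by rewrite gt_eqF// mulr_gt0.
  by move/(mulfI p2)/eqP; rewrite eqr_nat => /eqP.
- move=> r [Sr /andP[r1 r2]].
  (* The number of turns of [r] above the bottom of the window; its integer part is the index of the
     branch. *)
  pose x := (complex.Im r + 2 * pi * N'%:R) / (2 * pi).
  have p2 : (0 : R) < 2 * pi by rewrite mulr_gt0.
  have xE : complex.Im r = 2 * pi * x - 2 * pi * N'%:R.
    by rewrite /x mulrC divfK ?gt_eqF//; ring.
  have x0 : 0 <= x by rewrite /x divr_ge0// ?(ltW p2)//; lra.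
  have /andP[j1 j2] := truncn_itv x0; set j := Num.truncn x in j1 j2.
  have aI : 0 <= complex.Im r + 2 * pi * N'%:R - 2 * pi * j%:R < 2 * pi.
    rewrite xE; move: j1 j2; rewrite -natr1 -(ler_pM2l p2) -(ltr_pM2l p2) => h1 h2.
    apply/andP; split; lra.
  exists (cexp r, j); last first.
    rewrite /branch /=; set t := complex.Im r + _ - _ in aI.
    have e : cexp r = cexp (complex.Re r +i* t).
      rewrite -[LHS](cexp_periodD _ N') -[LHS](cexp_periodB _ j); congr cexp.
      by apply: eqC; rewrite ?ReD ?ImD ?ReN ?ImN /t /=; ring.
    apply: eqC.
      by rewrite ReD Re_clog normc_cexp expRK addr0.
    by rewrite ImD (_ : complex.Im (clog (cexp r)) = carg (cexp r))//= e cargE// /t; ring.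
  split => //=.
  have : x < (N' + N'')%:R.
    by rewrite -(ltr_pM2l p2) natrD; lra.
  by move=> h; rewrite -(ltr_nat R); exact: le_lt_trans h.
Qed.

Lemma fsum_strip_logs (S : set R[i]) N' N'' (F : R[i] -> R) : ~ S 0 -> finite_set S ->
  \sum_(r \in strip_logs S N' N'') F r =
  \sum_(j < N' + N'') \sum_(m \in S) F (branch N' (m, nat_of_ord j)).
Proof.
move=> S0 fS; rewrite (@reindex_fsbig _ _ _ _ _ (branch N') _ _ F (branch_bij N' N'' S0)).
rewrite (fsbig_ord _ _ (fun j => \sum_(m \in S) F (branch N' (m, j)))).
by rewrite exchange_fsbig// pair_fsbig.
Qed.

Lemma strip_logs_finite S N' N'' : ~ S 0 -> finite_set S -> finite_set (strip_logs S N' N'').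
Proof.
move=> S0 fS; apply: (@sub_finite_set _ _ (branch N' @` (S `*` `I_(N' + N'')))).
  by have [_ _] := branch_bij N' N'' S0.
by apply: finite_image; apply: finite_setX.
Qed.

End Branches.

(** * Linearization of the double sum over pairs of logarithms *)

Section PairSums.
Variables (R : realType) (alpha : R).
Hypotheses (alpha_gt0 : 0 < alpha) (alpha_lt1 : alpha < 1).
Variables (f : R[i] -> R) (B C : R).
Hypothesis tf : test_function f B C.
Variables (w1 w2 z0 : R[i]) (L : set R[i]).
Hypothesis L_lattice : lattice_basis L w1 w2.
Notation cov := (covol w1 w2).
Notation Mset N := (gridannulus z0 L 0 N%:R).
Implicit Types (phi : R) (r s p m : R[i]) (N : nat).

Definition log_diff phi (rs : R[i] * R[i]) : R[i] :=
  phi%:C * (cexp (alpha%:C * rs.2) - cexp (alpha%:C * rs.1)).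

Definition pair_sum phi N N' N'' : R :=
  \sum_(mn \in grid_pairs (grid z0 L) N)
    \sum_(rs \in log_pairs mn.1 mn.2 N' N'') f (log_diff phi rs).

Definition close_log_pairs N N' N'' : set (R[i] * R[i]) :=
  [set rs | [/\ strip_logs (Mset N) N' N'' rs.1, strip_logs (Mset N) N' N'' rs.2,
     cexp rs.2 <> cexp rs.1 & `|complex.Im rs.1 - complex.Im rs.2| < 2 * pi]].

Let Mset_finite N : finite_set (Mset N).
Proof. exact: (gridannulus_finite L_lattice). Qed.

Let Mset0 N : ~ Mset N 0.
Proof. by move=> [_ /andP[+ _]]; rewrite normc_gt0 eqxx. Qed.

Let close_log_pairs_finite N N' N'' : finite_set (close_log_pairs N N' N'').
Proof.
apply: (@sub_finite_set _ _ (strip_logs (Mset N) N' N'' `*` strip_logs (Mset N) N' N'')).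
  by move=> [r s] [].
by apply: finite_setX; apply: strip_logs_finite.
Qed.

(** The admissible pairs $(r,s)$ form one finite set, fibred over $(m,n)$ by the exponential and
    over [r] by projection; the same sum is read in both ways. *)
Lemma pair_sum_rows phi N N' N'' : pair_sum phi N N' N'' =
  \sum_(r \in strip_logs (Mset N) N' N'')
    \sum_(rs \in close_log_pairs N N' N'' `&` [set rs | rs.1 = r]) f (log_diff phi rs).
Proof.
rewrite (@fsum_fibers _ _ _ _ (close_log_pairs N N' N'') fst)//; last 2 first.
- by apply: strip_logs_finite.
- by move=> rs [].
rewrite -(@fsum_fibers _ _ _ (grid_pairs (grid z0 L) N) (close_log_pairs N N' N'')
   (fun rs => (cexp rs.1, cexp rs.2)))//.
- apply: eq_fsbigr => -[m n] /set_mem[/= Lm Ln nm m0 n0].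
  congr (\big[_/_]_(_ \in _) _); apply/seteqP; split => -[r s] /=.
    move=> [/= er es rs r1 s1]; rewrite /clogs /= in er es; split; last by rewrite er es.
    by split => //=; rewrite /strip_logs /= ?er ?es.
  by move=> [[/= [_ r1] [_ s1] _ rs] [<- <-]]; split.
- apply: (@sub_finite_set _ _ (Mset N `*` Mset N)); last exact: finite_setX.
  by move=> [m n] [].
- by move=> [r s] [/= [[? ?] _] [[? ?] _] ? _]; split.
Qed.

Notation fin P := (gridannulus 0 L 0 P).
Definition lin_diff phi p r : R[i] := (phi * alpha)%:C * p * cexp ((alpha - 1)%:C * r).
(** By [close_logs] and $|m|\le N$, a contributing difference $n-m$ has at most this size. It equals
    $4C/(\alpha\lambda_N)$. *)
Definition reach phi N : R := 4 * C / alpha * N%:R `^ (1 - alpha) / phi.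
(** The margin 1 is the distance within which [log_of_shift] is asked to place the logarithm of
    $m+p$. *)
Definition near_edge (N' N'' : nat) (r : R[i]) : bool := (complex.Im r < - (2 * pi * N'%:R) + 1) ||
  (2 * pi * N''%:R - 1 <= complex.Im r).

Let C0 : 0 < C := test_pos tf.
Let B0 : 0 <= B := test_bound_ge0 tf.
Let C1 : R := 4 * C / alpha.
Let C10 : 0 < C1. Proof. by rewrite divr_gt0// mulr_gt0. Qed.

Lemma normc_lin phi p r : 0 < phi ->
  normc (lin_diff phi p r) = phi * alpha * normc p / expR ((1 - alpha) * complex.Re r).
Proof.
move=> phi0; rewrite /lin_diff normcM normcZ gtr0_norm ?mulr_gt0// normc_cexp ReZ.
by rewrite -expRN; congr (_ * expR _); ring.
Qed.

(** For fixed [r] the partners [s] are reindexed by $p=e^s-e^r$. Uniform continuity replaces each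
    difference by its linearization up to [eps]; a [p] without admissible partner costs $B$ and
    occurs only for exceptional [r]. *)
Lemma row_linear (eps : R) : 0 < eps -> exists2 F : R, 0 < F &
  forall phi N N' N'' r, F <= phi -> (0 < N)%N -> strip_logs (Mset N) N' N'' r ->
  `|\sum_(rs \in close_log_pairs N N' N'' `&` [set rs | rs.1 = r]) f (log_diff phi rs)
    - \sum_(p \in fin (reach phi N)) f (lin_diff phi p r)|
  <= ncard (fin (reach phi N)) *
     (eps + B * (ind R (N%:R - reach phi N < normc (cexp r)) + ind R (near_edge N' N'' r))).
Proof.
move=> eps0; have pi2 : (2 : R) <= pi by exact: pi_ge2.
have [c0 c00 cmin] := grid_min_norm L_lattice z0.
have [d d0 ud] := test_unif tf eps0.
have [F1 F10 close] := close_logs alpha_gt0 alpha_lt1 C0 c00 ltr01.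
have d20 : 0 < d / 2 by rewrite divr_gt0.
have [F2 F20 shift] := log_of_shift alpha_gt0 alpha_lt1 C10 c00 ltr01 d20.
exists (F1 + F2); first by rewrite addr_gt0.
move=> phi N N' N'' r Fphi N0 Wr.
have phi0 : 0 < phi by clra.
have N0' : (0 : R) < N%:R by rewrite ltr0n.
set P := reach phi N; set Y := expR ((1 - alpha) * complex.Re r).
have Y0 : 0 < Y by exact: expR_gt0.
have [[Lr /andP[r0 rN]] rI] := Wr.
have cr : c0 <= normc (cexp r) by apply: cmin => //; exact: cexp_neq0.
have YN : Y <= N%:R `^ (1 - alpha).
  have a1 : 0 < 1 - alpha by rewrite subr_gt0.
  rewrite /Y /powR (gt_eqF N0') ler_expR (ler_pM2l a1).
  by rewrite -ler_expR lnK ?posrE// -normc_cexp.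
(* This radius depends on the modulus of the given [r], as [log_of_shift] requires, whereas [fin P]
   is the same for all rows. *)
pose Q := [set p | L p /\ 0 < normc p <= C1 * Y / phi].
have QP : Q `<=` fin P.
  move=> p [Lp /andP[p0 pQ]]; split; first by rewrite grid0E.
  rewrite p0 /=; apply: (le_trans pQ); rewrite /P /reach -/C1.
  by rewrite ler_pM2r ?invr_gt0// ler_pM2l.
have fP : finite_set (fin P) by exact: (gridannulus_finite L_lattice).
have fQ : finite_set Q by exact: sub_finite_set fP.
have wex p : exists w, Q p -> [/\ cexp (r + w) = cexp r + p, normc w < 1 &
    normc (log_diff phi (r, r + w) - lin_diff phi p r) <= d / 2].
  have [Qp|] := pselect (Q p); last by exists 0.
  have [|||w [h1 h2 h3]] := shift phi r p; [by clra|exact: cr|by case: Qp => _ /andP[]|].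
  by exists w.
have [w wP] := choice wex.
set T := close_log_pairs N N' N'' `&` [set rs | rs.1 = r].
have fT : finite_set T by apply: sub_finite_set (@close_log_pairs_finite N N' N'') => rs [].
rewrite (@fsum_image_support _ _ _ T Q (fun p => (r, r + w p)))//; last 2 first.
- move=> p q /set_mem/wP[wp _ _] /set_mem/wP[wq _ _] [] /addrI e.
  by apply: (addrI (cexp r)); rewrite -wp -wq e.
- move=> [r' s] [[/= _ [[Ls _] sI] sr rs] /= er]; rewrite {}er in sr rs * => fs0.
  have small : normc (log_diff phi (r, s)) <= C.
    by rewrite leNgt; apply/negP => /(test_supp tf).
  have [||||s1 s2] := close phi r s; [by clra|exact: cr|exact: rs|exact: small|].
  have Qp : Q (cexp s - cexp r).
    split; first exact: (gridB L_lattice Lr Ls).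
    by rewrite normc_gt0 subr_eq0; apply/andP; split; [exact/eqP|exact: s2].
  exists (cexp s - cexp r) => //; congr (_, _).
  (* Both [s] and the logarithm built from [p] lie within 1 of [r], so their imaginary parts differ
     by less than 2 and the two coincide. *)
  have [e1 e2 _] := wP _ Qp; apply: cexp_inj; last by rewrite e1 addrC subrK.
  have := Im_le_normc (w (cexp s - cexp r)); have := Im_le_normc (s - r).
  rewrite !ImD ImN => h1 h2.
  rewrite (_ : _ - _ = complex.Im (w (cexp s - cexp r)) - (complex.Im s - complex.Im r)); last by ring.
  by apply: (le_lt_trans (ler_normB _ _)); clra.
(* Outside [Q] the linearized difference exceeds $4C$ in modulus, beyond the support. *)
have -> : \sum_(p \in fin P) f (lin_diff phi p r) = \sum_(p \in Q) f (lin_diff phi p r).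
  apply/esym; apply: fsbig_widen => //= p [[Lp /andP[p0 pP]] nQ].
  apply: (test_supp tf); rewrite normc_lin// -/Y ltr_pdivlMr//.
  have : C1 * Y / phi < normc p.
    rewrite ltNge; apply/negP => h; apply: nQ; split; first by rewrite -[L]grid0E.
    by rewrite p0.
  rewrite /C1 => h.
  have : phi * alpha * (4 * C / alpha * Y / phi) < phi * alpha * normc p.
    by rewrite ltr_pM2l ?mulr_gt0.
  rewrite (_ : phi * alpha * (4 * C / alpha * Y / phi) = 4 * (C * Y)); last first.
    by field; rewrite !gt_eqF.
  have CY : 0 < C * Y by rewrite mulr_gt0.
  by clra.
rewrite -fsumrB//; apply: (le_trans (ler_norm_fsum _ fQ)).
set b := _ + ind R _.
have b0 : 0 <= b by rewrite addr_ge0// ind_ge0.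
apply: (@le_trans _ _ (\sum_(p \in fin P) (eps + B * b))); last first.
  rewrite /ncard mulr_fsuml le_eqVlt; apply/orP; left; apply/eqP.
  by apply: eq_fsbigr => p _; rewrite mul1r.
apply: (@le_trans _ _ (\sum_(p \in Q) (eps + B * b))); last first.
  apply: ler_fsum_subset => // p _; apply: addr_ge0; first exact: ltW.
  exact: mulr_ge0.
apply: ler_fsum => // p Qp; have [e1 e2 e3] := wP _ Qp.
have [Lp /andP[p0 pQ]] := Qp; have [_ /andP[_ pP]] := QP _ Qp.
have le1 : `|f (log_diff phi (r, r + w p)) - f (lin_diff phi p r)| <= eps.
  by apply/ltW/ud; clra.
case: ifPn => [_|nT].
  by apply: (le_trans le1); rewrite lerDl mulr_ge0.
rewrite sub0r normrN ger0_norm ?(test_ge0 tf)//.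
(* The pair built from [p] can fail to be admissible only if $m+p$ leaves the disc, which forces
   $|m|>N-P$, or if its logarithm leaves the window, which forces [r] near an end. *)
suff b1 : 1 <= b.
  have : B * 1 <= B * b by rewrite ler_wpM2l.
  by have := test_le tf (lin_diff phi p r); clra.
rewrite /b /near_edge; have i01 := @ind_ge0 R; rewrite leNgt; apply/negP => b1.
have [nb|nb] := ltP (N%:R - P) (normc (cexp r)).
  have h : ind R (N%:R - P < normc (cexp r)) = 1 by rewrite nb.
  by rewrite h in b1; have := i01 ((complex.Im r < - (2 * pi * N'%:R) + 1) ||
  (2 * pi * N''%:R - 1 <= complex.Im r)); clra.
have [ed|] := boolP ((complex.Im r < - (2 * pi * N'%:R) + 1) ||
  (2 * pi * N''%:R - 1 <= complex.Im r)).
  by rewrite ed in b1; have := i01 (N%:R - P < normc (cexp r)); rewrite /ind in b1 *; clra.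
rewrite negb_or -leNgt -ltNge => /andP[ed1 ed2].
have := Im_le_normc (w p) => /(le_lt_trans) /(_ e2); rewrite ltr_norml => /andP[i1 i2].
move/negP: nT; apply; apply/mem_set; split => //=; split => //=.
- split; last by rewrite ImD; apply/andP; split; clra.
  rewrite e1; split; first exact: (gridD L_lattice).
  apply/andP; split; first by rewrite -e1 normc_gt0 cexp_neq0.
  by apply: (le_trans (normcD _ _)); clra.
- rewrite e1 => e; move: p0; rewrite normc_gt0 => /eqP; apply.
  by apply: (addrI (cexp r)); rewrite e addr0.
- by rewrite ImD opprD addrA subrr sub0r normrN ltr_norml; apply/andP; split; clra.
Qed.

(** The argument lies in $[0,2\pi[$, so every branch other than the lowest and the highest keeps a
    distance of at least $2\pi>1$ from both ends. *)
Lemma near_edge_branch N' N'' m (j : 'I_(N' + N'')) : m != 0 ->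
  ind R (near_edge N' N'' (branch N' (m, nat_of_ord j))) <=
  ind R (nat_of_ord j == 0%N) + ind R (nat_of_ord j == (N' + N'').-1).
Proof.
move=> m0; have pi2 : (2 : R) <= pi by exact: pi_ge2.
have /andP[c0 c1] := carg_itv m0; have jK := ltn_ord j.
case: (ltnP 0 j) => [j0|]; last first.
  rewrite leqn0 => /eqP ->; rewrite eqxx.
  apply: (le_trans (ind_le1 R _)); rewrite {1}/ind lerDl; exact: ind_ge0.
have [e|ne] := eqVneq (nat_of_ord j) (N' + N'').-1.
  apply: (le_trans (ind_le1 R _)); rewrite [X in _ + X]/ind lerDr; exact: ind_ge0.
rewrite [X in ind R X <= _](_ : _ = false) ?addr_ge0 ?ind_ge0//.
apply/negbTE; rewrite /near_edge Im_branch negb_or -leNgt -ltNge.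
have j1 : (2 * pi : R) * 1%:R <= 2 * pi * j%:R by rewrite ler_pM2l ?ler_nat//; clra.
have j2 : (2 * pi : R) * j.+2%:R <= 2 * pi * (N' + N'')%:R.
  rewrite ler_pM2l; last by clra.
  by rewrite ler_nat; clia.
rewrite natrD -addn2 natrD in j2.
by apply/andP; split; clra.
Qed.

Lemma sum_ind_eq (K a : nat) : \sum_(j < K) ind R (nat_of_ord j == a) <= 1.
Proof.
elim: K => [|K IH]; first by rewrite big_ord0.
rewrite big_ord_recr /=; have [e|ne] := eqVneq K a; last by rewrite /ind addr0.
rewrite big1 ?add0r// => j _; rewrite /ind.
by have := ltn_ord j; rewrite -e; case: eqP => // ->; rewrite ltnn.
Qed.

Lemma sum_ind_fset (S X : set R[i]) (b : R[i] -> bool) : finite_set S -> finite_set X ->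
  (forall m, S m -> b m -> X m) -> \sum_(m \in S) ind R (b m) <= ncard X.
Proof.
move=> fS fX SX.
have -> : \sum_(m \in S) ind R (b m) = \sum_(m \in S `&` [set m | b m]) (1 : R).
  rewrite fsbig_mkcondr; apply: eq_fsbigr => m _; rewrite /ind.
  by case: ifP => bm; [rewrite mem_set|rewrite memNset//= bm].
by apply: ler_fsum_subset => // m [] /= /SX; apply.
Qed.

(** The budget is shared in thirds: the uniform continuity error over all $(j,m,p)$, the [m] within
    reach of the boundary circle for all branches, and the two end branches for all [m]. *)
Lemma pair_sum_linear (eps : R) : 0 < eps -> exists2 F : R, 1 <= F &
  forall phi N N' N'', F <= phi -> F <= N%:R -> F <= (N' + N'')%:R ->
  `|pair_sum phi N N' N'' - \sum_(j < N' + N'') \sum_(m \in Mset N)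
      \sum_(p \in fin (reach phi N)) f (lin_diff phi p (branch N' (m, nat_of_ord j)))|
  <= eps * (N' + N'')%:R * (reach phi N * N%:R) ^+ 2.
Proof.
move=> eps0; have pi0 := @pi_gt0 R; have cov0 := cov_gt0 z0 L_lattice.
have [cM cM0 hM] := card_gridannulus0_le L_lattice z0.
have [cL cL0 hL] := card_gridannulus0_le L_lattice 0.
have D0 := @diam_ge0 R w1 w2; set D := diam w1 w2 in D0.
pose a := 4 * pi / cov.
have a0 : 0 < a by rewrite divr_gt0// mulr_gt0.
have Ba : 0 < B * a + 1 by have := mulr_ge0 B0 (ltW a0); clra.
pose e1 := eps / (3 * cL * cM).
have e10 : 0 < e1 by rewrite divr_gt0// !mulr_gt0.
(* The relative width of the boundary annulus, which holds at most $a\,\eta N^2$ grid points; the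
   summand 1 guards against $B=0$. *)
pose eta := Num.min 2^-1 (eps / (3 * cL * (B * a + 1))).
have eta0 : 0 < eta by rewrite lt_min invr_gt0 ltr0n divr_gt0// !mulr_gt0.
have eta1 : eta <= 2^-1 by rewrite ge_min lexx.
have eta2 : eta * (B * a + 1) <= eps / (3 * cL).
  rewrite -ler_pdivlMr// ge_min; apply/orP; right.
  by rewrite invfM mulrA.
have [F F0 row] := row_linear e10.
have F1 : 0 <= C1 / eta by rewrite divr_ge0 ?ltW.
have F2 : 0 <= 2 * D / eta by rewrite divr_ge0 ?mulr_ge0// ltW.
have F3 : 0 <= 6 * B * cM * cL / eps by rewrite divr_ge0 ?mulr_ge0// ltW.
(* The term $C_1/\eta$ bounds $\varphi$ so that $P\le\eta N$, the terms with $D$ make the annulus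
   wide compared with a cell and keep its inner radius at least $D$, and $6Bc_Mc_L/\varepsilon$
   bounds $K$ so that two branches among $K$ are negligible. *)
exists (F + C1 / eta + 2 * D / eta + 6 * B * cM * cL / eps + 2 * D + 1); first by clra.
move=> phi N N' N'' Fphi FN FK; set K := (N' + N'')%N in FK *; set P := reach phi N.
have phi0 : 0 < phi by clra.
have N1 : (1 : R) <= N%:R by clra.
have N0 : (0 < N)%N by rewrite -(ltr_nat R); clra.
have K1 : (1 : R) <= K%:R by clra.
set n := ncard (fin P); set nM := ncard (Mset N).
have n0 : 0 <= n by exact: ncard_ge0.
have nM0 : 0 <= nM by exact: ncard_ge0.
have P0 : 0 <= P by rewrite /P /reach -/C1 !mulr_ge0 ?invr_ge0 ?powR_ge0// ltW.
have Peta : P <= eta * N%:R.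
  rewrite /P /reach -/C1 ler_pdivrMr//.
  have NN : N%:R `^ (1 - alpha) <= (N%:R : R).
    by rewrite -[leRHS]powRr1 ?ler0n//; apply: ler_powR => //; rewrite gerBl ltW.
  have h : C1 <= phi * eta by rewrite -ler_pdivrMr//; clra.
  apply: (le_trans (ler_wpM2l (ltW C10) NN)).
  by rewrite [leRHS]mulrAC (mulrC eta); apply: ler_wpM2r.
pose A := gridannulus z0 L ((1 - eta) * N%:R) N%:R.
have hA : ncard A <= a * eta * N%:R ^+ 2.
  have D1 : 2 * D <= eta * N%:R by rewrite [leRHS]mulrC -ler_pdivrMr//; clra.
  have D2 : D <= (1 - eta) * N%:R <= N%:R.
    have : 2^-1 * N%:R <= (1 - eta) * N%:R by rewrite ler_pM2r ?ltr0n//; clra.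
    have : 0 <= eta * N%:R by rewrite mulr_ge0 ?ler0n// ltW.
    by move=> ? ?; apply/andP; split; clra.
  apply: (le_trans (card_gridannulus_le z0 L_lattice D2)).
  rewrite ler_pdivrMr// /a -/D.
  have -> : 4 * pi / cov * eta * N%:R ^+ 2 * cov = pi * (4 * eta * N%:R ^+ 2).
    by move: (pi : R) => q; field; rewrite gt_eqF.
  rewrite ler_pM2l//; set x := N%:R in N1 D1 *.
  have -> : (x + D) ^+ 2 - ((1 - eta) * x - D) ^+ 2 = (eta * x + 2 * D) * ((2 - eta) * x).
    by ring.
  have -> : 4 * eta * x ^+ 2 = (2 * (eta * x)) * (2 * x) by ring.
  apply: ler_pM; last 2 first.
  - by clra.
  - by rewrite ler_pM2r; clra.
  - by rewrite addr_ge0 ?mulr_ge0//; clra.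
  - by rewrite mulr_ge0//; clra.
have Mz m : Mset N m -> m != 0 by move=> [_ /andP[+ _]]; rewrite normc_gt0.
rewrite pair_sum_rows.
rewrite -(@fsum_strip_logs _ (Mset N) N' N''
  (fun r => \sum_(p \in fin P) f (lin_diff phi p r)))//.
have fW : finite_set (strip_logs (Mset N) N' N'') by apply: strip_logs_finite.
rewrite -fsumrB//; apply: (le_trans (ler_norm_fsum _ fW)).
have Fp : F <= phi by clra.
apply: (le_trans (ler_fsum fW (fun r Wr => row phi N N' N'' r Fp N0 Wr))).
rewrite fsum_strip_logs// -/K -/P -/n.
apply: (@le_trans _ _ (\sum_(j < K) (n * ((e1 * nM + B * ncard A)
   + B * nM * (ind R (nat_of_ord j == 0%N) + ind R (nat_of_ord j == K.-1)))))).
  apply: ler_sum => j _; set ij := ind R _ + ind R _.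
  apply: (@le_trans _ _ (\sum_(m \in Mset N)
      (n * ((e1 + B * ij) + B * ind R (N%:R - P < normc m))))).
    apply: ler_fsum => // m Mm; rewrite cexp_branch ?Mz//.
    apply: ler_wpM2l => //.
    have := near_edge_branch j (Mz _ Mm); rewrite -/K -/ij => h.
    by have := ler_wpM2l B0 h; clra.
  rewrite -mulr_fsumr; apply: ler_wpM2l => //.
  have -> : \sum_(m \in Mset N) (e1 + B * ij + B * ind R (N%:R - P < normc m)) =
     (e1 + B * ij) * nM + B * \sum_(m \in Mset N) ind R (N%:R - P < normc m).
    rewrite /nM /ncard !mulr_fsumr -fsbig_split//; apply: eq_fsbigr => m _.
    by rewrite /= mulr1.
  have : \sum_(m \in Mset N) ind R (N%:R - P < normc m) <= ncard A.
    apply: sum_ind_fset => //; first exact: (gridannulus_finite L_lattice).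
    move=> m [Lm /andP[_ mN]] h; split => //; rewrite mN andbT.
    by apply: le_lt_trans h; clra.
  by move=> /(ler_wpM2l B0); clra.
rewrite -mulr_sumr big_split /= sumr_const card_ord -mulr_sumr big_split /=.
have := sum_ind_eq K 0; have := sum_ind_eq K K.-1.
set S0 := \sum_(j < K) _; set S1 := \sum_(j < K) _ => h1 h0.
have -> : eps * K%:R * (P * N%:R) ^+ 2 = (cL * P ^+ 2) * (K%:R * N%:R ^+ 2 * (eps / cL)).
  by field; rewrite gt_eqF.
apply: (@le_trans _ _ (n * (K%:R * N%:R ^+ 2 * (eps / cL)))); last first.
  apply: ler_wpM2r; first by rewrite !mulr_ge0 ?invr_ge0 ?sqr_ge0 ?ler0n// ltW.
  exact: hL.
apply: ler_wpM2l => //.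
have h2 : B * nM * (S1 + S0) <= B * nM * 2.
  by apply: ler_wpM2l; [rewrite mulr_ge0|clra].
apply: (le_trans (lerD (lexx _) h2)).
rewrite -mulr_natl.
have q1 : e1 * nM <= N%:R ^+ 2 * (eps / cL) / 3.
  apply: (le_trans (ler_wpM2l (ltW e10) (hM _))).
  rewrite le_eqVlt; apply/orP; left; apply/eqP; rewrite /e1; field.
  by rewrite !gt_eqF.
have q2 : B * ncard A <= N%:R ^+ 2 * (eps / cL) / 3.
  apply: (le_trans (ler_wpM2l B0 hA)).
  have : eta * (B * a) <= eps / (3 * cL) by clra.
  move=> /(ler_wpM2l (sqr_ge0 (N%:R : R))) h.
  rewrite (_ : B * (a * eta * N%:R ^+ 2) = N%:R ^+ 2 * (eta * (B * a))); last by ring.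
  apply: (le_trans h); rewrite le_eqVlt; apply/orP; left; apply/eqP; field.
  by rewrite !gt_eqF.
have q3 : B * nM * 2 <= K%:R * (N%:R ^+ 2 * (eps / cL) / 3).
  have h : 6 * B * cM * cL <= K%:R * eps by rewrite -ler_pdivrMr//; clra.
  apply: (@le_trans _ _ (B * (cM * N%:R ^+ 2) * 2)).
    by rewrite ler_pM2r//; apply: ler_wpM2l => //; exact: hM.
  rewrite (_ : K%:R * (N%:R ^+ 2 * (eps / cL) / 3) = N%:R ^+ 2 * (K%:R * eps) / (3 * cL)); last first.
    by field; rewrite gt_eqF.
  rewrite ler_pdivlMr; last by rewrite mulr_gt0.
  have := ler_wpM2l (sqr_ge0 (N%:R : R)) h; clra.
have q4 : K%:R * (e1 * nM + B * ncard A) <= K%:R * (N%:R ^+ 2 * (eps / cL) / 3 + N%:R ^+ 2 * (eps / cL) / 3).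
  by apply: ler_wpM2l; [exact: ler0n|clra].
clra.
Qed.

End PairSums.

(** * The density for finite $N$ *)

Section Density.
Variables (R : realType) (alpha : R).
Hypotheses (alpha_gt0 : 0 < alpha) (alpha_lt1 : alpha < 1).
Variables (f : R[i] -> R) (B C : R).
Hypothesis tf : test_function f B C.
Variables (w1 w2 z0 : R[i]) (L : set R[i]).
Hypothesis L_lattice : lattice_basis L w1 w2.
Notation cov := (covol w1 w2).
Notation Mset N := (gridannulus z0 L 0 N%:R).
Notation fin P := (gridannulus 0 L 0 P).
Let beta : R := 1 - alpha.
Let s : R := 2 / beta.
Implicit Types (phi : R) (p m w : R[i]) (N : nat).

Let beta_gt0 : 0 < beta. Proof. by rewrite subr_gt0. Qed.
Let beta_le1 : beta <= 1. Proof. by rewrite gerBl ltW. Qed.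
Let s_gt0 : 0 < s. Proof. by rewrite divr_gt0. Qed.
Let C0 : 0 < C := test_pos tf.

(** A logarithm of $\varphi\alpha p$; through it each [p] becomes a mere value of the constant [c]
    in [pt]. *)
Definition log_slope phi p : R[i] := clog p + (ln (phi * alpha))%:C.

Lemma lin_diff_pt phi p m N' j : 0 < phi -> p != 0 ->
  lin_diff alpha phi p (branch N' (m, j)) =
  pt beta (log_slope phi p
    - (0 +i* (beta * (- (2 * pi * N'%:R) + 2 * pi * j%:R)))) m.
Proof.
move=> phi0 p0; rewrite /lin_diff /pt -{1}(clogK p0).
have -> : (phi * alpha)%:C = cexp (ln (phi * alpha))%:C :> R[i].
  apply: eqC; rewrite /= ?cos0 ?sin0 ?mulr0// mulr1 lnK// posrE mulr_gt0//.
rewrite -!cexpD; congr cexp; rewrite /log_slope /branch /beta.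
by apply: eqC; rewrite ?(ReD, ImD, ReN, ImN, ReZ, ImZ) /=; ring.
Qed.

Lemma expR_log_slope phi p : 0 < phi -> 0 < normc p ->
  expR (s * complex.Re (log_slope phi p)) = (phi * alpha) `^ s * normc p `^ s.
Proof.
move=> phi0 p0; rewrite /log_slope ReD /= mulrDr addrC expRD.
by rewrite /powR !gt_eqF// mulr_gt0.
Qed.

Lemma rad_log_slope phi p N : 0 < phi -> 0 < normc p -> (0 < N)%N ->
  rad beta (log_slope phi p) N%:R = alpha * (phi / N%:R `^ beta) * normc p.
Proof.
move=> phi0 p0 N0; have N0' : (0 : R) < N%:R by rewrite ltr0n.
rewrite /rad /log_slope ReD expRD expRN expRD.
rewrite (_ : complex.Re (clog p) = ln (normc p))// (_ : complex.Re (_)%:C = ln (phi * alpha))//.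
rewrite lnK ?posrE// lnK ?posrE ?mulr_gt0// /powR gt_eqF//.
by rewrite [LHS]mulrAC; ring.
Qed.

(** The threshold of [branch_average] does not depend on [c], hence serves all [p] at once. There
    are at most $c_LP^2$ of them, which produces the factor $(PN)^2$. *)
Lemma branch_sum_average (eps : R) : 0 < eps -> exists2 F : R, 1 <= F &
  forall phi N N' N'', 0 < phi -> F <= N%:R -> F <= (N' + N'')%:R ->
  exists2 J : R[i] -> R,
  forall p, Jint f beta (log_slope phi p) N%:R = (J p)%:E &
  `|\sum_(j < N' + N'') \sum_(m \in Mset N)
      \sum_(p \in fin (reach alpha C phi N))
        f (lin_diff alpha phi p (branch N' (m, nat_of_ord j)))
    - (N' + N'')%:R / cov * \sum_(p \in fin (reach alpha C phi N)) J p|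
  <= eps * (N' + N'')%:R * (reach alpha C phi N * N%:R) ^+ 2.
Proof.
move=> eps0; have [cL cL0 hL] := card_gridannulus0_le L_lattice 0.
have e0 : 0 < eps / cL by rewrite divr_gt0.
have [F F1 H] := branch_average tf beta_gt0 beta_le1 z0 L_lattice e0.
exists F => // phi N N' N'' phi0 FN FK.
set P := reach _ _ _ _; set K := (N' + N'')%N in FK *.
pose A : R := - (2 * pi * N'%:R).
have Jex p : exists J : R, Jint f beta (log_slope phi p) N%:R = J%:E /\
  `|\sum_(j < K) \sum_(m \in Mset N)
      f (pt beta (log_slope phi p - (0 +i* (beta * (A + 2 * pi * j%:R)))) m) - K%:R / cov * J|
  <= eps / cL * N%:R ^+ 2 * K%:R.
  by have [J J1 J2] := H N%:R K A (log_slope phi p) FN FK; exists J.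
have [J JP] := choice Jex; exists J; first by move=> p; case: (JP p).
have fP : finite_set (fin P) by exact: (gridannulus_finite L_lattice).
have fM : finite_set (Mset N) by exact: (gridannulus_finite L_lattice).
have -> : \sum_(j < K) \sum_(m \in Mset N) \sum_(p \in fin P)
      f (lin_diff alpha phi p (branch N' (m, nat_of_ord j))) =
  \sum_(p \in fin P) \sum_(j < K) \sum_(m \in Mset N)
      f (pt beta (log_slope phi p - (0 +i* (beta * (A + 2 * pi * j%:R)))) m).
  transitivity (\sum_(j < K) \sum_(p \in fin P) \sum_(m \in Mset N)
      f (pt beta (log_slope phi p - (0 +i* (beta * (A + 2 * pi * j%:R)))) m)).
    apply: eq_bigr => j _; rewrite exchange_fsbig//.
    apply: eq_fsbigr => p /set_mem[_ /andP[p0 _]]; apply: eq_fsbigr => m _.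
    by rewrite lin_diff_pt// -normc_gt0.
  rewrite [RHS]fsbig_finite//= exchange_big /=; apply: eq_bigr => j _.
  by rewrite fsbig_finite.
rewrite mulr_fsumr -fsumrB//; apply: (le_trans (ler_norm_fsum _ fP)).
apply: (le_trans (ler_fsum fP (fun p _ => proj2 (JP p)))).
apply: (@le_trans _ _ (ncard (fin P) * (eps / cL * N%:R ^+ 2 * K%:R))).
  rewrite /ncard mulr_fsuml le_eqVlt; apply/orP; left; apply/eqP.
  by apply: eq_fsbigr => p _; rewrite mul1r.
apply: (@le_trans _ _ (cL * P ^+ 2 * (eps / cL * N%:R ^+ 2 * K%:R))).
  apply: ler_wpM2r; last exact: hL.
  by rewrite !mulr_ge0 ?invr_ge0 ?sqr_ge0 ?ler0n// ltW.
rewrite le_eqVlt; apply/orP; left; apply/eqP; field; rewrite gt_eqF//.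
Qed.

(** In terms of $s=2/(1-\alpha)$ the exponent $(4-2\alpha)/(1-\alpha)$ is $s+2$. *)
Lemma rhoE (lam : R) w : 0 < lam -> w != 0 -> rho alpha L cov lam%:E w =
  alpha `^ s / (beta * cov) * (normc w / lam) `^ (- (s + 2))
   * \sum_(p \in [set p | L p /\ normc p <= normc w / (alpha * lam)]) normc p `^ s.
Proof.
move=> l0 wn0; rewrite /rho (gt_eqF l0) (negbTE wn0); congr (_ * _ `^ _ * _).
have b0 := beta_gt0; rewrite /s /beta in b0 *; field; rewrite gt_eqF//.
Qed.

Lemma lattice_ball_finite (X : R) : finite_set [set p | L p /\ normc p <= X].
Proof.
have := grid_finite 0 L_lattice X; congr finite_set.
by apply/seteqP; split => p /=; rewrite grid0E.
Qed.

Lemma lattice_sum_annulus (P X : R) : X <= P ->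
  \sum_(p \in [set p | L p /\ normc p <= X]) normc p `^ s =
  \sum_(p \in fin P) normc p `^ s * ind R (normc p <= X).
Proof.
move=> XP; transitivity (\sum_(p \in fin P `&` [set p | normc p <= X]) normc p `^ s).
  apply/esym; apply: fsbig_widen.
    by move=> p [[Lp _] pX]; split => //; rewrite -[L]grid0E.
  move=> p [[Lp pX] h] /=.
  have [p0|] := boolP (0 < normc p).
    by exfalso; apply: h; split => //; split; [rewrite grid0E|rewrite p0 (le_trans pX)].
  (* The origin belongs to the lattice disc but contributes $0^s=0$. *)
  rewrite normc_gt0 negbK => /eqP ->; by rewrite normc0 powR0// gt_eqF.
rewrite fsbig_mkcondr; apply: eq_fsbigr => p _; rewrite /ind.
case: ifPn => [/set_mem /= ->|/negP h]; first by rewrite mulr1.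
rewrite (_ : normc p <= X = false) ?mulr0//.
by apply/negbTE/negP => pX; apply: h; exact: mem_set.
Qed.

(** The condition on the radius reads $|p|\le|w|/(\alpha\lambda)$, which is the range of summation
    of [rho]. Since $\beta s=2$, one has $\varphi^s=\lambda^sN^2$, and the powers combine to
    $(N/\lambda)^2$. *)
Lemma sum_slope_density phi N w : 0 < phi -> (0 < N)%N ->
  let lam := phi / N%:R `^ beta in
  \sum_(p \in fin (reach alpha C phi N))
    beta^-1 * expR (s * complex.Re (log_slope phi p)) *
    (f w * normc w `^ (- (s + 2)) * ind R (rad beta (log_slope phi p) N%:R <= normc w))
  = cov * (N%:R / lam) ^+ 2 * (f w * rho alpha L cov lam%:E w).
Proof.
move=> phi0 N0 lam; have N0' : (0 : R) < N%:R by rewrite ltr0n.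
have cov0 := cov_gt0 z0 L_lattice.
have Nb0 : 0 < (N%:R : R) `^ beta by exact: powR_gt0.
have lam0 : 0 < lam by rewrite divr_gt0.
have [fw0|/eqP fw0] := eqVneq (f w) 0.
  by rewrite fsbig1 => [|p _]; rewrite fw0 !mul0r mulr0.
have wC : normc w <= C by rewrite leNgt; apply/negP => /(test_supp tf).
have [->|wn0] := eqVneq w 0.
  rewrite /rho (gt_eqF lam0) eqxx !mulr0 fsbig1// => p _.
  rewrite [X in ind R X](_ : _ = false) ?mulr0//.
  by apply/negbTE; rewrite -ltNge normc0 expR_gt0.
have w0 : 0 < normc w by rewrite normc_gt0.
(* On the support $|w|\le C$, so the radius $|w|/(\alpha\lambda)$ stays below the reach
   $4C/(\alpha\lambda)$ and no term of [rho] is lost. *)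
rewrite rhoE// (@lattice_sum_annulus (reach alpha C phi N)); last first.
  rewrite /reach -/beta.
  rewrite (_ : 4 * C / alpha * N%:R `^ beta / phi = 4 * C / (alpha * lam)); last first.
    by rewrite /lam; field; rewrite !gt_eqF.
  have al : 0 < (alpha * lam)^-1 by rewrite invr_gt0 mulr_gt0.
  rewrite (ler_pM2r al) (le_trans wC)// ler_peMl ?(ltW C0)//.
  by rewrite (ler_nat R 1 4).
rewrite !mulr_fsumr; apply: eq_fsbigr => p /set_mem[_ /andP[p0 _]].
rewrite expR_log_slope// rad_log_slope//.
have -> : (alpha * (phi / N%:R `^ beta) * normc p <= normc w) =
   (normc p <= normc w / (alpha * lam)).
  rewrite ler_pdivlMr; last by rewrite mulr_gt0.
  by rewrite [X in _ = (X <= _)]mulrC.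
have [phi1 alpha1 w0' lam1] : [/\ 0 <= phi, 0 <= alpha, 0 <= normc w & 0 <= lam].
  by split; exact: ltW.
have Nb1 : 0 <= (N%:R : R) `^ beta by exact: ltW.
have lam1' : 0 <= lam^-1 by rewrite invr_ge0.
rewrite (powRM _ phi1 alpha1) (powRM _ w0' lam1').
have -> : lam^-1 `^ (- (s + 2)) = phi `^ s / N%:R ^+ 2 * lam ^+ 2.
  rewrite -(powR_inv1 lam1) -powRrM mulN1r opprK powRD; last by rewrite (gt_eqF lam0) implybT.
  rewrite (_ : lam `^ 2 = lam ^+ 2) ?powR_mulrn//; congr (_ * _).
  rewrite /lam powRM ?invr_ge0//; congr (_ * _).
  rewrite -(powR_inv1 Nb1) -!powRrM (_ : beta * (-1 * s) = -2); last first.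
    by rewrite /s; field; rewrite gt_eqF.
  by rewrite powRN powR_mulrn ?ler0n.
field.
by rewrite !gt_eqF.
Qed.

Lemma pair_sum_density (eps : R) : 0 < eps -> exists2 F : R, 1 <= F &
  forall phi N N' N'', F <= phi -> F <= N%:R -> F <= (N' + N'')%:R ->
  let lam := phi / N%:R `^ beta in
  exists2 I : R, cint (fun w => f w * rho alpha L cov lam%:E w) = I%:E &
  `|pair_sum alpha f z0 L phi N N' N'' - (N' + N'')%:R * (N%:R / lam) ^+ 2 * I|
  <= eps * ((N' + N'')%:R * (N%:R / lam) ^+ 2).
Proof.
move=> eps0; have cov0 := cov_gt0 z0 L_lattice.
pose C1 := 4 * C / alpha.
have C10 : 0 < C1 by rewrite divr_gt0// mulr_gt0.
have e0 : 0 < eps / (2 * C1 ^+ 2) by rewrite divr_gt0// mulr_gt0// exprn_gt0.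
have [F1 F11 H1] := pair_sum_linear alpha_gt0 alpha_lt1 tf z0 L_lattice e0.
have [F2 F21 H2] := branch_sum_average e0.
exists (F1 + F2); first by clra.
move=> phi N N' N'' Fphi FN FK lam.
have phi0 : 0 < phi by clra.
have N0 : (0 < N)%N by rewrite -(ltr_nat R); clra.
have N0' : (0 : R) < N%:R by rewrite ltr0n.
have Nb0 : 0 < (N%:R : R) `^ beta by exact: powR_gt0.
have lam0 : 0 < lam by rewrite divr_gt0.
have [||J JE HJ] := H2 phi N N' N'' phi0; [by clra|by clra|].
have HP := H1 phi N N' N'' ltac:(clra) ltac:(clra) ltac:(clra).
set K := (N' + N'')%N in HJ HP *; set P := reach alpha C phi N in HJ HP.
(* This converts the errors in $(PN)^2$ into the normalization $(N/\lambda)^2$, at the price of the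
   constant $C_1^2$ already divided out. *)
have PE : P = C1 / lam by rewrite /P /reach /C1 /lam -/beta; field; rewrite !gt_eqF.
have Nl : 0 < (N%:R / lam) ^+ 2 by rewrite exprn_gt0// divr_gt0.
have fP : finite_set (fin P) by exact: (gridannulus_finite L_lattice).
have mf : cmeas f := cmeas_unif (test_unif tf).
have f0 := test_ge0 tf.
have IE : cint (fun w => f w * rho alpha L cov lam%:E w) =
   ((\sum_(p \in fin P) J p) / (cov * (N%:R / lam) ^+ 2))%:E.
  transitivity (cint (fun w => \sum_(p <- finmap.enum_fset (fset_set (fin P)))
      (cov * (N%:R / lam) ^+ 2)^-1 * (beta^-1 * expR (s * complex.Re (log_slope phi p)) *
    (f w * normc w `^ (- (s + 2)) * ind R (rad beta (log_slope phi p) N%:R <= normc w))))).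
    apply: eq_cint => w; rewrite -mulr_sumr -fsbig_finite//.
    rewrite sum_slope_density// mulKf// gt_eqF// mulr_gt0//.
  have c1 : 0 <= (cov * (N%:R / lam) ^+ 2)^-1 by rewrite invr_ge0 mulr_ge0 ?ltW.
  have c2 p : 0 <= beta^-1 * expR (s * complex.Re (log_slope phi p)).
    by rewrite mulr_ge0 ?invr_ge0 ?expR_ge0// ltW.
  have h0 p w : 0 <= f w * normc w `^ (- (s + 2)) *
      ind R (rad beta (log_slope phi p) N%:R <= normc w).
    by rewrite !mulr_ge0 ?powR_ge0 ?ind_ge0.
  have hm p : cmeas (fun w => f w * normc w `^ (- (s + 2)) *
      ind R (rad beta (log_slope phi p) N%:R <= normc w)).
    apply: cmeasM; first apply: cmeasM => //.
      apply: (@cmeas_comp R (fun x => x `^ (- (s + 2)))); last exact: cmeas_normc.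
      exact: measurable_powR.
    by apply: cmeas_bool; apply: (@cmeas_le R (fun=> _) (@normc R)); [exact: cmeas_cst|exact: cmeas_normc].
  rewrite cint_sum; last 2 first.
  - by move=> p w; rewrite mulr_ge0// mulr_ge0.
  - by move=> p; do 2 (apply: cmeasM; first exact: cmeas_cst).
  rewrite (eq_bigr (fun p => ((cov * (N%:R / lam) ^+ 2)^-1 * J p)%:E)); last first.
    move=> p _; rewrite cintZ//; last 2 first.
    - by move=> w; rewrite mulr_ge0.
    - by apply: cmeasM => //; exact: cmeas_cst.
    rewrite EFinM; congr (_ * _)%E; rewrite -JE (Jint_subst tf beta_gt0)//.
    by rewrite cintZ.
  rewrite sumEFin -mulr_sumr [X in _ = (X / _)%:E]fsbig_finite//; congr _%:E.
  by rewrite mulrC.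
exists ((\sum_(p \in fin P) J p) / (cov * (N%:R / lam) ^+ 2)); first exact: IE.
rewrite (_ : K%:R * (N%:R / lam) ^+ 2 * _ = K%:R / cov * \sum_(p \in fin P) J p); last first.
  by field; rewrite !gt_eqF.
have -> : eps * (K%:R * (N%:R / lam) ^+ 2) =
   eps / (2 * C1 ^+ 2) * K%:R * (P * N%:R) ^+ 2 + eps / (2 * C1 ^+ 2) * K%:R * (P * N%:R) ^+ 2.
  by rewrite PE; field; rewrite !gt_eqF.
apply: le_trans (lerD HP HJ).
by rewrite (le_trans _ (ler_normD _ _))// addrA subrK.
Qed.

End Density.

(** * Convergence of the densities *)

Section PowerDifference.
Variable R : realType.
Implicit Types (a b x s X D : R).

Lemma bernoulli_le1 x (k : nat) : 0 <= x <= 1 -> 1 - k%:R * (1 - x) <= x ^+ k.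
Proof.
move=> /andP[x0 x1]; elim: k => [|k IH]; first by rewrite mul0r subr0 expr0.
rewrite exprS -natr1; have h1 : x ^+ k <= 1 by apply: exprn_ile1.
have h2 : (1 - x) * x ^+ k <= (1 - x) * 1 by apply: ler_wpM2l; clra.
clra.
Qed.

(** For $x=a/b$ in $[0,1]$ and an integer $k\ge s$, Bernoulli gives $1-x^s\le1-x^k\le k(1-x)$; this
    stands in for the mean value theorem and allows $a=0$. *)
Lemma powR_diff_le s a b X D (k : nat) : 1 <= s <= k%:R -> 0 <= a -> a <= b -> b <= X ->
  b - a <= D -> b `^ s - a `^ s <= k%:R * D * X `^ (s - 1).
Proof.
move=> /andP[s1 sk] a0 ab bX abD.
have k1 : 1 <= k%:R :> R by clra.
have D0 : 0 <= D by clra.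
have s0 : 0 < s by clra.
have [b0|b0] := leP b 0.
  have -> : b = 0 by clra.
  have -> : a = 0 by clra.
  by rewrite subrr !mulr_ge0 ?powR_ge0.
pose x := a / b.
have aE : a = b * x by rewrite /x mulrC divfK// gt_eqF.
have x01 : 0 <= x <= 1 by rewrite /x divr_ge0 ?(ltW b0)//= ler_pdivrMr// mul1r.
have /andP[x0 x1] := x01.
have bx : 1 - k%:R * (1 - x) <= x `^ s.
  have [xe|xn] := eqVneq x 0.
    by rewrite xe powR0 ?gt_eqF// subr0 mulr1; clra.
  have xp : 0 < x by rewrite lt0r xn.
  apply: (le_trans (bernoulli_le1 k x01)); rewrite -powR_mulrn//.
  by apply: ger_powR; rewrite ?xp.
rewrite {1}aE powRM ?(ltW b0)// -{1}[b `^ s]mulr1 -mulrBr.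
apply: (@le_trans _ _ (b `^ s * (k%:R * (1 - x)))).
  by apply: ler_wpM2l; [exact: powR_ge0|clra].
rewrite -(mulr_powRB1 (ltW b0) s0).
have -> : b * b `^ (s - 1) * (k%:R * (1 - x)) = k%:R * (b - a) * b `^ (s - 1).
  by rewrite aE; ring.
apply: ler_pM; rewrite ?powR_ge0//.
- by rewrite mulr_ge0//; clra.
- by rewrite ler_wpM2l//; clra.
apply: ge0_ler_powR; rewrite ?nnegrE; clra.
Qed.

Lemma powRD_gt0 x a b : 0 < x -> x `^ (a + b) = x `^ a * x `^ b.
Proof. by move=> x0; rewrite powRD// (gt_eqF x0) implybT. Qed.

End PowerDifference.

(** * Power sums over lattice discs *)

Section LatticeSum.
Variables (R : realType) (s : R).
Hypothesis s_ge1 : 1 <= s.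
Variables (w1 w2 : R[i]) (L : set R[i]).
Hypothesis L_lattice : lattice_basis L w1 w2.
Notation cov := (covol w1 w2).
Notation mu := (@lebesgue_measure R).
Notation D := (diam w1 w2).
Let s0 : 0 < s. Proof. exact: lt_le_trans s_ge1. Qed.

Definition lattice_sum (X : R) : R :=
  \sum_(p \in [set p | L p /\ normc p <= X]) normc p `^ s.

Lemma lattice_sum_ge0 X : 0 <= lattice_sum X.
Proof. by apply: fsumr_ge0 => p _; exact: powR_ge0. Qed.

Lemma lattice_sum_bound : exists2 c : R, 0 < c &
  forall X : R, 0 < X -> lattice_sum X <= c * X `^ (s + 2).
Proof.
have [c c0 H] := card_gridannulus0_le L_lattice 0.
exists c => // X X0; rewrite /lattice_sum; have s0' := s0.
apply: (@le_trans _ _ (\sum_(p \in gridannulus 0 L 0 X) X `^ s)); last first.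
  have -> : \sum_(p \in gridannulus 0 L 0 X) X `^ s = X `^ s * ncard (gridannulus 0 L 0 X).
    by rewrite /ncard mulr_fsumr; apply: eq_fsbigr => p _; rewrite mulr1.
  rewrite powRD_gt0// (_ : X `^ 2 = X ^+ 2) ?(powR_mulrn 2 (ltW X0))//.
  by rewrite [leRHS]mulrCA; apply: ler_wpM2l; [exact: powR_ge0|exact: H].
have -> : \sum_(p \in [set p | L p /\ normc p <= X]) normc p `^ s =
    \sum_(p \in gridannulus 0 L 0 X) normc p `^ s.
  apply/esym; apply: fsbig_widen.
    by move=> p [Lp /andP[_ pX]]; split => //; rewrite -[L]grid0E.
  move=> p [[Lp pX] h] /=.
  have [p0|] := boolP (0 < normc p).
    by exfalso; apply: h; split; [rewrite grid0E|rewrite p0].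
  by rewrite normc_gt0 negbK => /eqP ->; rewrite normc0 powR0// gt_eqF.
apply: ler_fsum; first exact: (gridannulus_finite L_lattice).
move=> p [_ /andP[p0 pX]]; apply: ge0_ler_powR; rewrite ?nnegrE; clra.
Qed.

Lemma lattice_sum_small : exists2 x : R, 0 < x & forall X, X < x -> lattice_sum X = 0.
Proof.
have [c c0 H] := grid_min_norm L_lattice 0; exists c => // X Xc.
rewrite /lattice_sum fsbig1// => p [Lp pX]; have [->|p0] := eqVneq p 0.
  by rewrite normc0 powR0// gt_eqF.
have : c <= normc p by apply: H => //; rewrite grid0E.
by clra.
Qed.

(** The sum is compared cell by cell with the integral of $|z|^s$ over the disc. Inside, the defect
    is the variation of the power across a cell; in the annulus of width $2D$ around $|z|=X$ it is
    at most $X^s$. *)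
Lemma lattice_sum_asymp : exists2 c : R, 0 <= c & forall X : R, 0 < X -> D <= X ->
  `|cov * lattice_sum X - 2 * pi / (s + 2) * X `^ (s + 2)| <= c * X `^ (s + 1).
Proof.
have pi0 := @pi_gt0 R; have D0 := @diam_ge0 R w1 w2.
have s0' := s0; have s1 := s_ge1.
pose k := (Num.truncn s).+1.
have sk : 1 <= s <= k%:R.
  by rewrite s_ge1 /=; have /andP[_ /ltW] := truncn_itv (ltW s0).
(* For $X\ge D$, $(X+D)^2\le4X^2$ yields the part with $k$ and $(X+D)^2-(X-D)^2=4XD$ the part with
   1. *)
exists (4 * pi * D * (k%:R + 1)).
  by have pi1 := ltW pi0; rewrite !mulr_ge0// addr_ge0.
move=> X X0 DX.
pose S : set R[i] := gridball 0 L X.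
have SE : lattice_sum X = \sum_(p \in S) normc p `^ s.
  by rewrite /lattice_sum; congr (\big[_/_]_(_ \in _) _);
     apply/seteqP; split => p /=; rewrite /S /gridball /= grid0E.
pose F (z : R[i]) : R := normc z `^ s * ind R (normc z <= X).
pose E (z : R[i]) : R := k%:R * D * X `^ (s - 1) * ind R (normc z <= X + D)
   + X `^ s * ind R (X - D < normc z <= X + D).
have mpow : cmeas (fun z : R[i] => normc z `^ s).
  by apply: (@cmeas_comp R (fun x => x `^ s)); [exact: measurable_powR|exact: cmeas_normc].
have mF : cmeas F by apply: cmeasM => //; exact: cmeas_ind_le.
have mE1 : cmeas (fun z : R[i] => k%:R * D * X `^ (s - 1) * ind R (normc z <= X + D)).
  by apply: cmeasM; [exact: cmeas_cst|exact: cmeas_ind_le].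
have mE2 : cmeas (fun z : R[i] => X `^ s * ind R (X - D < normc z <= X + D)).
  by apply: cmeasM; [exact: cmeas_cst|exact: cmeas_ind_annulus].
have a0 : 0 <= k%:R * D * X `^ (s - 1) by rewrite !mulr_ge0 ?powR_ge0.
have F0 z : 0 <= F z by rewrite mulr_ge0 ?powR_ge0 ?ind_ge0.
have FE : cint F = (2 * pi / (s + 2) * X `^ (s + 2))%:E.
  rewrite (@cint_radial R (fun t => t `^ s * ind R (t <= X))); last 2 first.
  - apply: measurable_funM; first exact: measurable_powR.
    by apply: measurable_fun_ifT => //; exact: measurable_fun_ler.
  - by move=> t; rewrite mulr_ge0 ?powR_ge0 ?ind_ge0.
  have -> : (\int[mu]_(t in `]0%R, +oo[) (t `^ s * ind R (t <= X)%R * t)%:E =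
      \int[mu]_(t in `]0%R, +oo[) (ind R (t <= X)%R * t `^ (s + 1))%:E)%E.
    apply: eq_integral => t; rewrite inE /= in_itv /= andbT => t0; congr _%:E.
    by rewrite powRD_gt0// powRr1 ?(ltW t0)//; ring.
  rewrite integral_powR ?(ltW X0)//; last by clra.
  rewrite -EFinM; congr _%:E; rewrite (_ : s + 1 + 1 = s + 2); last by ring.
  by ring.
have EE : cint E = (k%:R * D * X `^ (s - 1) * (pi * (X + D) ^+ 2)
    + X `^ s * (pi * ((X + D) ^+ 2 - (X - D) ^+ 2)))%:E.
  rewrite cintD//; last 2 first.
  - by move=> z; rewrite mulr_ge0 ?ind_ge0.
  - by move=> z; rewrite mulr_ge0 ?powR_ge0 ?ind_ge0.
  rewrite !cintZ ?powR_ge0//; try (by move=> z; exact: ind_ge0);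
    try exact: cmeas_ind_le; try exact: cmeas_ind_annulus.
  rewrite cint_disc ?cint_annulus//; last by clra.
  by apply/andP; split; clra.
have := @grid_compare R w1 w2 0 L L_lattice S (fun p => normc p `^ s)
  (grid_finite 0 L_lattice X) _ (fun p => powR_ge0 _ _) F E mF (cmeasD mE1 mE2) F0.
rewrite FE EE /= !ltry -SE => H.
apply: (le_trans (H _ isT isT _)) => //.
- by move=> m [].
- move=> m z Lm pm; have := par_diam L_lattice pm => zm.
  have h1 : normc z <= normc m + D.
    have := normcD m (z - m); rewrite addrC subrK; clra.
  have h2 : normc m <= normc z + D.
    have := normcD z (m - z); rewrite addrC subrK normcBC; clra.
  have Xs0 := powR_ge0 X s.
  have mono (t : R) : 0 <= t -> t <= X -> t `^ s <= X `^ s.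
    by move=> t0 tX; apply: ge0_ler_powR; rewrite ?nnegrE; clra.
  have m0 := normc_ge0 m; have z0 := normc_ge0 z.
  have pm0 := powR_ge0 (normc m) s; have pz0 := powR_ge0 (normc z) s.
  rewrite /F /E; have [mX|mX] := leP (normc m) X.
    rewrite mem_set; last by split.
    rewrite (_ : normc z <= X + D); last by clra.
    have [zX|zX] := leP (normc z) X.
      rewrite /ind mulr1 mulr1.
      have d1 : `|normc m `^ s - normc z `^ s| <= k%:R * D * X `^ (s - 1).
        have [mz|/ltW mz] := leP (normc m) (normc z).
          rewrite distrC ger0_norm; first by apply: powR_diff_le => //; clra.
          by rewrite subr_ge0; apply: ge0_ler_powR; rewrite ?nnegrE; clra.
        rewrite ger0_norm; first by apply: powR_diff_le => //; clra.
        by rewrite subr_ge0; apply: ge0_ler_powR; rewrite ?nnegrE; clra.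
      by apply: (le_trans d1); rewrite lerDl; case: ifP; rewrite ?mulr1 ?mulr0.
    rewrite (_ : X - D < normc z); last by clra.
    rewrite /ind /= !mulr1 mulr0 subr0 ger0_norm//.
    by apply: (le_trans (mono _ m0 mX)); rewrite lerDr.
  rewrite memNset; last by move=> [_]; clra.
  have [zX|zX] := leP (normc z) X; last first.
    rewrite mulr0 subrr normr0; apply: addr_ge0; rewrite mulr_ge0 ?ind_ge0//.
  rewrite (_ : normc z <= X + D); last by clra.
  rewrite (_ : X - D < normc z); last by clra.
  rewrite /ind /= !mulr1 sub0r normrN ger0_norm//.
  by apply: (le_trans (mono _ z0 zX)); rewrite lerDr.
have e1 : X `^ (s + 1) = X * X `^ s by rewrite addrC powRD_gt0// powRr1 ?ltW.
have e2 : X `^ s = X * X `^ (s - 1) by rewrite mulr_powRB1// ltW.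
rewrite e1 e2; have x0 := powR_ge0 X (s - 1); set x := X `^ (s - 1) in x0 *.
have -> : (X + D) ^+ 2 - (X - D) ^+ 2 = 4 * X * D by ring.
have XD : (X + D) ^+ 2 <= 4 * X ^+ 2.
  have : (X + D) ^+ 2 <= (2 * X) ^+ 2 by apply: lerXn2r; rewrite ?nnegrE; clra.
  by rewrite exprMn -natrX.
have kDx : 0 <= k%:R * D * x * pi by rewrite !mulr_ge0// ltW.
have := ler_wpM2l kDx XD.
by clra.
Qed.

(** Only finitely many norms are at most $X+1$, so a neighbourhood of $X$ contains none of them. *)
Lemma lattice_sum_locally_const (X : R) : (forall p, L p -> normc p <> X) ->
  exists2 d : R, 0 < d & forall Y, `|Y - X| < d -> lattice_sum Y = lattice_sum X.
Proof.
move=> HX; pose T := [set p | L p /\ normc p <= X + 1].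
have fT : finite_set T.
  have := grid_finite 0 L_lattice (X + 1); congr finite_set.
  by apply/seteqP; split => p /=; rewrite grid0E.
have [|c c0 H] := @seq_pos_min R _ (fun p => `|normc p - X|) (finmap.enum_fset (fset_set T)).
  move=> p; rewrite in_fset_set// => /set_mem[Lp _].
  by rewrite normr_gt0 subr_eq0; apply/eqP; exact: HX.
exists (Num.min c 1); first by rewrite lt_min c0 ltr01.
move=> Y; rewrite lt_min => /andP[Yc Y1]; rewrite /lattice_sum.
congr (\big[_/_]_(_ \in _) _); apply/seteqP; split => p /= [Lp pY]; split => //.
  rewrite leNgt; apply/negP => Xp.
  have Tp : T p by split => //; move: Y1; rewrite ltr_norml => /andP[_ ?]; clra.
  have := H p; rewrite in_fset_set// mem_set// => /(_ isT).
  by rewrite ger0_norm; [move: Yc; rewrite ltr_norml => /andP[_ ?]; clra|clra].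
have Tp : T p by split => //; clra.
have := H p; rewrite in_fset_set// mem_set// => /(_ isT).
rewrite ler0_norm; last by clra.
by move: Yc; rewrite ltr_norml => /andP[? _]; clra.
Qed.

End LatticeSum.

Section NullCircles.
Variable R : realType.
Notation mu := (@lebesgue_measure R).

Lemma measurable_ind_eq (r : R) : measurable_fun setT (fun t : R => ind R (t == r)).
Proof. by apply: measurable_fun_ifT => //; exact: measurable_fun_eqr. Qed.

Lemma cint_circle (r : R) : cint (fun z : R[i] => ind R (normc z == r)) = 0%E.
Proof.
rewrite (@cint_radial R (fun t => ind R (t == r))); last 2 first.
- exact: measurable_ind_eq.
- by move=> t; exact: ind_ge0.
have -> : (\int[mu]_(t in `]0%R, +oo[) (ind R (t == r) * t)%:E =
    \int[mu]_(t in `]0%R, +oo[ `&` [set r]) (t%:E))%E.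
  rewrite integral_mkcondr; apply: eq_integral => t _; rewrite patchE /ind.
  case: eqP => [->|tr]; first by rewrite mem_set// mul1r.
  by rewrite memNset// mul0r.
have [r0|r0] := pselect (`]0%R, +oo[%classic r).
  rewrite (_ : _ `&` _ = [set r]); last by apply/seteqP; split => t /= => [[]//|->].
  by rewrite integral_set1 mule0.
rewrite (_ : _ `&` _ = set0); first by rewrite integral_set0 mule0.
by apply/seteqP; split => t //= [] + e; rewrite e.
Qed.

Lemma cmeas_circles (rs : seq R) : cmeas (fun z : R[i] => ind R (normc z \in rs)).
Proof.
elim: rs => [|r rs IH].
  have -> : (fun z : R[i] => ind R (normc z \in [::])) = (fun=> 0) by apply/funext.
  exact: cmeas_cst.
have -> : (fun z : R[i] => ind R (normc z \in r :: rs)) =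
   (fun z => ind R (normc z == r) + (1 - ind R (normc z == r)) * ind R (normc z \in rs)).
  apply/funext => z; rewrite inE /ind; case: eqP => _ /=; first by rewrite subrr mul0r addr0.
  by rewrite subr0 mul1r add0r.
have m1 : cmeas (fun z : R[i] => ind R (normc z == r)).
  exact: (cmeas_comp (measurable_ind_eq r) (@cmeas_normc R)).
apply: cmeasD => //; apply: cmeasM => //.
by apply: (@cmeas_comp R (fun x => 1 - x)) => //; exact: measurable_funB.
Qed.

Lemma cint_circles (rs : seq R) : cint (fun z : R[i] => ind R (normc z \in rs)) = 0%E.
Proof.
have i0 := @ind_ge0 R.
elim: rs => [|r rs IH].
  by rewrite /cint integral0_eq.
have m1 : cmeas (fun z : R[i] => ind R (normc z == r)).
  exact: (cmeas_comp (measurable_ind_eq r) (@cmeas_normc R)).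
apply/eqP; rewrite eq_le cint_ge0 ?andbT; last by move=> z.
apply: (@le_trans _ _ (cint (fun z : R[i] => ind R (normc z == r) + ind R (normc z \in rs)))).
  apply: cint_le => //; [exact: cmeas_circles|apply: cmeasD => //; exact: cmeas_circles|].
  move=> z; rewrite inE /ind; case: eqP => _ /=; last by rewrite add0r.
  by rewrite lerDl; case: ifP.
rewrite cintD//; last exact: cmeas_circles.
by rewrite cint_circle IH adde0.
Qed.

Lemma ae_circles (rs : seq R) (P : R * R -> Prop) :
  (forall q, normc (q.1 +i* q.2) \notin rs -> P q) -> {ae lebesgue2 R, forall q, P q}.
Proof.
move=> H; pose A := [set q : R * R | normc (q.1 +i* q.2) \in rs].
have mA : measurable A.
  have := @cmeas_circles rs measurableT [set 1%R] (measurable_set1 _); rewrite setTI.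
  congr measurable; apply/seteqP; split => q /=; rewrite /A /ind /=.
    by case: ifP => // _ /esym/eqP; rewrite oner_eq0.
  by move=> ->.
exists A; split => //.
  rewrite -[A]setIT -integral_indic//; apply: etrans (cint_circles rs).
  apply: eq_integral => q _; rewrite indicE /ind; congr _%:E.
  by case: ifP => h; [rewrite mem_set|rewrite memNset// /A /= h].
by move=> q /= nP; apply: contrapT => /negP h; apply: nP; exact: H.
Qed.

End NullCircles.

(** * The three regimes of the density *)

Section RadialDensity.
Variables (R : realType) (alpha : R).
Hypotheses (alpha_gt0 : 0 < alpha) (alpha_lt1 : alpha < 1).
Variables (w1 w2 : R[i]) (L : set R[i]).
Hypothesis L_lattice : lattice_basis L w1 w2.
Notation cov := (covol w1 w2).
Let beta : R := 1 - alpha.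
Let s : R := 2 / beta.
Let beta_gt0 : 0 < beta. Proof. by rewrite subr_gt0. Qed.
Let s_ge1 : 1 <= s.
Proof. by rewrite ler_pdivlMr// mul1r; have := alpha_gt0; rewrite /beta; lra. Qed.
Let s_gt0 : 0 < s. Proof. exact: lt_le_trans s_ge1. Qed.
Let cov0 : 0 < cov := cov_gt0 0 L_lattice.
Let c0 : R := alpha `^ s / (beta * cov).
Let c0_ge0 : 0 <= c0.
Proof. by rewrite divr_ge0 ?powR_ge0// mulr_ge0// ltW. Qed.

(** For finite positive $\lambda$ the density depends on $|z|/\lambda$ alone. The limits
    $\lambda_N\to0$, $\lambda_N\to\lambda\in\,]0,+\infty[$ and $\lambda_N\to+\infty$ become its
    behaviour at infinity, at a finite point and near 0. *)
Definition radial_density (X : R) : R :=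
  c0 * X `^ (- (s + 2)) * lattice_sum s L (X / alpha).

Lemma rho_radial lam w : 0 < lam -> w != 0 ->
  rho alpha L cov lam%:E w = radial_density (normc w / lam).
Proof.
move=> lam0 wn0; rewrite (rhoE alpha_lt1)//; congr (_ * _); rewrite /lattice_sum -/s.
by rewrite invfM mulrA mulrAC.
Qed.

Lemma radial_density_ge0 X : 0 <= radial_density X.
Proof.
apply: mulr_ge0; last exact: lattice_sum_ge0.
by apply: mulr_ge0 => //; exact: powR_ge0.
Qed.

(** The bound $cX^{s+2}$ on the lattice sum, valid for all $X>0$, exactly cancels the negative
    power; this gives a domination independent of $\lambda$. *)
Lemma radial_density_bound : exists2 b : R, 0 <= b &
  forall X : R, 0 < X -> radial_density X <= b.
Proof.
have [c cp H] := lattice_sum_bound s_ge1 L_lattice.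
exists (c0 * (c * alpha `^ (- (s + 2)))).
  by apply: mulr_ge0 => //; rewrite mulr_ge0 ?powR_ge0 ?(ltW cp).
move=> X X0; rewrite /radial_density -mulrA; apply: ler_wpM2l => //.
have Xa : 0 < X / alpha by rewrite divr_gt0.
apply: (le_trans (ler_wpM2l (powR_ge0 _ _) (H _ Xa))).
have a1 : 0 <= alpha by exact: ltW.
rewrite (@powRM _ X) ?invr_ge0 ?(ltW X0)// !powRN -(powR_inv1 a1) -powRrM mulN1r powRN.
rewrite mulrCA mulKf//; apply: lt0r_neq0; exact: powR_gt0.
Qed.

Lemma radial_density_small : exists2 x : R, 0 < x & forall X, X < x -> radial_density X = 0.
Proof.
have [x x0 H] := lattice_sum_small s_ge1 L_lattice.
exists (x * alpha); first by rewrite mulr_gt0.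
by move=> X Xx; rewrite /radial_density H ?mulr0// ltr_pdivrMr.
Qed.

Lemma powR_continuous_gt0 (a X : R) : 0 < X -> (Y `^ a) @[Y --> X] --> X `^ a.
Proof.
move=> X0; have nX : \forall Y \near X, 0 < Y by exact: (@lt_nbhsr _ 0 X).
apply: (@cvg_trans _ ((fun Y => expR (a * ln Y)) @ X)).
  by apply: near_eq_cvg; apply: filterS nX => Y Y0; rewrite /powR (gt_eqF Y0).
rewrite /powR (gt_eqF X0).
apply: (@cvg_comp _ _ _ (fun Y => a * ln Y) expR _ (nbhs (a * ln X))); last exact: continuous_expR.
by apply: cvgM; [exact: cvg_cst|exact: continuous_ln].
Qed.

Lemma radial_density_continuous (X : R) : 0 < X -> (forall p, L p -> normc p <> X / alpha) ->
  radial_density Y @[Y --> X] --> radial_density X.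
Proof.
move=> X0 /(lattice_sum_locally_const s L_lattice)[d d0 H].
have nX : \forall Y \near X, lattice_sum s L (Y / alpha) = lattice_sum s L (X / alpha).
  near=> Y; apply: H; rewrite -mulrBl normrM (gtr0_norm (_ : 0 < alpha^-1)) ?invr_gt0//.
  rewrite ltr_pdivrMr// distrC.
  by near: Y; apply: cvgr_dist_lt; rewrite ?mulr_gt0.
pose k := c0 * lattice_sum s L (X / alpha).
apply: (@cvg_trans _ ((fun Y => k * Y `^ (- (s + 2))) @ X)).
  by apply: near_eq_cvg; apply: filterS nX => Y YX; rewrite /radial_density YX mulrAC.
rewrite (_ : radial_density X = k * X `^ (- (s + 2))); last by rewrite /radial_density mulrAC.
have cv : Y `^ (- (s + 2)) @[Y --> X] --> X `^ (- (s + 2)) by exact: powR_continuous_gt0.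
exact: (cvgMl_tmp (a := k) cv).
Unshelve. all: by end_near. Qed.

(** The leading term of [lattice_sum_asymp] cancels the power and the error has relative order
    $1/X$. The constant follows from $(s+2)(1-\alpha)=2(2-\alpha)$ and
    $\alpha^s\alpha^{-(s+2)}=\alpha^{-2}$. *)
Lemma radial_density_limit : exists c X1 : R, [/\ 0 <= c, 0 < X1 & forall X, X1 <= X ->
  `|radial_density X - pi / (alpha ^+ 2 * (2 - alpha) * cov ^+ 2)| <= c / X].
Proof.
have [c c1 H] := lattice_sum_asymp s_ge1 L_lattice.
have D0 := @diam_ge0 R w1 w2; set D := diam w1 w2 in H D0.
have a0 := alpha_gt0; have a1 : 0 <= alpha by exact: ltW.
pose c2 := c0 / cov * (c * alpha `^ (- (s + 1))).
exists c2, (D * alpha + 1); split.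
- apply: mulr_ge0; last by rewrite mulr_ge0 ?powR_ge0.
  by apply: mulr_ge0 => //; rewrite invr_ge0 ltW.
- by have := mulr_ge0 D0 a1; lra.
move=> X XX1; have X0 : 0 < X by have := mulr_ge0 D0 a1; lra.
have Xa : 0 < X / alpha by rewrite divr_gt0.
have DX : D <= X / alpha by rewrite ler_pdivlMr//; lra.
have := H _ Xa DX; set S := lattice_sum _ _ _ => h.
have X2 : 0 < X `^ (s + 2) by exact: powR_gt0.
have pw (e : R) : (X / alpha) `^ e = X `^ e * alpha `^ (- e).
  rewrite (@powRM _ X) ?invr_ge0 ?(ltW X0)//; congr (_ * _).
  by rewrite -(powR_inv1 a1) -powRrM mulN1r.
have e1 : X `^ (s + 1) = X `^ (s + 2) / X.
  rewrite (_ : s + 2 = s + 1 + 1); last by ring.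
  by rewrite [RHS]mulrC [in RHS]powRD_gt0// powRr1 ?(ltW X0)// mulrC mulfK// gt_eqF.
have aas : alpha `^ s * alpha `^ (- (s + 2)) = (alpha ^+ 2)^-1.
  rewrite -powRD_gt0// (_ : s + - (s + 2) = - 2%:R); last by ring.
  by rewrite powRN powR_mulrn.
have lim : c0 / cov * (2 * pi / (s + 2) * alpha `^ (- (s + 2))) =
    pi / (alpha ^+ 2 * (2 - alpha) * cov ^+ 2).
  rewrite /c0 (_ : alpha `^ s / (beta * cov) / cov * (2 * pi / (s + 2) * alpha `^ (- (s + 2))) =
     (alpha `^ s * alpha `^ (- (s + 2))) * (2 * pi / (s + 2)) / (beta * cov ^+ 2)); last first.
    have := cov0; have := beta_gt0; have : s + 2 != 0 by rewrite gt_eqF// addr_gt0.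
    move: (pi : R) (alpha `^ s) (alpha `^ _) => q x y s2 b k.
    by field; rewrite s2 !gt_eqF.
  rewrite aas /s; have := cov0; have b0 := beta_gt0; rewrite /beta in b0 *.
  move: (pi : R) => q k; field.
  have [b1 b2] : 0 < 2 - alpha /\ 0 < 2 + 2 * (1 - alpha) by split; clra.
  by rewrite !gt_eqF.
have -> : radial_density X - pi / (alpha ^+ 2 * (2 - alpha) * cov ^+ 2) =
   c0 / cov * (X `^ (s + 2))^-1 *
     (cov * S - 2 * pi / (s + 2) * (X / alpha) `^ (s + 2)).
  rewrite -lim /radial_density -/S powRN pw.
  have := cov0; move: X2; have : s + 2 != 0 by rewrite gt_eqF// addr_gt0.
  move: (pi : R) (X `^ _) (alpha `^ _) c0 => q x y c0' s2 x0 k.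
  by field; rewrite s2 !gt_eqF.
have k0 : 0 <= c0 / cov * (X `^ (s + 2))^-1.
  by do 2 (apply: mulr_ge0 => //; last by rewrite invr_ge0 ltW).
rewrite normrM (ger0_norm k0); apply: (le_trans (ler_wpM2l k0 h)).
rewrite pw e1 /c2; have := cov0.
move: X2 (alpha `^ _) c0 => + y c0'; move: (X `^ _) => x x0 k.
rewrite le_eqVlt; apply/orP; left; apply/eqP; field.
by rewrite !gt_eqF.
Qed.

Lemma rho_bound : exists2 b : R, 0 <= b & forall (lam : R) z, 0 < lam ->
  0 <= rho alpha L cov lam%:E z <= b.
Proof.
have [b b0 H] := radial_density_bound; exists b => // lam z lam0.
have [->|z0] := eqVneq z 0; first by rewrite /rho (gt_eqF lam0) eqxx lexx.
by rewrite rho_radial// radial_density_ge0 H// divr_gt0// normc_gt0.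
Qed.

Lemma rho_ge0 (lambda : \bar R) z : (0 <= lambda)%E -> 0 <= rho alpha L cov lambda z.
Proof.
case: lambda => [l| |//] l0; last by rewrite /rho.
have [->|ln0] := eqVneq l 0.
  have a1 : 0 <= 2 - alpha by have := alpha_lt1; lra.
  rewrite /rho eqxx divr_ge0 ?pi_ge0// mulr_ge0 ?sqr_ge0// mulr_ge0 ?sqr_ge0//.
have [b _ H] := rho_bound; have lp : 0 < l by rewrite lt0r ln0 -lee_fin.
by have /andP[] := H l z lp.
Qed.

Lemma rho_cvg (lam : nat -> R) (lambda : \bar R) z : (forall n, 0 < lam n) ->
  (0 <= lambda)%E -> (lam n)%:E @[n --> \oo] --> lambda -> z != 0 ->
  (forall l p, lambda = l%:E -> L p -> normc z <> alpha * l * normc p) ->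
  rho alpha L cov (lam n)%:E z @[n --> \oo] --> rho alpha L cov lambda z.
Proof.
move=> lam0 l0 lamc zn0 Hl; have z0 : 0 < normc z by rewrite normc_gt0.
rewrite (_ : (fun n => rho _ _ _ (lam n)%:E z) = (fun n => radial_density (normc z / lam n))); last first.
  by apply/funext => n; rewrite rho_radial.
case: lambda l0 lamc Hl => [l| |//].
- rewrite lee_fin => l0 lamc Hl.
  have {}lamc : lam n @[n --> \oo] --> l by exact: (fine_cvg lamc).
  have [le0|ln0] := eqVneq l 0.
    rewrite /rho le0 eqxx; rewrite {}le0 in lamc.
    have [c [X1 [c1 X10 H]]] := radial_density_limit.
    apply/cvgrPdist_le => e e0; near=> n.
    rewrite distrC.
    have h1 : X1 <= normc z / lam n.
      rewrite ler_pdivlMr// -ler_pdivlMl//; apply: ltW.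
      near: n; move/cvgrPdist_lt: lamc => /(_ (X1^-1 * normc z)).
      by rewrite mulr_gt0 ?invr_gt0// => /(_ isT); apply: filterS => n; rewrite sub0r normrN gtr0_norm.
    apply: (le_trans (H _ h1)).
    rewrite ler_pdivrMr ?divr_gt0// mulrA ler_pdivlMr//.
    apply: (@le_trans _ _ ((c + 1) * lam n)); first by rewrite ler_pM2r//; lra.
    rewrite -ler_pdivlMl; last by lra.
    apply: ltW; near: n; move/cvgrPdist_lt: lamc => /(_ ((c + 1)^-1 * (e * normc z))).
    rewrite mulr_gt0 ?invr_gt0 ?mulr_gt0//; last by lra.
    by move=> /(_ isT); apply: filterS => n; rewrite sub0r normrN gtr0_norm.
  have lp : 0 < l by rewrite lt0r ln0.
  rewrite rho_radial//.
  apply: (@cvg_comp _ _ _ (fun n => normc z / lam n) radial_density _ (nbhs (normc z / l))).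
    by apply: cvgM; [exact: cvg_cst|exact: cvgV].
  apply: radial_density_continuous; first exact: divr_gt0.
  move=> p Lp e; apply: (Hl l p erefl Lp); rewrite e.
  by field; rewrite !gt_eqF.
- move=> _ /cvgeryP lamc _; rewrite /rho.
  have [x x0 H] := radial_density_small.
  apply: cvg_near_cst; near=> n; apply: H; rewrite ltr_pdivrMr// -ltr_pdivrMl//.
  near: n; move/cvgryPgt: lamc; exact.
Unshelve. all: by end_near. Qed.

Variables (f : R[i] -> R) (B C : R).
Hypothesis tf : test_function f B C.

(** The identity [sum_slope_density] with $N=1$ and $\varphi=\lambda$ writes the product as a finite
    sum of measurable functions with a range of [p] independent of [w]. *)
Lemma cmeas_test_rho (lam : R) : 0 < lam -> cmeas (fun w => f w * rho alpha L cov lam%:E w).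
Proof.
move=> lam0; have b1 : 0 < (1%N%:R : R) by [].
have mf : cmeas f := cmeas_unif (test_unif tf).
have -> : (fun w => f w * rho alpha L cov lam%:E w) = (fun w =>
   \sum_(p <- finmap.enum_fset (fset_set (gridannulus 0 L 0 (reach alpha C lam 1))))
      (cov * (1 / lam) ^+ 2)^-1 * (beta^-1 * expR (s * complex.Re (log_slope alpha lam p)) *
    (f w * normc w `^ (- (s + 2)) * ind R (rad beta (log_slope alpha lam p) 1 <= normc w)))).
  apply/funext => w; rewrite -mulr_sumr -fsbig_finite; last exact: (gridannulus_finite L_lattice).
  have := sum_slope_density alpha_gt0 alpha_lt1 tf 0 L_lattice w lam0 (ltn0Sn 0).
  rewrite /= powR1 divr1 => ->; rewrite mulKf//.
  by rewrite gt_eqF// mulr_gt0// exprn_gt0// divr_gt0.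
apply: cmeas_sum => p; do 2 (apply: cmeasM; first exact: cmeas_cst).
apply: cmeasM; first apply: cmeasM => //.
  apply: (@cmeas_comp R (fun x => x `^ (- (s + 2)))); last exact: cmeas_normc.
  exact: measurable_powR.
by apply: cmeas_bool; apply: (@cmeas_le R (fun=> _) (@normc R)); [exact: cmeas_cst|exact: cmeas_normc].
Qed.

Lemma cmeas_test_rho_ereal (lambda : \bar R) : (0 <= lambda)%E ->
  cmeas (fun w => f w * rho alpha L cov lambda w).
Proof.
have mf : cmeas f := cmeas_unif (test_unif tf).
case: lambda => [l| |//] l0; last by apply: cmeasM => //; exact: cmeas_cst.
have [->|ln0] := eqVneq l 0.
  by apply: cmeasM => //; rewrite /rho eqxx; exact: cmeas_cst.
by apply: cmeas_test_rho; rewrite lt0r ln0 -lee_fin.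
Qed.

Lemma cint_rho_cvg (lam : nat -> R) (lambda : \bar R) : (forall n, 0 < lam n) ->
  (0 <= lambda)%E -> (lam n)%:E @[n --> \oo] --> lambda ->
  exists2 I : R, cint (fun w => f w * rho alpha L cov lambda w) = I%:E &
  fine (cint (fun w => f w * rho alpha L cov (lam n)%:E w)) @[n --> \oo] --> I.
Proof.
move=> lam0 l0 lamc; have [b b0 Hb] := rho_bound.
have B0 := test_bound_ge0 tf; have C0 := test_pos tf; have f0 := test_ge0 tf.
(* The radii where the limit density jumps within the support. For $\lambda=+\infty$ the default
   value [fine] $=0$ only adds useless zeros; the radius 0 excludes the origin. *)
pose rs : seq R := 0 :: [seq alpha * fine lambda * normc p |
   p <- finmap.enum_fset (fset_set [set p | L p /\ normc p <= C / (alpha * fine lambda)])].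
have mg : cmeas (fun z => B * b * ind R (normc z <= C)).
  by apply: cmeasM; [exact: cmeas_cst|exact: cmeas_ind_le].
have [] := @dominated_convergence _ _ _ (lebesgue2 R) setT measurableT
  (fun n q => (f (q.1 +i* q.2) * rho alpha L cov (lam n)%:E (q.1 +i* q.2))%:E)
  (fun q => (f (q.1 +i* q.2) * rho alpha L cov lambda (q.1 +i* q.2))%:E)
  (fun q => (B * b * ind R (normc (q.1 +i* q.2) <= C))%:E).
- by move=> n; apply/measurable_EFinP; exact: cmeas_test_rho.
- by apply/measurable_EFinP; exact: cmeas_test_rho_ereal.
- apply: (@ae_circles _ rs) => q qrs _; set z := q.1 +i* q.2 in qrs *.
  apply: cvg_EFin; first exact: nearW.
  have [fz0|/eqP fz0] := eqVneq (f z) 0.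
    rewrite /= (_ : (fun _ => _) = (fun=> 0)); last by apply/funext => n; rewrite fz0 mul0r.
    by rewrite fz0 mul0r; exact: cvg_cst.
  have zC : normc z <= C by rewrite leNgt; apply/negP => /(test_supp tf).
  move: qrs; rewrite inE negb_or => /andP[zn0 zrs].
  have zp : z != 0 by rewrite -normc_gt0 lt0r zn0 normc_ge0.
  apply: cvgM; first exact: cvg_cst.
  apply: rho_cvg => // l p el Lp e; move/negP: zrs; apply.
  rewrite el /= in l0 *; rewrite lee_fin in l0; apply/mapP; exists p; last exact: e.
  have zp0 : 0 < normc z by rewrite normc_gt0.
  have lp : 0 < l.
    by rewrite lt0r l0 andbT; apply/negP => /eqP le0; rewrite e le0 mulr0 mul0r ltxx in zp0.
  rewrite in_fset_set; last exact: (lattice_ball_finite L_lattice).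
  by rewrite mem_set//; split => //; rewrite ler_pdivlMr ?mulr_gt0// mulrC -e.
- apply/integrableP; split; first exact/measurable_EFinP.
  under eq_integral => q _.
    rewrite abse_EFin ger0_norm; last by rewrite !mulr_ge0 ?ind_ge0.
    over.
  have := @cint_disc_fin R (B * b) C _ (ltW C0) (mulr_ge0 B0 b0) mg
     (fun z => mulr_ge0 (mulr_ge0 B0 b0) (ind_ge0 R _)) (fun z => lexx _).
  by move=> h; apply: (le_lt_trans h); rewrite ltry.
- apply: aeW => q n _; set z := q.1 +i* q.2; have /andP[r0 rb] := Hb (lam n) z (lam0 n).
  rewrite abse_EFin lee_fin ger0_norm ?mulr_ge0//.
  rewrite /ind; case: ifPn => [_|]; last first.
    by rewrite -ltNge => /(test_supp tf) ->; rewrite mul0r mulr0.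
  by rewrite mulr1; apply: ler_pM => //; exact: (test_le tf).
move=> ig _ cv.
have fin := integrable_fin_num measurableT ig.
exists (fine (cint (fun w => f w * rho alpha L cov lambda w))); first by rewrite fineK.
by apply: fine_cvg; rewrite fineK.
Qed.

End RadialDensity.

(** * Compactly supported functions *)

Section CompactSupport.
Variable R : realType.

(** Balls of the regular module have complex radii; a positive complex number is real, so they are
    the discs of [normc]. *)
Lemma nbhs_normc (x : R[i]) (A : set R[i]) :
  nbhs (x : R[i]^o) A <-> exists2 e : R, 0 < e & forall y, normc (y - x) < e -> A y.
Proof.
split.
  move=> /nbhs_ballP[e /= e0 H].
  have eE : e = (complex.Re e)%:C.
    by move: e0; rewrite ltcE => /andP[/eqP i0 _]; apply: eqC.
  exists (complex.Re e); first by move: e0; rewrite ltcE => /andP[].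
  move=> y yx; apply: H; rewrite -ball_normE /= eE.
  by rewrite (_ : `|_| = (normc (x - y))%:C)// ltcR normcBC.
move=> [e e0 H]; apply/nbhs_ballP; exists e%:C => /=; first by rewrite ltcR.
move=> y; rewrite -ball_normE /= (_ : `|_| = (normc (x - y))%:C)// ltcR normcBC.
exact: H.
Qed.

(** Compactness with a parameter tending to $+\infty$: a property that holds locally for all large
    [t] holds on [K] for one common [t]. *)
Lemma compact_near_oo (K : set R[i]^o) (P : R -> R[i] -> Prop) : compact K ->
  (forall x, K x -> exists e M : R, 0 < e /\
     forall y t, normc (y - x) < e -> M < t -> P t y) ->
  exists2 t : R, 0 < t & forall y, K y -> P t y.
Proof.
move=> /compact_near_coveringP cK H.
have [x Kx|M [Mr HM]] := cK R (nbhs (+oo)) P _.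
  have [e [M [e0 HP]]] := H x Kx.
  exists ([set y | normc (y - x) < e], [set t | M < t]); last by move=> [y t] [/= ? ?]; exact: HP.
  split; first by apply/nbhs_normc; exists e.
  by exists M; split => //; exact: num_real.
exists (`|M| + 1); first by have := normr_ge0 M; lra.
by apply: HM; have := ler_norm M; lra.
Qed.

(** Two uses of [compact_near_oo]: the parameter is first a common bound for the support and the
    values, then the inverse of a modulus of uniform continuity. *)
Lemma Cc_test (f : R[i] -> R[i]) : Cc f -> exists B C : R,
  [/\ 0 < C, forall z, normc (f z) <= B, forall z, C < normc z -> f z = 0 &
    forall e, 0 < e -> exists2 d : R, 0 < d &
      forall z w, normc (z - w) < d -> normc (f z - f w) < e].
Proof.
move=> [cf cK]; set K := closure _ in cK.
have fK z : ~ K z -> f z = 0.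
  by move=> nK; apply: contrapT => fz; apply: nK; exact: subset_closure.
have cont x e : 0 < e -> exists2 d : R, 0 < d & forall y, normc (y - x) < d -> normc (f y - f x) < e.
  move=> e0; have nf : nbhs (f x : R[i]^o) [set w | normc (w - f x) < e].
    by apply/nbhs_normc; exists e.
  by have /nbhs_normc[d d0 H] := cf x _ nf; exists d.
have [|t t0 Ht] := compact_near_oo (P := fun t y => normc y <= t /\ normc (f y) <= t) cK.
  move=> x _; have [d d0 Hd] := cont x 1 ltr01.
  exists (Num.min d 1), (normc x + normc (f x) + 1); split; first by rewrite lt_min d0 ltr01.
  move=> y t; rewrite lt_min => /andP[yd y1] tM; have := Hd y yd => fy.
  have := normcD (y - x) x; have := normcD (f y - f x) (f x); rewrite !subrK.
  have := normc_ge0 x; have := normc_ge0 (f x); split; lra.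
exists t, t; split => //.
- move=> z; have [/Ht[]//|/fK ->] := pselect (K z).
  by rewrite normc0 ltW.
- by move=> z tz; apply: fK => /Ht[]; lra.
move=> e e0.
have [|M M0 HM] := compact_near_oo
  (P := fun t y => forall w, normc (y - w) < t^-1 -> normc (f y - f w) < e) cK.
  move=> x _; have e2 : 0 < e / 2 by rewrite divr_gt0.
  have [d d0 Hd] := cont x (e / 2) e2.
  exists (d / 2), (2 / d); split; first by rewrite divr_gt0.
  move=> y M yd dM w yw.
  have M0 : 0 < M by apply: lt_trans dM; rewrite divr_gt0.
  have Md : M^-1 < d / 2.
    by rewrite -[d / 2]invrK invf_div ltf_pV2 ?posrE ?divr_gt0.
  have h1 : normc (f y - f x) < e / 2 by apply: Hd; lra.
  have h2 : normc (f w - f x) < e / 2.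
    apply: Hd; have := normcD (w - y) (y - x); rewrite addrA subrK (normcBC w y); lra.
  have := normcD (f y - f x) (f x - f w); rewrite addrA subrK (normcBC (f x)); lra.
exists M^-1; first by rewrite invr_gt0.
move=> z w zw; have [/HM/(_ _ zw)//|/fK z0] := pselect (K z).
have [/HM h|/fK ->] := pselect (K w); first by rewrite normcBC; apply: h; rewrite normcBC.
by rewrite z0 subrr normc0.
Qed.

(** Covers the real part, the imaginary part and their negatives, so that four test functions are
    treated as one. *)
Definition lipschitz_part (l : R[i] -> R) : Prop :=
  l 0 = 0 /\ forall z w, `|l z - l w| <= normc (z - w).

Lemma lipschitz_Re : lipschitz_part (@complex.Re R).
Proof. by split => // z w; rewrite -ReN -ReD; exact: Re_le_normc. Qed.

Lemma lipschitz_Im : lipschitz_part (@complex.Im R).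
Proof. by split => // z w; rewrite -ImN -ImD; exact: Im_le_normc. Qed.

Lemma lipschitz_opp l : lipschitz_part l -> lipschitz_part (fun z => - l z).
Proof.
move=> [l0 H]; split; first by rewrite l0 oppr0.
by move=> z w; rewrite -opprD normrN; exact: H.
Qed.

Definition pos_part (l : R[i] -> R) (f : R[i] -> R[i]) (z : R[i]) : R := Num.max 0 (l (f z)).

Lemma pos_partB l f z : pos_part l f z - pos_part (fun z => - l z) f z = l (f z).
Proof.
rewrite /pos_part /Num.max; case: ltP => h; case: ltP => h'; lra.
Qed.

Lemma Cc_pos_part (f : R[i] -> R[i]) : Cc f -> exists B C : R,
  forall l, lipschitz_part l -> test_function (pos_part l f) B C.
Proof.
move=> /Cc_test[B [C [C0 fB fC fu]]]; exists B, C => l [l0 lL].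
have B0 : 0 <= B by apply: le_trans (fB 0); exact: normc_ge0.
split => //.
- by move=> z; rewrite /pos_part le_max lexx.
- move=> z; rewrite /pos_part ge_max B0 /=; apply: le_trans (fB z).
  by have := lL (f z) 0; rewrite l0 !subr0; apply: le_trans; exact: ler_norm.
- by move=> z /fC; rewrite /pos_part => ->; rewrite l0 maxxx.
move=> e e0; have [d d0 H] := fu e e0; exists d => // z w zw.
apply: le_lt_trans (H z w zw); apply: le_trans (lL (f z) (f w)).
rewrite /pos_part /Num.max; move: (l (f z)) (l (f w)) => x y.
case: ltP => hx; case: ltP => hy; rewrite ?subr0 ?sub0r ?normrN ?subrr ?normr0//.
- by rewrite gtr0_norm//; apply: le_trans (ler_norm _); lra.
- by rewrite gtr0_norm// distrC; apply: le_trans (ler_norm _); lra.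
Qed.

End CompactSupport.

Section RealPart.
Variable R : realType.

Lemma part_fsum (T : choiceType) (S : set T) (l : R[i] -> R) (F : T -> R[i]) :
  {morph l : z w / z + w} -> l 0 = 0 -> finite_set S ->
  l (\sum_(i \in S) F i) = \sum_(i \in S) l (F i).
Proof. by move=> lD l0 fS; rewrite !fsbig_finite//=; exact: (big_morph l lD l0). Qed.

Lemma log_pairs_finite (m n : R[i]) N' N'' : m != 0 -> n != 0 ->
  finite_set (log_pairs m n N' N'').
Proof.
move=> m0 n0; apply: (@sub_finite_set _ _ (strip_logs [set m] N' N'' `*` strip_logs [set n] N' N'')).
  by move=> [r s] [/= rm sn _ rI sI].
apply: finite_setX; apply: strip_logs_finite => //=.
- by move=> e; rewrite e eqxx in m0.
- by move=> e; rewrite e eqxx in n0.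
Qed.

Variables (alpha : R) (w1 w2 z0 : R[i]) (L : set R[i]).
Hypothesis L_lattice : lattice_basis L w1 w2.

Lemma pair_measure_part (l : R[i] -> R) (f : R[i] -> R[i]) (phi psi : nat -> R) N N' N'' :
  {morph l : z w / z + w} -> l 0 = 0 -> (forall (a : R) z, l (a%:C * z) = a * l z) ->
  l (pair_measure alpha (grid z0 L) phi psi N N' N'' f) =
  ((N' + N'')%:R * psi N)^-1 *
    (pair_sum alpha (pos_part l f) z0 L (phi N) N N' N''
     - pair_sum alpha (pos_part (fun z => - l z) f) z0 L (phi N) N N' N'').
Proof.
move=> lD l0 lZ; rewrite /pair_measure lZ; congr (_ * _).
have fG : finite_set (grid_pairs (grid z0 L) N).
  apply: (@sub_finite_set _ _ (gridball z0 L N%:R `*` gridball z0 L N%:R)).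
    by move=> [m n] [/= ? ? _ /andP[_ ?] /andP[_ ?]].
  by apply: finite_setX; exact: (grid_finite z0 L_lattice).
rewrite part_fsum// /pair_sum -fsumrB//; apply: eq_fsbigr => -[m n] /set_mem[/= _ _ _].
move=> /andP[m0 _] /andP[n0 _]; rewrite !normc_gt0 in m0 n0.
have fL := log_pairs_finite N' N'' m0 n0.
rewrite part_fsum// -fsumrB//; apply: eq_fsbigr => rs _.
by rewrite pos_partB.
Qed.

End RealPart.

(** * The limit for a nonnegative test function *)

Section TestLimit.
Variables (R : realType) (alpha : R).
Hypotheses (alpha_gt0 : 0 < alpha) (alpha_lt1 : alpha < 1).
Variables (w1 w2 z0 : R[i]) (L : set R[i]).
Hypothesis L_lattice : lattice_basis L w1 w2.
Variables (phi psi : nat -> R) (lambda : \bar R).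
Hypotheses (phi_gt0 : forall N, 0 < phi N)
  (phi_oo : phi N @[N --> \oo] --> +oo)
  (lambda_ge0 : (0 <= lambda)%E)
  (phi_lambda : (phi N / (N%:R `^ (1 - alpha)))%:E @[N --> \oo] --> lambda)
  (psiE : forall N : nat, (1 <= N)%N -> psi N = ((N%:R `^ (2 - alpha)) / phi N) ^+ 2).
Notation cov := (covol w1 w2).

Lemma test_limit (f : R[i] -> R) (B C : R) : test_function f B C ->
  exists2 I : R, cint (fun w => f w * rho alpha L cov lambda w) = I%:E &
  forall eps, 0 < eps -> exists M : nat, forall N N' N'' : nat,
    (1 <= N)%N -> (M <= N)%N -> (M <= N' + N'')%N ->
    `|((N' + N'')%:R * psi N)^-1 * pair_sum alpha f z0 L (phi N) N N' N'' - I| < eps.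
Proof.
(* The index is shifted by one because at $N=0$ the power is 0 and the quotient takes the default
   value 0, which is not positive. *)
move=> tf; pose lam n := phi n.+1 / n.+1%:R `^ (1 - alpha).
have lam0 n : 0 < lam n by rewrite divr_gt0// powR_gt0.
have lamc : (lam n)%:E @[n --> \oo] --> lambda.
  move: phi_lambda; rewrite -(cvg_shiftS (fun N => (phi N / N%:R `^ (1 - alpha))%:E)).
  exact.
have [I IE Icv] := cint_rho_cvg alpha_gt0 alpha_lt1 L_lattice tf lam0 lambda_ge0 lamc.
exists I => // eps eps0.
have e20 : 0 < eps / 3 by rewrite divr_gt0.
have [F F1 H] := pair_sum_density alpha_gt0 alpha_lt1 tf z0 L_lattice e20.
have [M1 _ HM1] : \forall N \near \oo, F <= phi N by move/cvgryPge: phi_oo; exact.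
have [M2 _ HM2] : \forall n \near \oo,
    `|I - fine (cint (fun w => f w * rho alpha L cov (lam n)%:E w))| < eps / 3.
  by move/cvgrPdist_lt: Icv; exact.
pose MF := (Num.truncn F).+1.
have FMF (n : nat) : (MF <= n)%N -> F <= n%:R.
  move=> h; have F0 : 0 <= F by clra.
  have /andP[_ /ltW h2] := truncn_itv F0.
  by apply: (le_trans h2); rewrite ler_nat.
exists (M1 + M2.+1 + MF)%N => N N' N'' N1 MN MK.
have Fphi : F <= phi N by apply: HM1 => /=; clia.
have FN : F <= N%:R by apply: FMF; clia.
have FK : F <= (N' + N'')%:R by apply: FMF; clia.
have [J JE HJ] := H (phi N) N N' N'' Fphi FN FK.
have NE : N = N.-1.+1 by rewrite prednK.
have lamE : phi N / N%:R `^ (1 - alpha) = lam N.-1 by rewrite /lam -NE.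
have M2N : (M2 <= N.-1)%N by clia.
have := HM2 N.-1 M2N; rewrite -lamE JE /= => hJ.
have N0 : (0 : R) < N%:R by rewrite ltr0n.
(* The normalization found for finite $N$ is the prescribed one. *)
have NP : (N%:R / (phi N / N%:R `^ (1 - alpha))) ^+ 2 = psi N.
  rewrite psiE//; congr (_ ^+ 2).
  rewrite (_ : 2 - alpha = 1 + (1 - alpha)); last by ring.
  rewrite [in RHS]powRD_gt0// [in RHS]powRr1 ?ler0n//.
  have := phi_gt0 N; have : 0 < N%:R `^ (1 - alpha) by exact: (powR_gt0 _ N0).
  by move: (N%:R `^ _) => y y0 p0; field; rewrite !gt_eqF.
have K0 : (0 : R) < (N' + N'')%:R by clra.
have psi0 : 0 < psi N.
  by rewrite psiE// exprn_gt0// divr_gt0 ?powR_gt0.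
have T0 : 0 < (N' + N'')%:R * psi N by rewrite mulr_gt0.
rewrite NP in HJ; set T := (N' + N'')%:R * psi N in T0 HJ *.
set S := pair_sum _ _ _ _ _ _ _ _ in HJ *.
have h : `|T^-1 * S - J| <= eps / 3.
  have -> : T^-1 * S - J = T^-1 * (S - T * J) by rewrite mulrBr mulKf// gt_eqF.
  rewrite normrM gtr0_norm ?invr_gt0// mulrC ler_pdivrMr//.
have := ler_normD (T^-1 * S - J) (J - I); rewrite addrA subrK (distrC J I); clra.
Qed.

End TestLimit.

Theorem theorem2p1 (R : realType) (alpha : R)
    (alpha_gt0 : 0 < alpha) (alpha_lt1 : alpha < 1)
    (z0 : R[i]) (L : set R[i]) (w1 w2 : R[i])
    (L_lattice : lattice_basis L w1 w2)
    (phi psi : nat -> R) (lambda : \bar R)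
    (phi_gt0 : forall N : nat, 0 < phi N)
    (psi_gt0 : forall N : nat, 0 < psi N)
    (phi_oo : phi N @[N --> \oo] --> +oo)
    (lambda_ge0 : (0 <= lambda)%E)
    (phi_lambda :
      (phi N / (N%:R `^ (1 - alpha)))%:E @[N --> \oo] --> lambda)
    (psiE : forall N : nat, (1 <= N)%N ->
      psi N = ((N%:R `^ (2 - alpha)) / phi N) ^+ 2)
    (f : R[i] -> R[i]) (f_Cc : Cc f) :
  forall eps : R, 0 < eps ->
  exists M : nat, forall N N' N'' : nat,
    (1 <= N)%N -> (1 <= N' + N'')%N ->
    (M <= N)%N -> (M <= N' + N'')%N ->
    normc (pair_measure alpha (grid z0 L) phi psi N N' N'' f
           - cintegral (fun z => f z * (rho alpha L (covol w1 w2) lambda z)%:C))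
      < eps.
Proof.
move=> eps eps0; have [B [C test]] := Cc_pos_part f_Cc.
(* Two coordinates, each with a positive and a negative part. *)
have e40 : 0 < eps / 4 by rewrite divr_gt0.
set cov := covol w1 w2.
have part (l : R[i] -> R) : {morph l : z w / z + w} -> lipschitz_part l ->
    (forall (a : R) z, l (a%:C * z) = a * l z) ->
    exists M : nat, forall N N' N'' : nat, (1 <= N)%N -> (M <= N)%N -> (M <= N' + N'')%N ->
    `|l (pair_measure alpha (grid z0 L) phi psi N N' N'' f)
      - (\int[lebesgue2 R]_p l (f (p.1 +i* p.2) * (rho alpha L cov lambda (p.1 +i* p.2))%:C))%R|
    < eps / 2.
  move=> lD lL lZ.
  have t1 := test l lL; have t2 := test _ (lipschitz_opp lL).
  have [I1 I1E H1] := test_limit alpha_gt0 alpha_lt1 z0 L_lattice phi_gt0 phi_oo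
    lambda_ge0 phi_lambda psiE t1.
  have [I2 I2E H2] := test_limit alpha_gt0 alpha_lt1 z0 L_lattice phi_gt0 phi_oo
    lambda_ge0 phi_lambda psiE t2.
  have intg (g : R[i] -> R) (I : R) : test_function g B C ->
      cint (fun w => g w * rho alpha L cov lambda w) = I%:E ->
      (lebesgue2 R).-integrable setT
        (EFin \o (fun p : R * R => g (p.1 +i* p.2) * rho alpha L cov lambda (p.1 +i* p.2))).
    move=> tg gI; have mg := cmeas_test_rho_ereal alpha_gt0 alpha_lt1 L_lattice tg lambda_ge0.
    apply/integrableP; split; first exact/measurable_EFinP.
    apply: (@le_lt_trans _ _ I%:E); last exact: ltry.
    rewrite -gI /cint le_eqVlt; apply/orP; left; apply/eqP; apply: eq_integral => p _ /=.
    congr _%:E; rewrite ger0_norm//; apply: mulr_ge0; first exact: (test_ge0 tg).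
    exact: (rho_ge0 alpha_gt0 alpha_lt1 L_lattice).
  have -> : (\int[lebesgue2 R]_p l (f (p.1 +i* p.2) *
      (rho alpha L cov lambda (p.1 +i* p.2))%:C))%R = I1 - I2.
    (* Both positive parts have finite integral against the density, so the integral of their
       difference splits. *)
    transitivity (\int[lebesgue2 R]_p
      (pos_part l f (p.1 +i* p.2) * rho alpha L cov lambda (p.1 +i* p.2)
       - pos_part (fun z => - l z) f (p.1 +i* p.2) * rho alpha L cov lambda (p.1 +i* p.2)))%R.
      by apply: eq_Rintegral => p _; rewrite mulrC lZ mulrC -mulrBl pos_partB.
    rewrite RintegralB//; [|exact: intg I1E|exact: intg I2E].
    by congr (_ - _); rewrite /Rintegral -[RHS]/(fine _%:E) -?I1E -?I2E.
  have [M1 HM1] := H1 _ e40; have [M2 HM2] := H2 _ e40.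
  exists (M1 + M2)%N => N N' N'' N1 MN MK.
  have := HM1 N N' N'' N1 ltac:(clia) ltac:(clia).
  have := HM2 N N' N'' N1 ltac:(clia) ltac:(clia).
  rewrite (pair_measure_part _ _ L_lattice) ?(proj1 lL)//.
  set T := (_ * _)^-1; set S1 := pair_sum _ _ _ _ _ _ _ _; set S2 := pair_sum _ _ _ _ _ _ _ _.
  move=> h2 h1; rewrite (_ : _ - _ = (T * S2 - I1) - (T * S1 - I2)); last by ring.
  by apply: (le_lt_trans (ler_normB _ _)); clra.
have [M1 HM1] := part _ (@ReD R) (@lipschitz_Re R) (@ReZ R).
have [M2 HM2] := part _ (@ImD R) (@lipschitz_Im R) (@ImZ R).
exists (M1 + M2)%N => N N' N'' N1 _ MN MK.
have h1 := HM1 N N' N'' N1 ltac:(clia) ltac:(clia).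
have h2 := HM2 N N' N'' N1 ltac:(clia) ltac:(clia).
apply: (le_lt_trans (normc_le_ReIm _)); rewrite ReD ImD ReN ImN /cintegral /=.
by rewrite [ltRHS]splitr; exact: ltrD.
Qed.
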